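(* Let $f$, $b_\varepsilon^*$, $b_\varepsilon^+$ be as in the context, and fix $\varepsilon>0$. Consider, for $b>0$, the equation $$\left(\frac{v'}{\sqrt{1+(v')^2}}\right)'-b\,v'+\frac{f(v)}{\varepsilon}=0\qquad\text{on }\mathbb{R}. \tag{E}$$ Then: (i) for every $b\in(b_\varepsilon^*,b_\varepsilon^+)$ there exists a nonmonotone solution $v\in C^2(\mathbb{R})$ of (E), with values in $[0,1]$, such that $v(-\infty)=\alpha$, $v(+\infty)=1$, and $v$ is eventually increasing at $+\infty$ (i.e. increasing on some half-line $[z_0,+\infty)$); (ii) for every $b\in(0,b_\varepsilon^+)$ there exists a nonmonotone solution $v\in C^2(\mathbb{R})$ of (E), with values in $[0,1]$, such that $v(-\infty)=\alpha$, $v(+\infty)=0$, and $v$ is eventually decreasing at $+\infty$ (i.e. decreasing on some half-line $[z_0,+\infty)$).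
   Context: Assumptions on $f$: $f:[0,1]\to\mathbb{R}$ is continuous, $f(0)=f(1)=0$, and there is $\alpha\in(0,1)$ with $f(\alpha)=0$ and $f(s)(s-\alpha)>0$ for every $s\in(0,1)\setminus\{\alpha\}$. Moreover $\int_0^1 f(s)\,ds>0$, the derivative $f'(\alpha)$ exists and is $>0$, and $|f(s)|\le f'(\alpha)|s-\alpha|$ for every $s\in[0,1]$. Finally there is $l>0$ such that $f(s)\ge -ls$ and $f(s)\le l(1-s)$ for every $s\in[0,1]$. Notation: $f^-=\max\{-f,0\}$, $\bar\varepsilon=\int_0^1 f^-(s)\,ds$, and $b_\varepsilon^+=2\sqrt{f'(\alpha)/\varepsilon}$. For $\varepsilon>\bar\varepsilon$, $b_\varepsilon^*$ denotes the unique $b\ge 0$ for which (E) has an increasing solution $v\in C^2(\mathbb{R})$ with $v(-\infty)=0$ and $v(+\infty)=1$; it is known that such a value exists and that $0<b_\varepsilon^*<b_\varepsilon^+$. For $\varepsilon\le\bar\varepsilon$ one sets $b_\varepsilon^*=0$. *)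

(* Defs.v *)
From Stdlib Require Import Reals.
From Coquelicot Require Import Coquelicot.
Open Scope R_scope.

(* [f] is only meaningful on [0,1]: every condition below constrains it there
   and nowhere else ([alpha] is interior, so the two-sided [Derive] is the
   intended derivative; continuity is relative to [0,1]). *)
Record bistable (f : R -> R) (alpha : R) : Prop := {
  bistable_cont : continuous_on (fun s => 0 <= s <= 1) f;
  bistable_f0 : f 0 = 0;
  bistable_f1 : f 1 = 0;
  bistable_alpha : 0 < alpha < 1;
  bistable_falpha : f alpha = 0;
  bistable_sign : forall s, 0 < s < 1 -> s <> alpha -> 0 < f s * (s - alpha);
  bistable_int : 0 < RInt f 0 1;
  bistable_ex_derive : ex_derive f alpha;
  bistable_derive_pos : 0 < Derive f alpha;
  bistable_lin_alpha :
    forall s, 0 <= s <= 1 -> Rabs (f s) <= Derive f alpha * Rabs (s - alpha);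
  bistable_lin_ends :
    exists l, 0 < l /\
      forall s, 0 <= s <= 1 -> - l * s <= f s /\ f s <= l * (1 - s)
}.

Definition neg_part (f : R -> R) (s : R) : R := Rmax (- f s) 0.

Definition eps_bar (f : R -> R) : R := RInt (neg_part f) 0 1.

Definition b_plus (f : R -> R) (alpha eps : R) : R :=
  2 * sqrt (Derive f alpha / eps).

(* [Derive] is total, so differentiability is required at both orders. *)
Definition C2 (v : R -> R) : Prop :=
  (forall z, ex_derive v z) /\
  (forall z, ex_derive (Derive v) z) /\
  (forall z, continuous (Derive (Derive v)) z).

(* The range condition is part of the notion of solution because [f] is given
   on [0,1] only. *)
Definition solution (f : R -> R) (eps b : R) (v : R -> R) : Prop :=
  C2 v /\
  (forall z, 0 <= v z <= 1) /\
  (forall z,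
     Derive (fun t => Derive v t / sqrt (1 + (Derive v t) ^ 2)) z
       - b * Derive v z + f (v z) / eps = 0).

Definition increasing_front (f : R -> R) (eps b : R) (v : R -> R) : Prop :=
  solution f eps b v /\
  strict_increasing v /\
  is_lim v m_infty 0 /\
  is_lim v p_infty 1.

Definition is_b_star (f : R -> R) (eps bstar : R) : Prop :=
  (eps_bar f < eps ->
     unique (fun b => 0 <= b /\ exists v, increasing_front f eps b v) bstar) /\
  (eps <= eps_bar f -> bstar = 0).

(* [increasing] and [decreasing] are the non-strict notions. *)
Definition nonmonotone (v : R -> R) : Prop := ~ increasing v /\ ~ decreasing v.

Definition eventually_increasing (v : R -> R) : Prop :=
  exists z0, forall x y, z0 <= x -> x < y -> v x < v y.

Definition eventually_decreasing (v : R -> R) : Prop :=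
  exists z0, forall x y, z0 <= x -> x < y -> v y < v x.

(* Main.v *)
Require Import Defs.
From Stdlib Require Import Reals.
From Stdlib Require Import Lra Lia Psatz Classical ClassicalEpsilon Cantor.
From Coquelicot Require Import Coquelicot.
Open Scope R_scope.

(** Read backwards in [z], (E) is the damped system u' = psi p, p' = - b psi p - g u, where
    p = u' / sqrt (1 + u'^2), psi p = p / sqrt (1 - p^2) and g is f / eps; the damping keeps
    |p| away from 1. For (ii) take u z = v (- z); for (i), u z = 1 - v (- z), so that in both
    cases the trajectory leaves the saddle (0, 0) and has to reach the equilibrium (al, 0).
    As g is only continuous, trajectories come from Peano's theorem, and the unstable one is a
    limit, in the phase where u = al / 2 at time 0, of trajectories starting ever closer to
    the saddle.
    The energy V = 1 - sqrt (1 - p^2) + G u decreases. Since b^2 < 4 g'(al), the trajectory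
    cannot approach al monotonically, hence crosses it. Once V < min (G 0) (G 1) it is
    trapped in (0, 1), and converges to al by LaSalle's argument. In (ii), 0 = G 0 < G 1 and
    nothing remains to be shown. In (i), V may only drop below G 1 later: if eps <= eps_bar,
    then V < G 1 at the crossing, because kinetic energies are less than 1; if
    eps > eps_bar, the increasing front for bstar < b gives a phase curve p = Q u below
    which the trajectory stays, at a distance which increases when u > al, whereas Q
    vanishes at 1: hence p vanishes while u is in (al, 1). *)

(** The obstacle is the lack of uniqueness: [g] is merely continuous, so no phase-plane argument may
    say that trajectories cannot meet. Strict signs come instead from differential inequalities,
    based on linear bounds for [psi] on the strip [Rabs p <= P] and for [g] at the saddle.
    Comparison with [Q] rests on the strict inequality [b0 < b]: where [p = Q u] the gap [Q u - p]
    has a positive derivative, so the curve cannot be crossed upwards. Nothing guarantees that an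
    arbitrary trajectory leaving the saddle lies below [Q]; the approximations are therefore all
    started below [Q], which is a closed condition and survives in the limit. The number [P] is
    chosen so that the damping [b * psi P] exceeds the largest force, which makes the strip
    invariant. The force is extended by 0 outside [0, 1], so that trajectories are global before
    anything is known about their range. Monotonicity of [v] near plus infinity is that of [u] at
    negative times; nonmonotonicity holds because [u] takes values on both sides of its limit
    [al]. *)

(** * Mean value inequalities and hitting times *)

Lemma is_derive_continuity_pt (f : R -> R) x l :
  is_derive f x l -> continuity_pt f x.
Proof.
  intros H. apply continuity_pt_filterlim.
  apply (ex_derive_continuous f x). now exists l.
Qed.

(** Differentiability is asked in the open interval only, because a trajectory solves the system
    strictly after its starting time and is merely continuous there. The intermediate point is
    interior too, so slope bounds are needed only inside. *)
Lemma mvt_open (f df : R -> R) a b :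
  a < b ->
  (forall x, a < x < b -> is_derive f x (df x)) ->
  (forall x, a <= x <= b -> continuity_pt f x) ->
  exists c, a < c < b /\ f b - f a = df c * (b - a).
Proof.
  intros Hab Hd Hc.
  assert (pr1 : forall c, a < c < b -> derivable_pt f c).
  { intros c Hc'. exists (df c). apply is_derive_Reals. now apply Hd. }
  assert (pr2 : forall c, a < c < b -> derivable_pt id c).
  { intros c _. apply derivable_pt_id. }
  destruct (MVT f id a b pr1 pr2 Hab Hc) as (c & Hcc & E).
  { intros c _. apply derivable_continuous_pt, derivable_pt_id. }
  exists c. split; [exact Hcc|].
  assert (E1 : derive_pt f c (pr1 c Hcc) = df c).
  { apply derive_pt_eq_0. apply is_derive_Reals. now apply Hd. }
  assert (E2 : derive_pt id c (pr2 c Hcc) = 1).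
  { apply derive_pt_eq_0. apply derivable_pt_lim_id. }
  rewrite E1, E2 in E. unfold id in E. lra.
Qed.

Lemma derive_nonneg_le (f df : R -> R) a b :
  a <= b ->
  (forall x, a < x < b -> is_derive f x (df x)) ->
  (forall x, a <= x <= b -> continuity_pt f x) ->
  (forall x, a < x < b -> 0 <= df x) -> f a <= f b.
Proof.
  intros Hab Hd Hc Hp. destruct (Rle_lt_or_eq_dec _ _ Hab) as [Hlt|<-]; [|lra].
  destruct (mvt_open f df a b Hlt Hd Hc) as (c & Hcc & E).
  specialize (Hp c Hcc). nra.
Qed.

Lemma derive_ge_slope (f df : R -> R) k a b :
  a <= b ->
  (forall x, a < x < b -> is_derive f x (df x)) ->
  (forall x, a <= x <= b -> continuity_pt f x) ->
  (forall x, a < x < b -> k <= df x) -> k * (b - a) <= f b - f a.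
Proof.
  intros Hab Hd Hc Hp. destruct (Rle_lt_or_eq_dec _ _ Hab) as [Hlt|<-]; [|lra].
  destruct (mvt_open f df a b Hlt Hd Hc) as (c & Hcc & E).
  specialize (Hp c Hcc). nra.
Qed.

Lemma derive_le_slope (f df : R -> R) k a b :
  a <= b ->
  (forall x, a < x < b -> is_derive f x (df x)) ->
  (forall x, a <= x <= b -> continuity_pt f x) ->
  (forall x, a < x < b -> df x <= k) -> f b - f a <= k * (b - a).
Proof.
  intros Hab Hd Hc Hp. destruct (Rle_lt_or_eq_dec _ _ Hab) as [Hlt|<-]; [|lra].
  destruct (mvt_open f df a b Hlt Hd Hc) as (c & Hcc & E).
  specialize (Hp c Hcc). nra.
Qed.

Lemma derive_pos_lt (f df : R -> R) a b :
  a < b ->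
  (forall x, a < x < b -> is_derive f x (df x)) ->
  (forall x, a <= x <= b -> continuity_pt f x) ->
  (forall x, a < x < b -> 0 < df x) -> f a < f b.
Proof.
  intros Hlt Hd Hc Hp.
  destruct (mvt_open f df a b Hlt Hd Hc) as (c & Hcc & E).
  specialize (Hp c Hcc). nra.
Qed.

Lemma continuity_pt_eps (f : R -> R) x :
  continuity_pt f x ->
  forall e, 0 < e -> exists d, 0 < d /\ forall y, Rabs (y - x) < d -> Rabs (f y - f x) < e.
Proof.
  intros H e He. destruct (H e He) as (d & Hd & Hx). exists d. split; [exact Hd|].
  intros y Hy. destruct (Req_dec y x) as [->|Hne].
  - rewrite Rminus_diag_eq by reflexivity. rewrite Rabs_R0. exact He.
  - apply Hx. split; [|exact Hy]. split; [exact I|auto].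
Qed.

Lemma continuity_pt_of_eps (f : R -> R) x :
  (forall e, 0 < e -> exists d, 0 < d /\ forall y, Rabs (y - x) < d -> Rabs (f y - f x) < e) ->
  continuity_pt f x.
Proof.
  intros H e He. destruct (H e He) as (d & Hd & Hx). exists d. split; [exact Hd|].
  intros y [_ Hy]. now apply Hx.
Qed.

(** [T] is the supremum of the times up to which [f] stays below [c]. Continuity excludes [f T < c],
    since [T] could be increased, and [f T > c], since slightly smaller times would already violate
    the bound. *)
Lemma first_hit (f : R -> R) c a b :
  a <= b -> (forall t, a <= t <= b -> continuity_pt f t) ->
  f a < c <= f b ->
  exists T, a < T <= b /\ f T = c /\ forall s, a <= s < T -> f s < c.
Proof.
  intros Hab Hc [Ha Hb].
  set (E := fun t => a <= t <= b /\ forall s, a <= s <= t -> f s < c).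
  destruct (completeness E) as (T & HT1 & HT2).
  { exists b. intros t [Ht _]. lra. }
  { exists a. split; [lra|]. intros s Hs. replace s with a by lra. exact Ha. }
  assert (HaT : a <= T).
  { apply HT1. split; [lra|]. intros s Hs. replace s with a by lra. exact Ha. }
  assert (HTb : T <= b). { apply HT2. intros t [Ht _]. lra. }
  assert (Hbelow : forall s, a <= s < T -> f s < c).
  { intros s Hs. apply NNPP. intros Hn.
    assert (T <= s); [|lra]. apply HT2. intros t [Ht1 Ht2].
    apply Rnot_lt_le. intros Hst. apply Hn, Ht2. lra. }
  assert (HfT : f T = c).
  { destruct (Rtotal_order (f T) c) as [Hlt|[Heq|Hgt]]; [exfalso|exact Heq|exfalso].
    - destruct (continuity_pt_eps f T (Hc T ltac:(lra)) (c - f T) ltac:(lra)) as (d & Hd & Hx).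
      assert (T <> b) by (intros ->; lra).
      set (t := Rmin b (T + d / 2)).
      assert (Ht : T < t <= b /\ t <= T + d / 2).
      { unfold t. repeat split; [apply Rmin_glb_lt; lra|apply Rmin_l|apply Rmin_r]. }
      assert (t <= T); [|lra]. apply HT1. split; [lra|].
      intros s Hs. destruct (Rlt_dec s T) as [h|h]; [apply Hbelow; lra|].
      assert (Hs' : Rabs (s - T) < d) by (rewrite Rabs_pos_eq; lra).
      apply Hx in Hs'. apply Rabs_def2 in Hs'. lra.
    - destruct (continuity_pt_eps f T (Hc T ltac:(lra)) (f T - c) ltac:(lra)) as (d & Hd & Hx).
      assert (T <> a) by (intros ->; lra).
      set (t := Rmax a (T - d / 2)).
      assert (Ht : a <= t < T /\ T - d / 2 <= t).
      { unfold t. repeat split; [apply Rmax_l|apply Rmax_lub_lt; lra|apply Rmax_r]. }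
      assert (Hs' : Rabs (t - T) < d) by (rewrite Rabs_left; lra).
      apply Hx in Hs'. apply Rabs_def2 in Hs'.
      specialize (Hbelow t ltac:(lra)). lra. }
  exists T. repeat split; try assumption.
  destruct (Req_dec T a) as [->|]; lra.
Qed.

(** [first_hit] after time reversal. *)
Lemma last_exit (f : R -> R) a b :
  a <= b -> (forall t, a <= t <= b -> continuity_pt f t) ->
  f b < 0 <= f a ->
  exists T, a <= T < b /\ f T = 0 /\ forall s, T < s <= b -> f s < 0.
Proof.
  intros Hab Hc H.
  destruct (first_hit (fun t => f (- t)) 0 (- b) (- a)) as (T & HT & E & Hs).
  - lra.
  - intros t Ht. apply (continuity_pt_comp Ropp f).
    + apply continuity_pt_opp, derivable_continuous_pt, derivable_pt_id.
    + apply Hc. lra.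
  - rewrite !Ropp_involutive. exact H.
  - exists (- T). split; [lra|]. split; [exact E|].
    intros s Hs'. rewrite <- (Ropp_involutive s). apply Hs. lra.
Qed.

(** * Compactness of equi-Lipschitz sequences *)

Lemma bounded_subseq_cv (x : nat -> R) B :
  (forall n, Rabs (x n) <= B) ->
  exists d : nat -> nat, (forall n, (d n < d (S n))%nat) /\ ex_finite_lim_seq (fun n => x (d n)).
Proof.
  intros HB.
  destruct (Bolzano_Weierstrass x (fun y => - B <= y <= B)) as (l & Hl).
  { apply compact_P3. }
  { intros n. specialize (HB n). apply Rabs_le_between in HB. exact HB. }
  assert (Hex : forall N k, exists p, (N <= p)%nat /\ Rabs (x p - l) < / (INR k + 1)).
  { intros N k. apply (Hl (fun y => Rabs (y - l) < / (INR k + 1)) N).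
    assert (Hk : 0 < / (INR k + 1)) by (apply Rinv_0_lt_compat; pose proof (pos_INR k); lra).
    exists (mkposreal _ Hk). intros y Hy. exact Hy. }
  set (nxt := fun N k => proj1_sig (constructive_indefinite_description _ (Hex N k))).
  assert (Hn : forall N k, (N <= nxt N k)%nat /\ Rabs (x (nxt N k) - l) < / (INR k + 1)).
  { intros N k. unfold nxt. now destruct constructive_indefinite_description. }
  (* Each index lies beyond the previous one and is taken with tolerance [/ (INR n + 1)]: the
     extraction is strictly increasing and converges to [l]. *)
  set (d := fix d n := match n with O => nxt O O | S n' => nxt (S (d n')) (S n') end).
  exists d. split.
  - intros n. simpl. destruct (Hn (S (d n)) (S n)). lia.
  - exists l. apply is_lim_seq_spec. intros e.
    destruct (nfloor_ex (/ e)) as (N & HN).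
    { left. apply Rinv_0_lt_compat, cond_pos. }
    exists (S N). intros n Hn'.
    assert (Hd : Rabs (x (d n) - l) < / (INR n + 1)).
    { destruct n; [lia|]. apply Hn. }
    apply Rlt_trans with (1 := Hd).
    rewrite <- (Rinv_inv e). apply Rinv_lt_contravar.
    + apply Rmult_lt_0_compat; [apply Rinv_0_lt_compat, cond_pos|].
      pose proof (pos_INR n); lra.
    + assert (INR N + 1 <= INR n). { rewrite <- S_INR. apply le_INR. lia. } lra.
Qed.

Lemma extraction_ge (d : nat -> nat) :
  (forall n, (d n < d (S n))%nat) -> forall n, (n <= d n)%nat.
Proof. intros H n. induction n; [lia|]. specialize (H n). lia. Qed.

Lemma extraction_mono (d : nat -> nat) :
  (forall n, (d n < d (S n))%nat) -> forall n m, (n <= m)%nat -> (d n <= d m)%nat.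
Proof. intros H n m Hnm. induction Hnm; [lia|]. specialize (H m). lia. Qed.

(** [e] need not be monotone, nor controlled at small ranks: a diagonal sequence is a reindexing of
    the k-th extraction only from some rank on. *)
Lemma is_lim_seq_reindex (x : nat -> R) (e : nat -> nat) (l : R) :
  (exists N, forall n, (N <= n)%nat -> (n <= e n + N)%nat) ->
  is_lim_seq x l -> is_lim_seq (fun n => x (e n)) l.
Proof.
  intros (N & He) Hx. apply is_lim_seq_spec. apply is_lim_seq_spec in Hx.
  intros eps. destruct (Hx eps) as (M & HM). exists (M + N)%nat. intros n Hn.
  apply HM. specialize (He n). lia.
Qed.

(** Cantor's diagonal argument: [phi (S k)] refines [phi k] so that [x k] converges along it. From
    rank [S k] on, [phi n n] is a value of [phi (S k)] at an index at least [n], hence inherits the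
    limit. *)
Lemma diagonal_subseq (x : nat -> nat -> R) (B : nat -> R) :
  (forall k n, Rabs (x k n) <= B k) ->
  exists d : nat -> nat, (forall n, (n <= d n)%nat) /\
    forall k, ex_finite_lim_seq (fun n => x k (d n)).
Proof.
  intros HB.
  assert (Hex : forall (k : nat) (p : nat -> nat), exists s : nat -> nat,
    (forall n, (s n < s (S n))%nat) /\ ex_finite_lim_seq (fun n => x k (p (s n)))).
  { intros k p. apply (bounded_subseq_cv (fun n => x k (p n)) (B k)). intros; apply HB. }
  set (sub := fun k p => proj1_sig (constructive_indefinite_description _ (Hex k p))).
  assert (Hsub : forall k p, (forall n, (sub k p n < sub k p (S n))%nat) /\
    ex_finite_lim_seq (fun n => x k (p (sub k p n)))).
  { intros k p. unfold sub. now destruct constructive_indefinite_description. }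
  set (phi := fix phi k := match k with
    | O => fun n : nat => n | S k' => fun n => phi k' (sub k' (phi k') n) end).
  assert (Hphi : forall k n, (phi k n < phi k (S n))%nat).
  { induction k; intros n; [simpl; lia|]. simpl.
    apply Nat.lt_le_trans with (phi k (S (sub k (phi k) n))); [apply IHk|].
    apply extraction_mono; [exact IHk|]. apply Hsub. }
  assert (Hfac : forall k j n, (k + j <= n)%nat ->
    exists m, (n <= m)%nat /\ phi (k + j)%nat n = phi k m).
  { intros k j. induction j as [|j IH]; intros n Hn.
    - exists n. rewrite Nat.add_0_r. split; [lia|reflexivity].
    - rewrite Nat.add_succ_r. simpl.
      set (m := sub (k + j)%nat (phi (k + j)%nat) n).
      assert (Hm : (n <= m)%nat) by (apply extraction_ge, Hsub).
      destruct (IH m ltac:(lia)) as (m' & Hm' & ->). exists m'. split; [lia|reflexivity]. }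
  exists (fun n => phi n n). split; [intros n; now apply extraction_ge|].
  intros k.
  assert (Hex2 : forall n, exists m, (S k <= n)%nat -> (n <= m)%nat /\ phi n n = phi (S k) m).
  { intros n. destruct (Compare_dec.le_dec (S k) n) as [h|h]; [|exists 0%nat; lia].
    destruct (Hfac (S k) (n - S k)%nat n ltac:(lia)) as (m & Hm & E).
    replace (S k + (n - S k))%nat with n in E by lia. exists m. auto. }
  set (e := fun n => proj1_sig (constructive_indefinite_description _ (Hex2 n))).
  assert (He : forall n, (S k <= n)%nat -> (n <= e n)%nat /\ phi n n = phi (S k) (e n)).
  { intros n. unfold e. now destruct constructive_indefinite_description. }
  destruct (Hsub k (phi k)) as (_ & l & Hl). exists l.
  apply is_lim_seq_ext_loc with (fun n => x k (phi (S k) (e n))).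
  - exists (S k). intros n Hn. destruct (He n Hn) as [_ ->]. reflexivity.
  - apply (is_lim_seq_reindex (fun m => x k (phi (S k) m)) e); [|exact Hl].
    exists (S k). intros n Hn. destruct (He n Hn). lia.
Qed.

Definition rational_enum (k : nat) : R :=
  let (a, c) := Cantor.of_nat k in
  let (a1, a2) := Cantor.of_nat a in (INR a1 - INR a2) / (INR c + 1).

Lemma rational_enum_dense t e :
  0 < e -> exists k, Rabs (rational_enum k - t) < e.
Proof.
  intros He. destruct (nfloor_ex (/ e)) as (c & Hc).
  { left. now apply Rinv_0_lt_compat. }
  destruct (archimed (t * (INR c + 1))) as [H1 H2].
  set (z := up (t * (INR c + 1))) in *.
  exists (Cantor.to_nat (Cantor.to_nat (Z.to_nat z, Z.to_nat (- z)), c)).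
  unfold rational_enum. rewrite !Cantor.cancel_of_to.
  assert (E : INR (Z.to_nat z) - INR (Z.to_nat (- z)) = IZR z).
  { rewrite !INR_IZR_INZ, <- minus_IZR. f_equal. lia. }
  rewrite E. pose proof (pos_INR c) as Hp.
  assert (E2 : IZR z / (INR c + 1) - t = (IZR z - t * (INR c + 1)) / (INR c + 1)) by (field; lra).
  rewrite E2, Rabs_pos_eq.
  - apply Rle_lt_trans with (/ (INR c + 1)).
    + unfold Rdiv. rewrite <- (Rmult_1_l (/ (INR c + 1))) at 2.
      apply Rmult_le_compat_r; [left; apply Rinv_0_lt_compat; lra|lra].
    + rewrite <- (Rinv_inv e). apply Rinv_lt_contravar; [|lra].
      apply Rmult_lt_0_compat; [now apply Rinv_0_lt_compat|lra].
  - apply Rmult_le_pos; [lra|]. left. apply Rinv_0_lt_compat. lra.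
Qed.

Definition lipschitz (K : R) (u : R -> R) : Prop :=
  forall s t, Rabs (u s - u t) <= K * Rabs (s - t).

Lemma lipschitz_continuity_pt K u : lipschitz K u -> forall t, continuity_pt u t.
Proof.
  intros H t. apply continuity_pt_of_eps. intros e He.
  assert (HK : 0 <= Rabs K) by apply Rabs_pos.
  (* [K] carries no sign condition; [Rabs K + 1] is a positive substitute. *)
  exists (e / (Rabs K + 1)). split; [apply Rdiv_lt_0_compat; lra|].
  intros y Hy. specialize (H y t).
  apply Rle_lt_trans with (1 := H).
  assert (H1 : (Rabs K + 1) * Rabs (y - t) < e).
  { apply Rlt_div_r in Hy; [|lra]. rewrite Rmult_comm. exact Hy. }
  pose proof (Rabs_pos (y - t)). pose proof (Rle_abs K). nra.
Qed.

Lemma lipschitz_lim (un : nat -> R -> R) (u : R -> R) K :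
  (forall n, lipschitz K (un n)) ->
  (forall t, is_lim_seq (fun n => un n t) (u t)) -> lipschitz K u.
Proof.
  intros HL Hl s t.
  apply (is_lim_seq_le (fun n => Rabs (un n s - un n t)) (fun _ => K * Rabs (s - t))
    (Rabs (u s - u t)) (K * Rabs (s - t))).
  - intros n. apply HL.
  - apply is_lim_seq_abs with (l := Finite (u s - u t)). apply is_lim_seq_minus'; apply Hl.
  - apply is_lim_seq_const.
Qed.

(** Cauchy at [t] by comparison with a nearby rational: two Lipschitz errors of at most [e / 4]
    each, plus [e / 2] from convergence at the rational. *)
Lemma lipschitz_dense_cv (un : nat -> R -> R) K :
  (forall n, lipschitz K (un n)) ->
  (forall k, ex_finite_lim_seq (fun n => un n (rational_enum k))) ->
  forall t, ex_finite_lim_seq (fun n => un n t).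
Proof.
  intros HL Hk t. apply ex_lim_seq_cauchy_corr. intros e.
  assert (He := cond_pos e).
  assert (HK : 0 <= Rabs K) by apply Rabs_pos.
  destruct (rational_enum_dense t (e / (4 * (Rabs K + 1)))) as (k & Hr).
  { apply Rdiv_lt_0_compat; lra. }
  specialize (Hk k). apply ex_lim_seq_cauchy_corr in Hk.
  assert (He2 : 0 < e / 2) by lra.
  destruct (Hk (mkposreal _ He2)) as (N & HN). exists N. intros n m Hn Hm.
  specialize (HN n m Hn Hm). simpl in HN.
  pose proof (HL n (rational_enum k) t) as A1.
  pose proof (HL m (rational_enum k) t) as A2.
  apply Rlt_div_r in Hr; [|lra].
  pose proof (Rabs_pos (rational_enum k - t)). pose proof (Rle_abs K).
  assert (A3 : K * Rabs (rational_enum k - t) <= e / 4) by nra.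
  apply Rabs_def1.
  - apply Rabs_def2 in HN. apply Rabs_le_between in A1. apply Rabs_le_between in A2. lra.
  - apply Rabs_def2 in HN. apply Rabs_le_between in A1. apply Rabs_le_between in A2. lra.
Qed.

(** Arzela-Ascoli for two sequences along one common extraction. Pointwise limits suffice, the
    common Lipschitz constant providing the uniformity used later. *)
Lemma lipschitz_compactness (un pn : nat -> R -> R) K B :
  (forall n, lipschitz K (un n)) -> (forall n, lipschitz K (pn n)) ->
  (forall n, Rabs (un n 0) <= B) -> (forall n, Rabs (pn n 0) <= B) ->
  exists (d : nat -> nat) (u p : R -> R), (forall n, (n <= d n)%nat) /\
    (forall t, is_lim_seq (fun n => un (d n) t) (u t)) /\
    (forall t, is_lim_seq (fun n => pn (d n) t) (p t)).
Proof.
  intros HLu HLp Hu Hp.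
  assert (Hbd : forall (v : R -> R) t, lipschitz K v -> Rabs (v 0) <= B ->
    Rabs (v t) <= B + K * Rabs t).
  { intros v t Hv H0. specialize (Hv t 0). rewrite Rminus_0_r in Hv.
    replace (v t) with (v 0 + (v t - v 0)) by ring.
    apply Rle_trans with (1 := Rabs_triang _ _). lra. }
  (* Even ranks carry [un], odd ranks [pn], so that a single diagonal extraction serves both. *)
  set (x := fun k n => if Nat.even k then un n (rational_enum (Nat.div2 k))
                       else pn n (rational_enum (Nat.div2 k))).
  destruct (diagonal_subseq x (fun k => B + K * Rabs (rational_enum (Nat.div2 k))))
    as (d & Hd & Hcv).
  { intros k n. unfold x. destruct (Nat.even k); apply Hbd; auto. }
  assert (Cu : forall t, ex_finite_lim_seq (fun n => un (d n) t)).
  { apply (lipschitz_dense_cv (fun n => un (d n)) K); [auto|]. intros k.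
    specialize (Hcv (2 * k)%nat). unfold x in Hcv.
    rewrite Nat.even_even, Nat.div2_double in Hcv. exact Hcv. }
  assert (Cp : forall t, ex_finite_lim_seq (fun n => pn (d n) t)).
  { apply (lipschitz_dense_cv (fun n => pn (d n)) K); [auto|]. intros k.
    specialize (Hcv (S (2 * k))%nat). unfold x in Hcv.
    rewrite Nat.even_succ, Nat.odd_even, Nat.div2_succ_double in Hcv. exact Hcv. }
  exists d, (fun t => real (Lim_seq (fun n => un (d n) t))),
    (fun t => real (Lim_seq (fun n => pn (d n) t))).
  split; [exact Hd|]. split; intros t; apply Lim_seq_correct'; auto.
Qed.

(** The difference quotients of [xn n] at [t] are values of [yn n] at intermediate points, hence
    within [e / 2] of [y] uniformly in [n] and in small [h]; the bound passes to the limit in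
    [n]. *)
Lemma limit_is_derive (xn yn : nat -> R -> R) (x : R -> R) t y rho N :
  (forall s, is_lim_seq (fun n => xn n s) (x s)) -> 0 < rho ->
  (forall n s, (N <= n)%nat -> Rabs (s - t) < rho -> is_derive (xn n) s (yn n s)) ->
  (forall e, 0 < e -> exists d M, 0 < d /\ forall n s, (M <= n)%nat -> Rabs (s - t) < d ->
    Rabs (yn n s - y) < e) ->
  is_derive x t y.
Proof.
  intros Hlim Hrho Hder Hy. apply is_derive_Reals. intros e He.
  destruct (Hy (e / 2) ltac:(lra)) as (d & M & Hd & HM).
  assert (Hr : 0 < Rmin d rho) by (now apply Rmin_glb_lt).
  exists (mkposreal _ Hr). intros h Hh0 Hh. simpl in Hh.
  assert (Hh1 : Rabs h < d) by (apply Rlt_le_trans with (1 := Hh), Rmin_l).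
  assert (Hh2 : Rabs h < rho) by (apply Rlt_le_trans with (1 := Hh), Rmin_r).
  apply Rle_lt_trans with (e / 2); [|lra].
  apply (is_lim_seq_le_loc (fun n => Rabs ((xn n (t + h) - xn n t) / h - y)) (fun _ => e / 2)
    (Rabs ((x (t + h) - x t) / h - y)) (e / 2)).
  - exists (N + M)%nat. intros n Hn.
    assert (Hin : forall s, Rmin t (t + h) <= s <= Rmax t (t + h) -> Rabs (s - t) <= Rabs h).
    { intros s. unfold Rmin, Rmax, Rabs.
      repeat destruct Rle_dec; repeat destruct Rcase_abs; lra. }
    destruct (MVT_gen (xn n) t (t + h) (yn n)) as (c & Hc & E).
    + intros s Hs. apply Hder; [lia|]. apply Rle_lt_trans with (2 := Hh2). apply Hin. lra.
    + intros s Hs. apply is_derive_continuity_pt with (yn n s). apply Hder; [lia|].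
      apply Rle_lt_trans with (2 := Hh2). apply Hin. lra.
    + rewrite E. replace (yn n c * (t + h - t) / h) with (yn n c) by (field; exact Hh0).
      left. apply HM; [lia|]. apply Rle_lt_trans with (2 := Hh1). now apply Hin.
  - apply is_lim_seq_abs with (l := Finite ((x (t + h) - x t) / h - y)).
    apply is_lim_seq_minus'; [|apply is_lim_seq_const].
    apply is_lim_seq_mult' with (l2 := / h); [|apply is_lim_seq_const].
    apply is_lim_seq_minus'; apply Hlim.
  - apply is_lim_seq_const.
Qed.

Definition continuous2_at (F : R -> R -> R) u p : Prop :=
  forall e, 0 < e -> exists d, 0 < d /\ forall u' p',
    Rabs (u' - u) < d -> Rabs (p' - p) < d -> Rabs (F u' p' - F u p) < e.

(** This supplies the last hypothesis of [limit_is_derive]: convergence at the single time [t]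
    spreads to a neighbourhood independent of [n] through the common Lipschitz constant. *)
Lemma equicontinuous_field (F : R -> R -> R) (un pn : nat -> R -> R) (u p K t : R) :
  (forall n, lipschitz K (un n)) -> (forall n, lipschitz K (pn n)) ->
  is_lim_seq (fun n => un n t) u -> is_lim_seq (fun n => pn n t) p ->
  continuous2_at F u p ->
  forall e, 0 < e -> exists d M, 0 < d /\ forall n s, (M <= n)%nat -> Rabs (s - t) < d ->
    Rabs (F (un n s) (pn n s) - F u p) < e.
Proof.
  intros HLu HLp Hu Hp HF e He.
  destruct (HF e He) as (d & Hd & HFd).
  assert (HK : 0 <= Rabs K) by apply Rabs_pos.
  assert (Hd2 : 0 < d / 2) by lra.
  apply is_lim_seq_spec in Hu, Hp.
  destruct (Hu (mkposreal _ Hd2)) as (N1 & H1). destruct (Hp (mkposreal _ Hd2)) as (N2 & H2).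
  exists (d / (2 * (Rabs K + 1))), (N1 + N2)%nat.
  split; [apply Rdiv_lt_0_compat; lra|]. intros n s Hn Hs.
  apply Rlt_div_r in Hs; [|lra].
  pose proof (Rabs_pos (s - t)). pose proof (Rle_abs K).
  assert (A : K * Rabs (s - t) <= d / 2) by nra.
  specialize (H1 n ltac:(lia)). specialize (H2 n ltac:(lia)). simpl in H1, H2.
  specialize (HLu n s t). specialize (HLp n s t).
  apply HFd.
  - replace (un n s - u) with ((un n s - un n t) + (un n t - u)) by ring.
    apply Rle_lt_trans with (1 := Rabs_triang _ _). lra.
  - replace (pn n s - p) with ((pn n s - pn n t) + (pn n t - p)) by ring.
    apply Rle_lt_trans with (1 := Rabs_triang _ _). lra.
Qed.

Lemma lipschitz_of_derive (f df : R -> R) K :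
  (forall t, is_derive f t (df t)) -> (forall t, Rabs (df t) <= K) -> lipschitz K f.
Proof.
  intros Hd Hb s t.
  destruct (MVT_gen f t s df) as (c & _ & E).
  - intros; apply Hd.
  - intros x _. apply is_derive_continuity_pt with (df x), Hd.
  - rewrite E, Rabs_mult. apply Rmult_le_compat_r; [apply Rabs_pos|apply Hb].
Qed.

Lemma continuous2_comp (F : R -> R -> R) (u p : R -> R) t :
  continuous2_at F (u t) (p t) -> continuity_pt u t -> continuity_pt p t ->
  continuity_pt (fun s => F (u s) (p s)) t.
Proof.
  intros HF Hu Hp. apply continuity_pt_of_eps. intros e He.
  destruct (HF e He) as (d & Hd & HFd).
  destruct (continuity_pt_eps u t Hu d Hd) as (d1 & Hd1 & H1).
  destruct (continuity_pt_eps p t Hp d Hd) as (d2 & Hd2 & H2).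
  exists (Rmin d1 d2). split; [now apply Rmin_glb_lt|]. intros y Hy.
  apply HFd; [apply H1|apply H2]; apply Rlt_le_trans with (1 := Hy); [apply Rmin_l|apply Rmin_r].
Qed.

(** * Peano's existence theorem in the plane *)

(* Vanishes for s <= 0, so that the delayed equation below is C^1 across s = 0. *)
Definition ramp (h s : R) : R := Rmax 0 (Rmin 1 (s / h)).

Lemma ramp_bounds h s : 0 <= ramp h s <= 1.
Proof.
  unfold ramp. split; [apply Rmax_l|]. apply Rmax_lub; [lra|apply Rmin_l].
Qed.

Lemma ramp_neg h s : 0 < h -> s <= 0 -> ramp h s = 0.
Proof.
  intros Hh Hs. unfold ramp. apply Rmax_left.
  apply Rle_trans with (1 := Rmin_r _ _).
  apply Rmult_le_reg_r with h; [exact Hh|]. unfold Rdiv. rewrite Rmult_assoc, Rinv_l; lra.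
Qed.

Lemma ramp_one h s : 0 < h -> h <= s -> ramp h s = 1.
Proof.
  intros Hh Hs. unfold ramp.
  assert (1 <= s / h).
  { apply Rmult_le_reg_r with h; [exact Hh|]. unfold Rdiv. rewrite Rmult_assoc, Rinv_l; lra. }
  rewrite Rmin_left, Rmax_right; lra.
Qed.

Lemma ramp_continuity_pt h : forall s, continuity_pt (ramp h) s.
Proof.
  intros s. apply continuity_pt_of_eps. intros e He.
  destruct (continuity_pt_eps (fun s => s / h) s) with (e := e) as (d & Hd & Hx); [|exact He|].
  { apply continuity_pt_mult; [apply derivable_continuous_pt, derivable_pt_id|].
    apply continuity_pt_const. intros ? ?. reflexivity. }
  exists d. split; [exact Hd|]. intros y Hy. specialize (Hx y Hy).
  revert Hx. unfold ramp, Rmax, Rmin, Rabs.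
  repeat destruct Rle_dec; repeat destruct Rcase_abs; lra.
Qed.

Section Peano.

Variables (F1 F2 : R -> R -> R) (K u0 p0 : R).
Hypothesis F1_cont : forall u p, continuous2_at F1 u p.
Hypothesis F2_cont : forall u p, continuous2_at F2 u p.
Hypothesis F1_bound : forall u p, Rabs (F1 u p) <= K.
Hypothesis F2_bound : forall u p, Rabs (F2 u p) <= K.

(** Right-hand side of Tonelli's approximation: the field is evaluated a time [h] earlier, so that
    the equation is solved by plain integration. *)
Definition delayed (F : R -> R -> R) h (x : (R -> R) * (R -> R)) s : R :=
  ramp h s * F (fst x (s - h)) (snd x (s - h)).

(** Each integration determines the solution on one more interval of length [h], so the k-th iterate
    is exact up to time [INR k * h]. Keeping total functions avoids gluing pieces. *)
Fixpoint tonelli (h : R) (k : nat) : (R -> R) * (R -> R) :=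
  match k with
  | O => (fun _ => u0, fun _ => p0)
  | S k' => (fun t => u0 + RInt (delayed F1 h (tonelli h k')) 0 t,
             fun t => p0 + RInt (delayed F2 h (tonelli h k')) 0 t)
  end.

Lemma delayed_continuity_pt F h x :
  (forall u p, continuous2_at F u p) ->
  (forall t, continuity_pt (fst x) t) -> (forall t, continuity_pt (snd x) t) ->
  forall t, continuity_pt (delayed F h x) t.
Proof.
  intros HF H1 H2 t. apply continuity_pt_mult; [apply ramp_continuity_pt|].
  assert (Hs : continuity_pt (fun s => s - h) t).
  { apply continuity_pt_minus; [apply derivable_continuous_pt, derivable_pt_id|].
    apply continuity_pt_const. intros ? ?. reflexivity. }
  apply (continuous2_comp F (fun s => fst x (s - h)) (fun s => snd x (s - h))); [apply HF| |].
  - now apply (continuity_pt_comp (fun s => s - h) (fst x)).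
  - now apply (continuity_pt_comp (fun s => s - h) (snd x)).
Qed.

Lemma is_derive_primitive (c : R) (w : R -> R) t :
  (forall s, continuity_pt w s) -> is_derive (fun t => c + RInt w 0 t) t (w t).
Proof.
  intros Hw.
  assert (Hc : forall s, continuous w s) by (intros s; apply continuity_pt_filterlim, Hw).
  rewrite <- (Rplus_0_l (w t)) at 1.
  apply (is_derive_plus (fun _ => c)); [apply @is_derive_const|].
  apply (is_derive_RInt w (RInt w 0) 0 t); [|apply Hc].
  apply filter_forall. intros b. apply @RInt_correct, @ex_RInt_continuous. intros z _. apply Hc.
Qed.

Lemma tonelli_continuity_pt h k :
  (forall t, continuity_pt (fst (tonelli h k)) t) /\ (forall t, continuity_pt (snd (tonelli h k)) t).
Proof.
  induction k as [|k [IH1 IH2]]; simpl.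
  - split; intros t; apply continuity_pt_const; intros ? ?; reflexivity.
  - split; intros t; eapply is_derive_continuity_pt; apply is_derive_primitive;
      now apply delayed_continuity_pt.
Qed.

Lemma tonelli_derive h k t :
  is_derive (fst (tonelli h (S k))) t (delayed F1 h (tonelli h k) t) /\
  is_derive (snd (tonelli h (S k))) t (delayed F2 h (tonelli h k) t).
Proof.
  destruct (tonelli_continuity_pt h k). simpl.
  split; apply is_derive_primitive; now apply delayed_continuity_pt.
Qed.

Lemma tonelli_stable h : 0 < h -> forall k t, t <= INR k * h ->
  fst (tonelli h k) t = fst (tonelli h (S k)) t /\
  snd (tonelli h k) t = snd (tonelli h (S k)) t.
Proof.
  intros Hh. induction k as [|k IH]; intros t Ht.
  - simpl in *.
    assert (E : forall F, RInt (delayed F h (fun _ => u0, fun _ => p0)) 0 t = 0).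
    { intros F. rewrite (RInt_ext _ (fun _ => 0)).
      - rewrite RInt_const. apply Rmult_0_r.
      - intros s. rewrite Rmin_right, Rmax_left by lra. intros Hs.
        unfold delayed. rewrite ramp_neg by lra. apply Rmult_0_l. }
    rewrite !E. split; ring.
  - rewrite S_INR in Ht.
    assert (E : forall F, RInt (delayed F h (tonelli h k)) 0 t =
                          RInt (delayed F h (tonelli h (S k))) 0 t).
    { intros F. apply RInt_ext. intros s Hs. unfold delayed.
      (* For negative [t] the integration interval is [t, 0] and [s] may exceed [t]; the ramp
         vanishes there. *)
      destruct (Rle_dec s 0) as [h0|h0]; [rewrite ramp_neg, !Rmult_0_l by lra; reflexivity|].
      assert (Hst : s < t).
      { destruct Hs as [_ Hs]. revert Hs. unfold Rmax. destruct Rle_dec; lra. }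
      destruct (IH (s - h) ltac:(nra)) as [-> ->]. reflexivity. }
    change (u0 + RInt (delayed F1 h (tonelli h k)) 0 t =
            u0 + RInt (delayed F1 h (tonelli h (S k))) 0 t /\
            p0 + RInt (delayed F2 h (tonelli h k)) 0 t =
            p0 + RInt (delayed F2 h (tonelli h (S k))) 0 t).
    rewrite !E. split; reflexivity.
Qed.

Lemma tonelli_stable_le h : 0 < h -> forall k k' t, (k <= k')%nat -> t <= INR k * h ->
  fst (tonelli h k) t = fst (tonelli h k') t /\
  snd (tonelli h k) t = snd (tonelli h k') t.
Proof.
  intros Hh k k' t Hk Ht. induction Hk as [|k' Hk [E1 E2]]; [split; reflexivity|].
  assert (Ht' : t <= INR k' * h). { apply le_INR in Hk. nra. }
  destruct (tonelli_stable h Hh k' t Ht') as [E3 E4]. split; congruence.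
Qed.

Lemma delayed_solution h : 0 < h ->
  exists u p, (forall t, t <= 0 -> u t = u0 /\ p t = p0) /\
    (forall t, is_derive u t (delayed F1 h (u, p) t)) /\
    (forall t, is_derive p t (delayed F2 h (u, p) t)).
Proof.
  intros Hh.
  assert (Hex : forall t, exists k, t <= INR k * h).
  { intros t. destruct (Rle_dec 0 (t / h)) as [h0|h0].
    - destruct (nfloor_ex _ h0) as (k & Hk). exists (S k). rewrite S_INR.
      apply Rmult_le_reg_r with (/ h); [now apply Rinv_0_lt_compat|].
      rewrite Rmult_assoc, Rinv_r, Rmult_1_r by lra. unfold Rdiv in Hk. lra.
    - exists 0%nat. simpl. rewrite Rmult_0_l. apply Rnot_lt_le. intros Hc.
      apply h0. left. now apply Rdiv_lt_0_compat. }
  set (kk := fun t => proj1_sig (constructive_indefinite_description _ (Hex t))).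
  assert (Hkk : forall t, t <= INR (kk t) * h).
  { intros t. unfold kk. now destruct constructive_indefinite_description. }
  set (u := fun t => fst (tonelli h (kk t)) t).
  set (p := fun t => snd (tonelli h (kk t)) t).
  assert (Hup : forall k t, t <= INR k * h ->
    fst (tonelli h k) t = u t /\ snd (tonelli h k) t = p t).
  { intros k t Ht. unfold u, p. destruct (Nat.le_ge_cases k (kk t)) as [Hle|Hle].
    - now apply tonelli_stable_le.
    - destruct (tonelli_stable_le h Hh (kk t) k t Hle (Hkk t)). split; congruence. }
  exists u, p. split; [|split].
  - intros t Ht. destruct (Hup 0%nat t) as [<- <-]; [simpl; lra|]. split; reflexivity.
  (* The index is taken for [t + h], so that one fixed iterate agrees with [u] on the whole ball of
     radius [h] around [t]. *)
  - intros t. set (k := kk (t + h)).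
    assert (Hk : t + h <= INR k * h) by apply Hkk.
    apply is_derive_ext_loc with (fst (tonelli h (S k))).
    + exists (mkposreal h Hh). intros s Hs. apply Hup. rewrite S_INR.
      apply Rabs_def2 in Hs. unfold minus, plus, opp in Hs. simpl in Hs. lra.
    + replace (delayed F1 h (u, p) t) with (delayed F1 h (tonelli h k) t); [apply tonelli_derive|].
      unfold delayed. destruct (Hup k (t - h) ltac:(lra)) as [-> ->]. reflexivity.
  - intros t. set (k := kk (t + h)).
    assert (Hk : t + h <= INR k * h) by apply Hkk.
    apply is_derive_ext_loc with (snd (tonelli h (S k))).
    + exists (mkposreal h Hh). intros s Hs. apply Hup. rewrite S_INR.
      apply Rabs_def2 in Hs. unfold minus, plus, opp in Hs. simpl in Hs. lra.
    + replace (delayed F2 h (u, p) t) with (delayed F2 h (tonelli h k) t); [apply tonelli_derive|].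
      unfold delayed. destruct (Hup k (t - h) ltac:(lra)) as [-> ->]. reflexivity.
Qed.

Lemma delayed_bound F h x s :
  (forall u p, Rabs (F u p) <= K) -> Rabs (delayed F h x s) <= K.
Proof.
  intros HF. unfold delayed. rewrite Rabs_mult.
  specialize (HF (fst x (s - h)) (snd x (s - h))).
  pose proof (ramp_bounds h s). rewrite (Rabs_pos_eq (ramp h s)) by lra.
  pose proof (Rabs_pos (F (fst x (s - h)) (snd x (s - h)))). nra.
Qed.

(** The delayed solutions for [h = / (INR n + 1)] share the Lipschitz constant [K], and a limit of
    them solves the system. They are constant at negative times and the field need not vanish at the
    start, hence the equation for [0 < t] only. *)
Theorem peano :
  exists u p, lipschitz K u /\ lipschitz K p /\
    (forall t, t <= 0 -> u t = u0 /\ p t = p0) /\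
    (forall t, 0 < t -> is_derive u t (F1 (u t) (p t)) /\ is_derive p t (F2 (u t) (p t))).
Proof.
  set (h := fun n => / (INR n + 1)).
  assert (Hh : forall n, 0 < h n).
  { intros n. apply Rinv_0_lt_compat. pose proof (pos_INR n). lra. }
  assert (Hh0 : forall e, 0 < e -> exists N, forall n, (N <= n)%nat -> h n < e).
  { intros e He. destruct (nfloor_ex (/ e)) as (N & HN).
    { left. now apply Rinv_0_lt_compat. }
    exists N. intros n Hn. unfold h. rewrite <- (Rinv_inv e).
    apply le_INR in Hn. pose proof (pos_INR n). apply Rinv_lt_contravar; [|lra].
    apply Rmult_lt_0_compat; [now apply Rinv_0_lt_compat|lra]. }
  assert (Hex : forall n, exists x : (R -> R) * (R -> R),
    (forall t, t <= 0 -> fst x t = u0 /\ snd x t = p0) /\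
    (forall t, is_derive (fst x) t (delayed F1 (h n) x t)) /\
    (forall t, is_derive (snd x) t (delayed F2 (h n) x t))).
  { intros n. destruct (delayed_solution (h n) (Hh n)) as (u & p & H). now exists (u, p). }
  set (xn := fun n => proj1_sig (constructive_indefinite_description _ (Hex n))).
  assert (Hxn : forall n, (forall t, t <= 0 -> fst (xn n) t = u0 /\ snd (xn n) t = p0) /\
    (forall t, is_derive (fst (xn n)) t (delayed F1 (h n) (xn n) t)) /\
    (forall t, is_derive (snd (xn n)) t (delayed F2 (h n) (xn n) t))).
  { intros n. unfold xn. now destruct constructive_indefinite_description. }
  assert (L1 : forall n, lipschitz K (fst (xn n))).
  { intros n. eapply lipschitz_of_derive; [apply (Hxn n)|]. intros t. now apply delayed_bound. }
  assert (L2 : forall n, lipschitz K (snd (xn n))).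
  { intros n. eapply lipschitz_of_derive; [apply (Hxn n)|]. intros t. now apply delayed_bound. }
  destruct (lipschitz_compactness (fun n => fst (xn n)) (fun n => snd (xn n)) K
    (Rabs u0 + Rabs p0)) as (d & u & p & Hd & Hu & Hp); [exact L1|exact L2| | |].
  { intros n. destruct (proj1 (Hxn n) 0 (Rle_refl 0)) as [-> _].
    pose proof (Rabs_pos p0). lra. }
  { intros n. destruct (proj1 (Hxn n) 0 (Rle_refl 0)) as [_ ->].
    pose proof (Rabs_pos u0). lra. }
  assert (Hder : forall (F : R -> R -> R) (z : nat -> R -> R) (w : R -> R) t,
    (forall u p, continuous2_at F u p) ->
    (forall s, is_lim_seq (fun n => z (d n) s) (w s)) ->
    (forall n s, is_derive (z n) s (delayed F (h n) (xn n) s)) -> 0 < t ->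
    is_derive w t (F (u t) (p t))).
  { intros F z w t HF Hz Hzd Ht.
    destruct (Hh0 (t / 2) ltac:(lra)) as (N & HN).
    apply (limit_is_derive (fun n => z (d n)) (fun n s => delayed F (h (d n)) (xn (d n)) s)
      w t _ 1 0 Hz Rlt_0_1); [intros; apply Hzd|].
    intros e He.
    destruct (equicontinuous_field F (fun n => fst (xn (d n))) (fun n => snd (xn (d n)))
      (u t) (p t) K t (fun n => L1 (d n)) (fun n => L2 (d n)) (Hu t) (Hp t) (HF _ _) e He)
      as (r & M & Hr & HM).
    destruct (Hh0 (r / 2) ltac:(lra)) as (N' & HN').
    (* With [s > t / 2 > h] the ramp equals 1, and with [h < r / 2] the delayed time [s - h] stays
       within [r] of [t]. *)
    exists (Rmin (r / 2) (t / 2)), (M + N + N')%nat.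
    split; [apply Rmin_glb_lt; lra|]. intros n s Hn Hs.
    assert (Hs1 : Rabs (s - t) < r / 2) by (apply Rlt_le_trans with (1 := Hs), Rmin_l).
    assert (Hs2 : Rabs (s - t) < t / 2) by (apply Rlt_le_trans with (1 := Hs), Rmin_r).
    pose proof (Hd n) as Hdn.
    specialize (HN (d n) ltac:(lia)). specialize (HN' (d n) ltac:(lia)).
    apply Rabs_def2 in Hs1, Hs2. pose proof (Hh (d n)).
    unfold delayed. rewrite ramp_one, Rmult_1_l by lra. apply HM; [lia|].
    apply Rabs_def1; lra. }
  exists u, p. split; [|split; [|split]].
  - now apply (lipschitz_lim (fun n => fst (xn (d n)))).
  - now apply (lipschitz_lim (fun n => snd (xn (d n)))).
  - intros t Ht. split.
    + specialize (Hu t). apply is_lim_seq_ext with (v := fun _ => u0) in Hu.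
      * apply is_lim_seq_unique in Hu. rewrite Lim_seq_const in Hu. congruence.
      * intros n. now apply Hxn.
    + specialize (Hp t). apply is_lim_seq_ext with (v := fun _ => p0) in Hp.
      * apply is_lim_seq_unique in Hp. rewrite Lim_seq_const in Hp. congruence.
      * intros n. now apply Hxn.
  - intros t Ht. split.
    + apply (Hder F1 (fun n => fst (xn n)) u t); auto. intros n. apply Hxn.
    + apply (Hder F2 (fun n => snd (xn n)) p t); auto. intros n. apply Hxn.
Qed.

End Peano.

(** * The curvature nonlinearity *)

(* With p = v' / sqrt (1 + v'^2) one has v' = psi p, and [energy] is a primitive of psi. *)
Definition psi (p : R) : R := p / sqrt (1 - p ^ 2).
Definition energy (p : R) : R := 1 - sqrt (1 - p ^ 2).

Lemma sqrt_one_minus_pos p : Rabs p < 1 -> 0 < sqrt (1 - p ^ 2) <= 1 /\ 0 < 1 - p ^ 2.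
Proof.
  intros H. apply Rabs_def2 in H.
  assert (H0 : 0 < 1 - p ^ 2) by nra.
  split; [split|exact H0].
  - now apply sqrt_lt_R0.
  - rewrite <- sqrt_1 at 2. apply sqrt_le_1; nra.
Qed.

Lemma psi_0 : psi 0 = 0.
Proof. unfold psi, Rdiv. apply Rmult_0_l. Qed.

Lemma psi_opp p : psi (- p) = - psi p.
Proof.
  unfold psi. replace ((- p) ^ 2) with (p ^ 2) by ring. unfold Rdiv. ring.
Qed.

Lemma psi_ge p : 0 <= p < 1 -> p <= psi p.
Proof.
  intros H. destruct (sqrt_one_minus_pos p) as [H1 _]; [rewrite Rabs_pos_eq; lra|].
  unfold psi. apply Rmult_le_reg_r with (sqrt (1 - p ^ 2)); [lra|].
  unfold Rdiv. rewrite Rmult_assoc, Rinv_l by lra. nra.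
Qed.

Lemma psi_le p q : 0 <= p <= q -> q < 1 -> psi p <= psi q.
Proof.
  intros H Hq.
  destruct (sqrt_one_minus_pos p) as [H1 _]; [rewrite Rabs_pos_eq; lra|].
  destruct (sqrt_one_minus_pos q) as [H2 _]; [rewrite Rabs_pos_eq; lra|].
  unfold psi, Rdiv. apply Rmult_le_compat; [lra| |lra|].
  - left. apply Rinv_0_lt_compat. lra.
  - apply Rinv_le_contravar; [lra|]. apply sqrt_le_1; nra.
Qed.

Lemma Rabs_psi p : Rabs (psi p) = psi (Rabs p).
Proof.
  unfold psi. rewrite pow2_abs. unfold Rdiv. rewrite Rabs_mult. f_equal.
  apply Rabs_pos_eq. destruct (Req_dec (sqrt (1 - p ^ 2)) 0) as [->|H].
  - rewrite Rinv_0. lra.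
  - left. apply Rinv_0_lt_compat. pose proof (sqrt_pos (1 - p ^ 2)). lra.
Qed.

(** On the strip [Rabs p <= P] the nonlinearity is dominated by a linear function, which is what the
    exponential estimates need. *)
Lemma psi_linear_bound P p : P < 1 -> Rabs p <= P -> Rabs (psi p) <= / sqrt (1 - P ^ 2) * Rabs p.
Proof.
  intros HP Hp. pose proof (Rabs_pos p).
  destruct (sqrt_one_minus_pos P) as [H1 _]; [rewrite Rabs_pos_eq; lra|].
  destruct (sqrt_one_minus_pos (Rabs p)) as [H2 H3]; [rewrite Rabs_Rabsolu; lra|].
  rewrite Rabs_psi. unfold psi, Rdiv. rewrite Rmult_comm. apply Rmult_le_compat_r; [lra|].
  apply Rinv_le_contravar; [lra|]. apply sqrt_le_1; nra.
Qed.

Lemma energy_derive p : Rabs p < 1 -> is_derive energy p (psi p).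
Proof.
  intros H. destruct (sqrt_one_minus_pos p H) as [H1 H2]. unfold energy, psi.
  auto_derive.
  - replace (1 + - (p * (p * 1))) with (1 - p ^ 2) by ring. exact H2.
  - replace (1 + - (p * (p * 1))) with (1 - p ^ 2) by ring. field. lra.
Qed.

Lemma psi_derive p : Rabs p < 1 ->
  is_derive psi p (/ (sqrt (1 - p ^ 2) * (1 - p ^ 2))).
Proof.
  intros H. destruct (sqrt_one_minus_pos p H) as [H1 H2]. unfold psi.
  auto_derive.
  - replace (1 + - (p * (p * 1))) with (1 - p ^ 2) by ring. repeat split; lra.
  - replace (1 + - (p * (p * 1))) with (1 - p ^ 2) by ring.
    assert (E : sqrt (1 - p ^ 2) * sqrt (1 - p ^ 2) = 1 - p ^ 2) by (apply sqrt_sqrt; lra).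
    set (w := sqrt (1 - p ^ 2)) in *. rewrite <- E.
    assert (E2 : p ^ 2 = 1 - w * w) by lra.
    field_simplify; try lra. rewrite E2. field. lra.
Qed.

Lemma psi_continuity_pt p : Rabs p < 1 -> continuity_pt psi p.
Proof. intros H. eapply is_derive_continuity_pt, psi_derive, H. Qed.

Lemma energy_nonneg p : 0 <= energy p.
Proof.
  unfold energy. assert (sqrt (1 - p ^ 2) <= sqrt 1); [|rewrite sqrt_1 in *; lra].
  apply sqrt_le_1_alt. nra.
Qed.

Lemma energy_lt_1 p : Rabs p < 1 -> energy p < 1.
Proof. intros H. destruct (sqrt_one_minus_pos p H). unfold energy. lra. Qed.

Lemma energy_0 : energy 0 = 0.
Proof. unfold energy. rewrite pow_i, Rminus_0_r, sqrt_1 by lia. ring. Qed.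

(** Linearization of [psi] at 0, where its slope is 1; it serves the estimate of the angle around
    the equilibrium. *)
Lemma psi_near_0 e : 0 < e -> exists r, 0 < r < 1 /\ forall p, 0 <= p < r -> psi p <= (1 + e) * p.
Proof.
  intros He.
  destruct (continuity_pt_eps (fun p => / sqrt (1 - p ^ 2)) 0) with (e := e) as (d & Hd & Hx).
  - eapply is_derive_continuity_pt. auto_derive; [|reflexivity].
    replace (1 + - (0 * (0 * 1))) with 1 by ring. rewrite sqrt_1. repeat split; lra.
  - exact He.
  - exists (Rmin d (1 / 2)). split; [split; [apply Rmin_glb_lt; lra|]|].
    { apply Rle_lt_trans with (1 := Rmin_r _ _). lra. }
    intros p Hp. assert (Hpd : p < d) by (apply Rlt_le_trans with (1 := proj2 Hp), Rmin_l).
    specialize (Hx p). rewrite Rminus_0_r, Rabs_pos_eq in Hx by lra.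
    specialize (Hx Hpd). rewrite pow_i, Rminus_0_r, sqrt_1, Rinv_1 in Hx by lia.
    apply Rabs_def2 in Hx. unfold psi, Rdiv. rewrite Rmult_comm.
    apply Rmult_le_compat_r; lra.
Qed.

(** * Jointly continuous fields and clamping *)

Lemma continuous2_fst (w : R -> R) u p : continuity_pt w u -> continuous2_at (fun u _ => w u) u p.
Proof.
  intros Hw e He. destruct (continuity_pt_eps w u Hw e He) as (d & Hd & H).
  exists d. split; auto.
Qed.

Lemma continuous2_snd (w : R -> R) u p : continuity_pt w p -> continuous2_at (fun _ p => w p) u p.
Proof.
  intros Hw e He. destruct (continuity_pt_eps w p Hw e He) as (d & Hd & H).
  exists d. split; auto.
Qed.

Lemma continuous2_plus F H u p :
  continuous2_at F u p -> continuous2_at H u p -> continuous2_at (fun u p => F u p + H u p) u p.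
Proof.
  intros H1 H2 e He.
  destruct (H1 (e / 2) ltac:(lra)) as (d1 & Hd1 & A1).
  destruct (H2 (e / 2) ltac:(lra)) as (d2 & Hd2 & A2).
  exists (Rmin d1 d2). split; [now apply Rmin_glb_lt|]. intros u' p' Hu Hp.
  pose proof (Rmin_l d1 d2). pose proof (Rmin_r d1 d2).
  specialize (A1 u' p' ltac:(lra) ltac:(lra)). specialize (A2 u' p' ltac:(lra) ltac:(lra)).
  replace (F u' p' + H u' p' - (F u p + H u p)) with
    ((F u' p' - F u p) + (H u' p' - H u p)) by ring.
  apply Rle_lt_trans with (1 := Rabs_triang _ _). lra.
Qed.

Definition clamp (a b x : R) : R := Rmax a (Rmin b x).

Lemma clamp_in a b x : a <= b -> a <= clamp a b x <= b.
Proof. intros H. unfold clamp, Rmax, Rmin. repeat destruct Rle_dec; lra. Qed.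

Lemma clamp_id a b x : a <= x <= b -> clamp a b x = x.
Proof. intros H. unfold clamp, Rmax, Rmin. repeat destruct Rle_dec; lra. Qed.

Lemma clamp_below a b x : a <= b -> x <= a -> clamp a b x = a.
Proof. intros H. unfold clamp, Rmax, Rmin. repeat destruct Rle_dec; lra. Qed.

Lemma clamp_above a b x : a <= b -> b <= x -> clamp a b x = b.
Proof. intros H. unfold clamp, Rmax, Rmin. repeat destruct Rle_dec; lra. Qed.

Lemma clamp_contract a b x y : Rabs (clamp a b x - clamp a b y) <= Rabs (x - y).
Proof.
  unfold clamp, Rmax, Rmin, Rabs. repeat destruct Rle_dec; repeat destruct Rcase_abs; lra.
Qed.

Lemma clamp_continuity_pt a b x : continuity_pt (clamp a b) x.
Proof.
  apply (lipschitz_continuity_pt 1). intros s t. rewrite Rmult_1_l. apply clamp_contract.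
Qed.

(** * The damped system *)

(** [m] is the slope of [g] at [al], and [dd_osc] says that the roots of [x ^ 2 + b * x + m], the
    eigenvalues at the equilibrium, are not real. [dd_lin0] prevents trajectories from leaving the
    saddle in finite time. [dd_psiP] makes [Rabs p <= P] invariant. *)
Record damped_data (g : R -> R) (al b m l M P : R) : Prop := {
  dd_cont : forall s, continuity_pt g s;
  dd_al : 0 < al < 1;
  dd_b : 0 < b;
  dd_out : forall s, s <= 0 \/ 1 <= s -> g s = 0;
  dd_neg : forall s, 0 < s < al -> g s < 0;
  dd_pos : forall s, al < s < 1 -> 0 < g s;
  dd_zero : g al = 0;
  dd_bound : forall s, Rabs (g s) <= M;
  dd_derive : is_derive g al m;
  dd_osc : b ^ 2 < 4 * m;
  dd_l : 0 < l;
  dd_lin0 : forall s, 0 <= s < al -> - g s <= l * s;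
  dd_P : 0 < P < 1;
  dd_psiP : M < b * psi P
}.

(** Continuity and the bound on [p] are asked at all times, since Peano's solutions are extended by
    constants before the start. A trajectory for every [a] solves the system on the whole line. *)
Definition trajectory (g : R -> R) (b P a : R) (u p : R -> R) : Prop :=
  (forall t, continuity_pt u t) /\ (forall t, continuity_pt p t) /\
  (forall t, Rabs (p t) <= P) /\
  (forall t, a < t -> is_derive u t (psi (p t)) /\ is_derive p t (- b * psi (p t) - g (u t))).

Definition potential (g : R -> R) (s : R) : R := RInt g 0 s.

Lemma trajectory_weaken g b P a a' u p :
  a <= a' -> trajectory g b P a u p -> trajectory g b P a' u p.
Proof.
  intros Ha (H1 & H2 & H3 & H4). repeat (split; [assumption|]). intros t Ht. apply H4. lra.
Qed.

Section Damped.

Variables (g : R -> R) (al b m l M P : R).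
Hypothesis Hg : damped_data g al b m l M P.

Let g_cont := dd_cont _ _ _ _ _ _ _ Hg.
Let Hal := dd_al _ _ _ _ _ _ _ Hg.
Let Hb := dd_b _ _ _ _ _ _ _ Hg.
Let g_out := dd_out _ _ _ _ _ _ _ Hg.
Let g_neg := dd_neg _ _ _ _ _ _ _ Hg.
Let g_pos := dd_pos _ _ _ _ _ _ _ Hg.
Let g_zero := dd_zero _ _ _ _ _ _ _ Hg.
Let g_bound := dd_bound _ _ _ _ _ _ _ Hg.
Let HP := dd_P _ _ _ _ _ _ _ Hg.
Let HPM := dd_psiP _ _ _ _ _ _ _ Hg.

Local Notation G := (potential g).
Local Notation traj := (trajectory g b P).

Lemma g_le_0 s : s <= al -> g s <= 0.
Proof.
  intros H. destruct (Rle_dec s 0) as [h|h]; [rewrite g_out; lra|].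
  destruct (Req_dec s al) as [->|]; [lra|]. left. apply g_neg. lra.
Qed.

Lemma g_ge_0 s : al <= s -> 0 <= g s.
Proof.
  intros H. destruct (Rle_dec 1 s) as [h|h]; [rewrite g_out; lra|].
  destruct (Req_dec s al) as [->|]; [lra|]. left. apply g_pos. lra.
Qed.

Lemma potential_derive s : is_derive G s (g s).
Proof.
  rewrite <- (Rplus_0_l (g s)) at 1.
  apply is_derive_ext with (fun t => 0 + RInt g 0 t).
  { intros t. apply Rplus_0_l. }
  rewrite Rplus_0_l. now apply is_derive_primitive.
Qed.

Lemma potential_continuity_pt s : continuity_pt G s.
Proof. eapply is_derive_continuity_pt, potential_derive. Qed.

Lemma potential_0 : G 0 = 0.
Proof. apply @RInt_point. Qed.

Lemma potential_decr s t : s <= t <= al -> G t <= G s.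
Proof.
  intros H. pose proof (derive_le_slope G g 0 s t) as K.
  apply Rminus_le. rewrite <- (Rmult_0_l (t - s)). apply K; [lra| | |].
  - intros; apply potential_derive.
  - intros; apply potential_continuity_pt.
  - intros; apply g_le_0; lra.
Qed.

Lemma potential_incr s t : al <= s <= t -> G s <= G t.
Proof.
  intros H. apply (derive_nonneg_le G g); [lra| | |].
  - intros; apply potential_derive.
  - intros; apply potential_continuity_pt.
  - intros; apply g_ge_0; lra.
Qed.

Lemma potential_incr_strict s t : al <= s < t -> t <= 1 -> G s < G t.
Proof.
  intros H H1. apply (derive_pos_lt G g); [lra| | |].
  - intros; apply potential_derive.
  - intros; apply potential_continuity_pt.
  - intros; apply g_pos; lra.
Qed.

Lemma potential_neg_pos s : G s < 0 -> 0 < s.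
Proof.
  intros H. apply Rnot_le_lt. intros Hs.
  pose proof (potential_decr s 0 ltac:(lra)). rewrite potential_0 in *. lra.
Qed.

Lemma potential_below_end s : G s < G 1 -> s < 1.
Proof.
  intros H. apply Rnot_le_lt. intros Hs.
  pose proof (potential_incr 1 s ltac:(lra)). lra.
Qed.

Lemma g_uniform_neg x y : 0 < x <= y -> y < al -> exists c, 0 < c /\ forall s, x <= s <= y -> g s <= - c.
Proof.
  intros H Hy. destruct (continuity_ab_min (fun s => - g s) x y) as (z & Hz & Hz2); [lra| |].
  { intros; apply continuity_pt_opp, g_cont. }
  exists (- g z). split; [specialize (g_neg z ltac:(lra)); lra|].
  intros s Hs. specialize (Hz s Hs). lra.
Qed.

Lemma g_uniform_pos x y : al < x <= y -> y < 1 -> exists c, 0 < c /\ forall s, x <= s <= y -> c <= g s.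
Proof.
  intros H Hy. destruct (continuity_ab_min g x y) as (z & Hz & Hz2); [lra|auto|].
  exists (g z). split; [specialize (g_pos z ltac:(lra)); lra|exact Hz].
Qed.

Lemma traj_abs_lt_1 a u p : traj a u p -> forall t, Rabs (p t) < 1.
Proof. intros (_ & _ & H & _) t. specialize (H t). lra. Qed.

Definition speed_bound : R := psi P * (1 + b) + M.

(** Peano's theorem needs a bounded field, so [psi] is frozen outside the strip [Rabs p <= P]. The
    truncation never acts: beyond the strip the damping has size [b * psi P > M] and pushes [p]
    back. *)
Lemma trajectory_exists u0 p0 : Rabs p0 <= P ->
  exists u p, u 0 = u0 /\ p 0 = p0 /\ traj 0 u p /\ lipschitz speed_bound u /\ lipschitz speed_bound p.
Proof.
  intros Hp0.
  set (ps := fun p => psi (clamp (- P) P p)).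
  assert (Hcl : forall p, Rabs (clamp (- P) P p) <= P).
  { intros p. apply Rabs_le. apply clamp_in. lra. }
  assert (Hps : forall p, Rabs (ps p) <= psi P).
  { intros p. unfold ps. rewrite Rabs_psi. apply psi_le; [|lra].
    split; [apply Rabs_pos|apply Hcl]. }
  assert (Cps : forall p, continuity_pt ps p).
  { intros p. apply (continuity_pt_comp (clamp (- P) P) psi); [apply clamp_continuity_pt|].
    apply psi_continuity_pt. specialize (Hcl p). lra. }
  assert (HM : 0 <= M) by (apply Rle_trans with (2 := g_bound 0), Rabs_pos).
  assert (HpsP : 0 < psi P) by (pose proof (psi_ge P ltac:(lra)); lra).
  destruct (peano (fun _ p => ps p) (fun u p => - b * ps p + - g u) speed_bound u0 p0)
    as (u & p & Lu & Lp & H0 & Hd).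
  - intros. apply (continuous2_snd ps), Cps.
  - intros v q. apply continuous2_plus.
    + apply (continuous2_snd (fun p => - b * ps p)). apply continuity_pt_scal, Cps.
    + apply (continuous2_fst (fun u => - g u)). apply continuity_pt_opp, g_cont.
  - intros _ q. specialize (Hps q). unfold speed_bound. nra.
  - intros v q. apply Rle_trans with (1 := Rabs_triang _ _).
    rewrite Rabs_Ropp, Rabs_mult, Rabs_Ropp, (Rabs_pos_eq b) by lra.
    specialize (Hps q). specialize (g_bound v). unfold speed_bound. nra.
  - destruct (H0 0 (Rle_refl 0)) as [E1 E2].
    exists u, p. split; [exact E1|]. split; [exact E2|].
    assert (Cp := lipschitz_continuity_pt _ _ Lp).
    assert (Hinv : forall t, Rabs (p t) <= P).
    { intros t. destruct (Rle_dec t 0) as [h|h].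
      { destruct (H0 t h) as [_ ->]. exact Hp0. }
      apply Rabs_le_between in Hp0.
      apply Rabs_le. split; apply Rnot_lt_le; intros Hlt.
      (* After its last time at the value [-P], [p] would be increasing, yet it ends below that
         value. The other side is symmetric. *)
      - destruct (last_exit (fun t => P + p t) 0 t) as (T & HT & ET & Hs); [lra| |lra|].
        { intros; apply continuity_pt_plus; [apply continuity_pt_const; intros ? ?; reflexivity|apply Cp]. }
        pose proof (derive_nonneg_le p (fun t => - b * ps (p t) + - g (u t)) T t) as K.
        assert (p T <= p t); [|lra]. apply K; [lra|intros; apply Hd; lra|intros; apply Cp|].
        intros r Hr. specialize (Hs r ltac:(lra)).
        unfold ps. rewrite clamp_below, psi_opp by lra.
        specialize (g_bound (u r)). apply Rabs_le_between in g_bound. lra.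
      - destruct (last_exit (fun t => P - p t) 0 t) as (T & HT & ET & Hs); [lra| |lra|].
        { intros; apply continuity_pt_minus; [apply continuity_pt_const; intros ? ?; reflexivity|apply Cp]. }
        pose proof (derive_le_slope p (fun t => - b * ps (p t) + - g (u t)) 0 T t) as K.
        assert (p t - p T <= 0 * (t - T)); [|lra].
        apply K; [lra|intros; apply Hd; lra|intros; apply Cp|].
        intros r Hr. specialize (Hs r ltac:(lra)).
        unfold ps. rewrite clamp_above by lra.
        specialize (g_bound (u r)). apply Rabs_le_between in g_bound. lra. }
    split; [|split; assumption].
    split; [apply (lipschitz_continuity_pt _ _ Lu)|]. split; [exact Cp|]. split; [exact Hinv|].
    intros t Ht. destruct (Hd t Ht) as [D1 D2].
    unfold ps in D1, D2. rewrite clamp_id in D1, D2 by (apply Rabs_le_between, Hinv).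
    split; assumption.
Qed.

Lemma psi_traj_continuity_pt a u p : traj a u p -> forall t, continuity_pt (fun t => psi (p t)) t.
Proof.
  intros H t. apply (continuity_pt_comp p psi); [apply H|].
  apply psi_continuity_pt. now apply (traj_abs_lt_1 a u p).
Qed.

Lemma total_energy_derive a u p t : traj a u p -> a < t ->
  is_derive (fun t => energy (p t) + G (u t)) t (- b * psi (p t) ^ 2).
Proof.
  intros H Ht. assert (Hp := traj_abs_lt_1 a u p H t). destruct H as (_ & _ & _ & H).
  destruct (H t Ht) as [D1 D2].
  replace (- b * psi (p t) ^ 2) with
    ((- b * psi (p t) - g (u t)) * psi (p t) + psi (p t) * g (u t)) by ring.
  apply (is_derive_plus (fun t => energy (p t)) (fun t => G (u t))).
  - apply (is_derive_comp energy p); [now apply energy_derive|exact D2].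
  - apply (is_derive_comp G u); [apply potential_derive|exact D1].
Qed.

Lemma total_energy_continuity_pt a u p t : traj a u p ->
  continuity_pt (fun t => energy (p t) + G (u t)) t.
Proof.
  intros H. apply continuity_pt_plus.
  - apply (continuity_pt_comp p energy); [apply H|]. eapply is_derive_continuity_pt, energy_derive.
    now apply (traj_abs_lt_1 a u p).
  - apply (continuity_pt_comp u G); [apply H|apply potential_continuity_pt].
Qed.

Lemma total_energy_noninc a u p s t : traj a u p -> a <= s <= t ->
  energy (p t) + G (u t) <= energy (p s) + G (u s).
Proof.
  intros H Hst. apply Rminus_le. rewrite <- (Rmult_0_l (t - s)).
  apply (derive_le_slope (fun t => energy (p t) + G (u t)) (fun t => - b * psi (p t) ^ 2)); [lra| | |].
  - intros r Hr. apply (total_energy_derive a); [exact H|lra].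
  - intros r _. now apply (total_energy_continuity_pt a).
  - intros r _. pose proof (pow2_ge_0 (psi (p r))). nra.
Qed.

(** Adding [b * u] removes [psi]. The sum is bounded while [u] stays in [0, 1], and its slope
    [- g u] is bounded away from 0 far from the zeros of [g]; this limits the time spent there. *)
Lemma momentum_derive a u p t : traj a u p -> a < t ->
  is_derive (fun t => p t + b * u t) t (- g (u t)).
Proof.
  intros (_ & _ & _ & H) Ht. destruct (H t Ht) as [D1 D2].
  replace (- g (u t)) with ((- b * psi (p t) - g (u t)) + b * psi (p t)) by ring.
  apply (is_derive_plus p (fun t => b * u t)); [exact D2|].
  now apply (is_derive_scal u).
Qed.

Lemma momentum_continuity_pt a u p t : traj a u p -> continuity_pt (fun t => p t + b * u t) t.
Proof. intros H. apply continuity_pt_plus; [apply H|]. apply continuity_pt_scal, H. Qed.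

Lemma traj_increasing a u p s t : traj a u p -> a <= s <= t ->
  (forall r, s < r < t -> 0 <= p r) -> u s <= u t.
Proof.
  intros H Hst Hp. apply (derive_nonneg_le u (fun t => psi (p t))); [lra| | |].
  - intros; apply H; lra.
  - intros; apply H.
  - intros r Hr. specialize (Hp r Hr). pose proof (traj_abs_lt_1 a u p H r) as H1.
    apply Rabs_def2 in H1. pose proof (psi_ge (p r) ltac:(lra)). lra.
Qed.

Lemma traj_increasing_strict a u p s t : traj a u p -> a <= s < t ->
  (forall r, s < r < t -> 0 < p r) -> u s < u t.
Proof.
  intros H Hst Hp. apply (derive_pos_lt u (fun t => psi (p t))); [lra| | |].
  - intros; apply H; lra.
  - intros; apply H.
  - intros r Hr. specialize (Hp r Hr). pose proof (traj_abs_lt_1 a u p H r) as H1.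
    apply Rabs_def2 in H1. pose proof (psi_ge (p r) ltac:(lra)). lra.
Qed.

(** * Crossing the equilibrium and falling below the energy [G 1] *)

Lemma first_zero a u p s t : traj a u p -> a <= s <= t -> 0 < p s -> p t <= 0 ->
  exists T, s < T <= t /\ p T = 0 /\ forall r, s <= r < T -> 0 < p r.
Proof.
  intros H Hst Hs Ht.
  destruct (first_hit (fun t => - p t) 0 s t) as (T & HT & E & Hr); [lra| |lra|].
  - intros; apply continuity_pt_opp, H.
  - exists T. split; [exact HT|]. split; [lra|]. intros r Hr'. specialize (Hr r Hr'). lra.
Qed.

Lemma traj_stays_rising a u p s t : traj a u p -> a <= s <= t -> 0 < p s ->
  (forall r, s <= r <= t -> u r <= al) -> 0 < p t.
Proof.
  intros H Hst Hs Hu. apply Rnot_le_lt. intros Ht.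
  destruct (first_zero a u p s t H Hst Hs Ht) as (T & HT & ET & Hpos).
  set (k := b * / sqrt (1 - P ^ 2)).
  assert (K : p s * exp (k * s) <= p T * exp (k * T)).
  { apply (derive_nonneg_le (fun t => p t * exp (k * t))
      (fun t => (- b * psi (p t) - g (u t)) * exp (k * t) + p t * (k * exp (k * t)))); [lra| | |].
    - intros r Hr. apply (is_derive_mult p (fun t => exp (k * t))).
      + apply H; lra.
      + auto_derive; [trivial|ring].
      + intros; apply Rmult_comm.
    - intros r Hr. apply continuity_pt_mult; [apply H|].
      apply is_derive_continuity_pt with (k * exp (k * r)). auto_derive; [trivial|ring].
    - intros r Hr. specialize (Hpos r ltac:(lra)).
      pose proof (psi_linear_bound P (p r) ltac:(lra) (proj1 (proj2 (proj2 H)) r)) as B.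
      rewrite (Rabs_pos_eq (p r)) in B by lra. apply Rabs_le_between in B.
      pose proof (g_le_0 (u r) (Hu r ltac:(lra))). pose proof (exp_pos (k * r)).
      replace ((- b * psi (p r) - g (u r)) * exp (k * r) + p r * (k * exp (k * r)))
        with ((b * (/ sqrt (1 - P ^ 2) * p r - psi (p r)) - g (u r)) * exp (k * r))
        by (unfold k; ring).
      apply Rmult_le_pos; [|lra]. nra. }
  rewrite ET, Rmult_0_l in K. pose proof (exp_pos (k * s)). nra.
Qed.

(** The form [q ^ 2 - b * q * x + m * x ^ 2] is positive definite because [b ^ 2 < 4 * m]. The
    margin [e] absorbs the linearization errors of [psi] and [g], and [k] is the coercivity left
    over. *)
Lemma oscillation_margin : exists e k, 0 < e /\ 0 < k < 1 /\
  forall x q, 0 <= x -> 0 <= q ->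
    k * (x ^ 2 + q ^ 2) <= q ^ 2 - b * (1 + e) * q * x + (m - e) * x ^ 2.
Proof.
  pose proof (dd_osc _ _ _ _ _ _ _ Hg) as Hosc. clear - Hosc Hb.
  set (D := 4 * m - b ^ 2).
  (* For [e <= 1] one has [(1 + e) ^ 2 <= 1 + 3 * e]; the perturbation thus costs at most
     [e * (3 * b ^ 2 + 4)], half of the discriminant gap [D]. *)
  set (e := Rmin 1 (D / (2 * (3 * b ^ 2 + 4)))).
  assert (Hb2 : 0 < b ^ 2) by nra.
  assert (He : 0 < e).
  { apply Rmin_glb_lt; [lra|]. apply Rdiv_lt_0_compat; unfold D; lra. }
  assert (He1 : e <= 1) by apply Rmin_l.
  assert (He2 : e * (2 * (3 * b ^ 2 + 4)) <= D).
  { apply Rle_div_r; [lra|]. apply Rmin_r. }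
  set (B := b * (1 + e)). set (m' := m - e).
  assert (HB : B ^ 2 + D / 2 <= 4 * m').
  { unfold B, m', D in *. nra. }
  assert (HD : 0 < D) by (unfold D; lra).
  assert (Hm' : 0 < m') by nra.
  (* Then [4 * k * (1 + m') = D / 2], exactly the remaining half of the gap. *)
  set (k := D / (8 * (1 + m'))).
  assert (Hk : k * (8 * (1 + m')) = D) by (unfold k; field; lra).
  assert (Hk0 : 0 < k) by (unfold k; apply Rdiv_lt_0_compat; lra).
  assert (Hk1 : k < 1).
  { apply Rmult_lt_reg_r with (8 * (1 + m')); [lra|]. rewrite Hk.
    assert (D <= 8 * m') by nra. lra. }
  exists e, k. split; [exact He|]. split; [lra|]. intros x q Hx Hq.
  fold B m'.
  assert (Hdisc : B ^ 2 <= 4 * (1 - k) * (m' - k)) by nra.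
  assert (0 <= 4 * (1 - k) * ((1 - k) * q ^ 2 - B * q * x + (m' - k) * x ^ 2)); [|nra].
  replace (4 * (1 - k) * ((1 - k) * q ^ 2 - B * q * x + (m' - k) * x ^ 2)) with
    ((2 * (1 - k) * q - B * x) ^ 2 + (4 * (1 - k) * (m' - k) - B ^ 2) * x ^ 2) by ring.
  pose proof (pow2_ge_0 (2 * (1 - k) * q - B * x)). pose proof (pow2_ge_0 x). nra.
Qed.

(* The angle [atan (p / (al - u))] of the trajectory around the equilibrium [(al, 0)] would
   increase at a uniform rate, because [b ^ 2 < 4 m] makes that equilibrium a focus. *)
Lemma no_monotone_approach a u p : traj a u p ->
  (forall t, a <= t -> u t < al) -> (forall t, a <= t -> 0 < p t) ->
  (forall e, 0 < e -> exists N, a <= N /\ forall t, N <= t -> al - u t < e /\ p t < e) -> False.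
Proof.
  intros H Hu Hp Hlim.
  destruct oscillation_margin as (e & k & He & Hk & Hquad).
  destruct (psi_near_0 e He) as (r & Hr & Hpsi).
  assert (Hlin : exists d, 0 < d /\ forall s, al - d < s < al -> (m - e) * (al - s) <= - g s).
  { pose proof (dd_derive _ _ _ _ _ _ _ Hg) as Hd. apply is_derive_Reals in Hd.
    destruct (Hd e He) as ([d Hd0] & Hx). exists d. split; [exact Hd0|]. intros s Hs.
    simpl in Hx. specialize (Hx (s - al) ltac:(lra)).
    rewrite Rabs_left in Hx by lra. specialize (Hx ltac:(lra)).
    replace (al + (s - al)) with s in Hx by ring. rewrite g_zero, Rminus_0_r in Hx.
    apply Rabs_def2 in Hx. destruct Hx as [_ Hx].
    assert (E : g s = g s / (s - al) * (s - al)) by (field; lra). nra. }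
  destruct Hlin as (d & Hd & Hlin).
  destruct (Hlim (Rmin r d)) as (N & HN & HNt); [apply Rmin_glb_lt; lra|].
  pose proof (Rmin_l r d) as R1. pose proof (Rmin_r r d) as R2.
  set (th := fun t => atan (p t / (al - u t))).
  assert (Hden : forall t, a <= t -> 0 < al - u t) by (intros t Ht; specialize (Hu t Ht); lra).
  (* During a time [PI / k + 1] the angle would grow by at least [PI + k], more than the range of
     [atan] allows. *)
  assert (Hslope : k * (N + (PI / k + 1) - N) <= th (N + (PI / k + 1)) - th N).
  { assert (0 < PI / k) by (apply Rdiv_lt_0_compat; [apply PI_RGT_0|lra]).
    (* With [x = al - u] and [q = p], this derivative is at least the form of [oscillation_margin]
       divided by [x ^ 2 + q ^ 2]. *)
    apply (derive_ge_slope th (fun t =>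
      ((- b * psi (p t) - g (u t)) * (al - u t) + p t * psi (p t)) / ((al - u t) ^ 2 + p t ^ 2))).
    - lra.
    - intros t Ht. specialize (Hden t ltac:(lra)).
      destruct (proj2 (proj2 (proj2 H)) t ltac:(lra)) as [D1 D2].
      unfold th.
      evar_last.
      + apply (is_derive_comp atan (fun t => p t / (al - u t))); [apply is_derive_atan|].
        apply (is_derive_div p (fun t => al - u t)); [exact D2| |lra].
        apply (is_derive_minus (fun _ => al) u); [apply @is_derive_const|exact D1].
      + unfold scal, minus, plus, opp, zero, mult; simpl. unfold mult, Rsqr; simpl.
        assert (0 < (al - u t) * (al - u t) + p t * p t) by nra.
        field. repeat split; nra.
    - intros t Ht. specialize (Hden t ltac:(lra)). unfold th.
      apply (continuity_pt_comp (fun t => p t / (al - u t)) atan).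
      + apply continuity_pt_div; [apply H| |lra].
        apply continuity_pt_minus; [apply continuity_pt_const; intros ? ?; reflexivity|apply H].
      + eapply is_derive_continuity_pt, is_derive_atan.
    - intros t Ht. specialize (Hden t ltac:(lra)). specialize (Hp t ltac:(lra)).
      destruct (HNt t ltac:(lra)) as [A1 A2].
      specialize (Hlin (u t) ltac:(lra)). specialize (Hpsi (p t) ltac:(lra)).
      pose proof (psi_ge (p t) ltac:(lra)) as Hpsi2.
      specialize (Hquad (al - u t) (p t) ltac:(lra) ltac:(lra)).
      assert (0 < (al - u t) ^ 2 + p t ^ 2) by nra.
      apply Rle_div_r; [lra|]. apply Rle_trans with (1 := Hquad).
      assert (b * psi (p t) * (al - u t) <= b * ((1 + e) * p t) * (al - u t)).
      { apply Rmult_le_compat_r; [lra|]. apply Rmult_le_compat_l; lra. }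
      nra. }
  assert (E : k * (N + (PI / k + 1) - N) = PI + k) by (field; lra).
  rewrite E in Hslope.
  pose proof (atan_bound (p N / (al - u N))).
  pose proof (atan_bound (p (N + (PI / k + 1)) / (al - u (N + (PI / k + 1))))).
  unfold th in Hslope. lra.
Qed.

(** If [u] stayed below [al], then [p > 0] would persist and [u] would increase. The momentum bound
    forces [u] to tend to [al], then [p] to tend to 0, and this contradicts
    [no_monotone_approach]. *)
Lemma crossing a u p : traj a u p -> 0 < u a < al -> 0 < p a ->
  exists T, a < T /\ u T = al /\ 0 < p T /\
    forall t, a <= t < T -> 0 < u t < al /\ 0 < p t.
Proof.
  intros H Hua Hpa.
  destruct (classic (exists t, a <= t /\ al <= u t)) as [(t & Ht & Hut)|Hn].
  { destruct (first_hit u al a t) as (T & HT & ET & Hs); [lra|intros; apply H|lra|].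
    assert (Hle : forall s, a <= s <= T -> u s <= al).
    { intros s Hs'. destruct (Req_dec s T) as [->|]; [lra|]. left. apply Hs. lra. }
    assert (Hpos : forall s, a <= s <= T -> 0 < p s).
    { intros s Hs'. apply (traj_stays_rising a u p a s H); [lra|exact Hpa|].
      intros r Hr. apply Hle. lra. }
    exists T. split; [lra|]. split; [exact ET|]. split; [apply Hpos; lra|].
    intros s Hs'. split; [split|]; [|apply Hs; lra|apply Hpos; lra].
    apply Rlt_le_trans with (u a); [lra|].
    apply (traj_increasing a u p); [exact H|lra|]. intros r Hr. left. apply Hpos. lra. }
  exfalso.
  assert (Hlt : forall t, a <= t -> u t < al).
  { intros t Ht. apply Rnot_le_lt. intros Hc. apply Hn. now exists t. }
  assert (Hpos : forall t, a <= t -> 0 < p t).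
  { intros t Ht. apply (traj_stays_rising a u p a t H); [lra|exact Hpa|].
    intros r Hr. left. apply Hlt. lra. }
  assert (Hmono : forall s t, a <= s <= t -> u s <= u t).
  { intros s t Hst. apply (traj_increasing a u p); [exact H|lra|].
    intros r Hr. left. apply Hpos. lra. }
  assert (HpP : forall t, p t <= P) by (intros t; apply Rabs_le_between, H).
  assert (Hu_lim : forall e, 0 < e -> exists N, a <= N /\ forall t, N <= t -> al - u t < e).
  { intros e He. apply NNPP. intros Hc.
    assert (Hall : forall t, a <= t -> u t <= al - e).
    { intros t Ht. apply Rnot_lt_le. intros Hlt'. apply Hc. exists t. split; [exact Ht|].
      intros s Hs. specialize (Hmono t s ltac:(lra)). lra. }
    destruct (g_uniform_neg (u a) (al - e)) as (c & Hc0 & Hcg);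
      [split; [lra|apply Hall; lra]|lra|].
    (* The momentum would gain at least [P + b + c], whereas [p <= P] and [0 < u < 1] allow a gain
       of at most [P + b]. *)
    set (T := (P + b) / c + 1).
    assert (HT : 0 < (P + b) / c) by (apply Rdiv_lt_0_compat; lra).
    assert (K : c * (a + T - a) <= (p (a + T) + b * u (a + T)) - (p a + b * u a)).
    { apply (derive_ge_slope (fun t => p t + b * u t) (fun t => - g (u t))).
      - unfold T; lra.
      - intros t Ht. apply (momentum_derive a); [exact H|lra].
      - intros t Ht. now apply (momentum_continuity_pt a).
      - intros t Ht. specialize (Hcg (u t)).
        specialize (Hall t ltac:(lra)). specialize (Hmono a t ltac:(lra)).
        specialize (Hcg ltac:(lra)). lra. }
    assert (E : c * (a + T - a) = P + b + c) by (unfold T; field; lra).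
    specialize (HpP (a + T)). specialize (Hlt (a + T) ltac:(unfold T; lra)). nra. }
  apply (no_monotone_approach a u p H Hlt Hpos).
  intros e He.
  set (e' := Rmin e (e / (2 * b))).
  assert (He' : 0 < e').
  { apply Rmin_glb_lt; [lra|]. apply Rdiv_lt_0_compat; lra. }
  assert (He1 : e' <= e) by apply Rmin_l.
  assert (He2 : e' * (2 * b) <= e) by (apply Rle_div_r; [lra|apply Rmin_r]).
  destruct (Hu_lim e' He') as (N & HN & HNt).
  exists N. split; [exact HN|]. intros t Ht. split; [specialize (HNt t Ht); lra|].
  apply Rnot_le_lt. intros Hpt.
  (* Below [al] the momentum does not decrease, and [u] has less than [e / (2 * b)] left to travel:
     a value [p t >= e] would leave [p] above [e / 2] forever and carry [u] past 1 within time
     [2 / e]. *)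
  assert (Hlow : forall s, t <= s -> e / 2 <= p s).
  { intros s Hs.
    assert (K : p t + b * u t <= p s + b * u s).
    { apply (derive_nonneg_le (fun t => p t + b * u t) (fun t => - g (u t))); [lra| | |].
      - intros r Hr. apply (momentum_derive a); [exact H|lra].
      - intros r Hr. now apply (momentum_continuity_pt a).
      - intros r Hr. specialize (Hlt r ltac:(lra)). pose proof (g_le_0 (u r) ltac:(lra)). lra. }
    specialize (HNt t Ht). specialize (Hlt s ltac:(lra)).
    assert (b * (u s - u t) <= b * e') by (apply Rmult_le_compat_l; lra). lra. }
  assert (K : e / 2 * (t + 2 / e - t) <= u (t + 2 / e) - u t).
  { assert (0 < 2 / e) by (apply Rdiv_lt_0_compat; lra).
    apply (derive_ge_slope u (fun t => psi (p t))); [lra| | |].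
    - intros r Hr. apply H. lra.
    - intros; apply H.
    - intros r Hr. specialize (Hlow r ltac:(lra)). specialize (HpP r).
      pose proof (psi_ge (p r) ltac:(lra)). lra. }
  assert (E : e / 2 * (t + 2 / e - t) = 1) by (field; lra).
  assert (0 < 2 / e) by (apply Rdiv_lt_0_compat; lra).
  specialize (Hlt (t + 2 / e) ltac:(lra)). specialize (Hmono a t ltac:(lra)). lra.
Qed.

(** At a first zero of [p] with [al <= u < 1] the energy is [G u < G 1]. If [p] stayed positive with
    [u] below [s], the momentum would decrease at a uniform rate forever, which is impossible.
    Otherwise [u] reaches [s] still rising. *)
Lemma reach a u p s : traj a u p -> u a = al -> 0 < p a -> al < s < 1 ->
  (exists T, a <= T /\ energy (p T) + G (u T) < G 1 /\ forall t, a <= t <= T -> u t < 1) \/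
  (exists T, a < T /\ u T = s /\ forall t, a <= t <= T -> al <= u t <= s /\ 0 < p t).
Proof.
  intros H Hua Hpa Hs.
  assert (Hzero : forall T, a <= T -> p T = 0 -> al <= u T < 1 -> energy (p T) + G (u T) < G 1).
  { intros T HT E Hu. rewrite E, energy_0, Rplus_0_l. apply potential_incr_strict; lra. }
  assert (Hfirst : forall t, a <= t -> p t <= 0 -> (forall r, a <= r <= t -> u r < 1) ->
    exists T, a <= T /\ energy (p T) + G (u T) < G 1 /\ forall t, a <= t <= T -> u t < 1).
  { intros t Ht Hpt Hlt1.
    destruct (first_zero a u p a t H ltac:(lra) Hpa Hpt) as (T & HT & ET & Hpos).
    exists T. split; [lra|]. split; [|intros r Hr; apply Hlt1; lra].
    apply Hzero; [lra|exact ET|]. split; [|apply Hlt1; lra].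
    rewrite <- Hua. apply (traj_increasing a u p); [exact H|lra|].
    intros r Hr. left. apply Hpos. lra. }
  destruct (classic (exists t, a <= t /\ s <= u t)) as [(t & Ht & Hut)|Hn].
  - destruct (first_hit u s a t) as (T & HT & ET & Hsm); [lra|intros; apply H|lra|].
    assert (Hle : forall r, a <= r <= T -> u r <= s).
    { intros r Hr. destruct (Req_dec r T) as [->|]; [lra|]. left. apply Hsm. lra. }
    destruct (classic (exists t, a <= t <= T /\ p t <= 0)) as [(t' & Ht' & Hpt')|Hnp].
    + left. apply (Hfirst t'); [lra|exact Hpt'|]. intros r Hr. specialize (Hle r ltac:(lra)). lra.
    + right. exists T. split; [lra|]. split; [exact ET|].
      assert (Hpos : forall r, a <= r <= T -> 0 < p r).
      { intros r Hr. apply Rnot_le_lt. intros Hc. apply Hnp. now exists r. }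
      intros r Hr. split; [split; [|now apply Hle]|now apply Hpos].
      rewrite <- Hua. apply (traj_increasing a u p); [exact H|lra|].
      intros r' Hr'. left. apply Hpos. lra.
  - left.
    assert (Hlt : forall t, a <= t -> u t < s).
    { intros t Ht. apply Rnot_le_lt. intros Hc. apply Hn. now exists t. }
    destruct (classic (exists t, a <= t /\ p t <= 0)) as [(t' & Ht' & Hpt')|Hnp].
    { apply (Hfirst t'); [lra|exact Hpt'|]. intros r Hr. specialize (Hlt r ltac:(lra)). lra. }
    exfalso.
    assert (Hpos : forall r, a <= r -> 0 < p r).
    { intros r Hr. apply Rnot_le_lt. intros Hc. apply Hnp. now exists r. }
    (* One unit of time moves [u] off the zero [al] of [g], so that the force has a positive lower
       bound afterwards. *)
    assert (H1 : al < u (a + 1)).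
    { rewrite <- Hua. apply (traj_increasing_strict a u p); [exact H|lra|].
      intros r Hr. apply Hpos. lra. }
    destruct (g_uniform_pos (u (a + 1)) s) as (c & Hc & Hcg);
      [split; [lra|left; apply Hlt; lra]|lra|].
    set (T := (P + b) / c + 1).
    assert (HT : 0 < (P + b) / c) by (apply Rdiv_lt_0_compat; lra).
    assert (K : (p (a + 1 + T) + b * u (a + 1 + T)) - (p (a + 1) + b * u (a + 1))
      <= - c * (a + 1 + T - (a + 1))).
    { apply (derive_le_slope (fun t => p t + b * u t) (fun t => - g (u t))).
      - unfold T; lra.
      - intros t Ht. apply (momentum_derive a); [exact H|lra].
      - intros t Ht. now apply (momentum_continuity_pt a).
      - intros t Ht. specialize (Hcg (u t)).
        pose proof (traj_increasing a u p (a + 1) t H ltac:(lra)) as Hmono.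
        specialize (Hlt t ltac:(lra)).
        assert (u (a + 1) <= u t) by (apply Hmono; intros; left; apply Hpos; lra).
        specialize (Hcg ltac:(lra)). lra. }
    assert (E : - c * (a + 1 + T - (a + 1)) = - (P + b + c)) by (unfold T; field; lra).
    specialize (Hpos (a + 1 + T) ltac:(unfold T; lra)).
    pose proof (proj1 (proj2 (proj2 H)) (a + 1)) as HpP. apply Rabs_le_between in HpP.
    specialize (Hlt (a + 1) ltac:(lra)).
    pose proof (traj_increasing a u p a (a + 1 + T) H ltac:(unfold T; lra)) as Hmono.
    assert (al <= u (a + 1 + T)).
    { rewrite <- Hua. apply Hmono. intros r Hr. apply Rnot_lt_le. intros Hc'. apply Hnp.
      exists r. lra. }
    nra.
Qed.

(* The phase curve p = Q u of a trajectory of the system with damping b0 < b which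
   joins (0, 0) to (1, 0). *)
Definition barrier (Q : R -> R) (b0 : R) : Prop :=
  0 <= b0 < b /\
  (forall s, 0 < s < 1 -> 0 < Q s < 1 /\ is_derive Q s (- b0 - g s / psi (Q s))) /\
  (forall c s0, 0 < c -> s0 < 1 -> exists s, s0 < s < 1 /\ Q s < c).

(** The derivative of [Q u - p] along a trajectory. At a contact [p = Q u] the second term vanishes
    and [(b - b0) * psi p > 0] remains. *)
Definition barrier_gap_slope (Q : R -> R) (b0 : R) (u p : R -> R) (t : R) : R :=
  (b - b0) * psi (p t) + g (u t) * (1 - psi (p t) / psi (Q (u t))).

Lemma barrier_psi_pos Q b0 s : barrier Q b0 -> 0 < s < 1 -> 0 < psi (Q s).
Proof.
  intros (_ & HQ & _) Hs. destruct (HQ s Hs) as [H _].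
  pose proof (psi_ge (Q s) ltac:(lra)). lra.
Qed.

Lemma barrier_gap_derive Q b0 a u p t : barrier Q b0 -> traj a u p -> a < t -> 0 < u t < 1 ->
  is_derive (fun t => Q (u t) - p t) t (barrier_gap_slope Q b0 u p t).
Proof.
  intros HQ H Ht Hu. pose proof (barrier_psi_pos Q b0 (u t) HQ Hu) as Hpos.
  destruct HQ as (Hb0 & HQ & _). destruct (HQ (u t) Hu) as [_ HQd].
  destruct (proj2 (proj2 (proj2 H)) t Ht) as [D1 D2].
  replace (barrier_gap_slope Q b0 u p t) with
    (psi (p t) * (- b0 - g (u t) / psi (Q (u t))) - (- b * psi (p t) - g (u t)))
    by (unfold barrier_gap_slope; field; lra).
  apply (is_derive_minus (fun t => Q (u t)) p); [|exact D2].
  now apply (is_derive_comp Q u).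
Qed.

Lemma barrier_comp_continuity_pt Q b0 a u p t : barrier Q b0 -> traj a u p -> 0 < u t < 1 ->
  continuity_pt (fun t => Q (u t)) t.
Proof.
  intros (_ & HQ & _) H Hu. apply (continuity_pt_comp u Q); [apply H|].
  eapply is_derive_continuity_pt. now apply HQ.
Qed.

Lemma barrier_gap_slope_continuity_pt Q b0 a u p t : barrier Q b0 -> traj a u p -> 0 < u t < 1 ->
  continuity_pt (barrier_gap_slope Q b0 u p) t.
Proof.
  intros HQ H Hu. pose proof (barrier_psi_pos Q b0 (u t) HQ Hu) as Hpos.
  assert (Cp := psi_traj_continuity_pt a u p H t).
  unfold barrier_gap_slope. apply continuity_pt_plus; [now apply continuity_pt_scal|].
  apply continuity_pt_mult.
  - apply (continuity_pt_comp u g); [apply H|apply g_cont].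
  - apply continuity_pt_minus; [apply continuity_pt_const; intros ? ?; reflexivity|].
    apply continuity_pt_div; [exact Cp| |lra].
    apply (continuity_pt_comp (fun t => Q (u t)) psi).
    + now apply (barrier_comp_continuity_pt Q b0 a u p).
    + apply psi_continuity_pt. destruct (proj1 (proj2 HQ) (u t) Hu) as [B _].
      rewrite Rabs_pos_eq; lra.
Qed.

(** At the last contact before a violation the gap has positive slope, so it is positive just
    afterwards: a contradiction. The strict inequality [b0 < b] takes the place of uniqueness. *)
Lemma barrier_invariant Q b0 a u p t : barrier Q b0 -> traj a u p -> a <= t ->
  (forall r, a <= r <= t -> 0 < u r < 1) -> p a <= Q (u a) -> p t <= Q (u t).
Proof.
  intros HQ H Ht Hu Ha. apply Rnot_lt_le. intros Hlt.
  assert (Cgap : forall r, a <= r <= t -> continuity_pt (fun t => Q (u t) - p t) r).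
  { intros r Hr. apply continuity_pt_minus; [|apply H].
    apply (barrier_comp_continuity_pt Q b0 a u p); auto. }
  destruct (last_exit (fun t => Q (u t) - p t) a t) as (T & HT & ET & Hs); [lra|exact Cgap|lra|].
  assert (Hpos : 0 < barrier_gap_slope Q b0 u p T).
  { unfold barrier_gap_slope. replace (p T) with (Q (u T)) by lra.
    pose proof (barrier_psi_pos Q b0 (u T) HQ (Hu T ltac:(lra))) as B.
    replace (psi (Q (u T)) / psi (Q (u T))) with 1 by (field; lra).
    destruct HQ as (Hb0 & _). nra. }
  destruct (continuity_pt_eps _ T
    (barrier_gap_slope_continuity_pt Q b0 a u p T HQ H (Hu T ltac:(lra))) _ Hpos) as (d & Hd & Hx).
  set (r := Rmin t (T + d / 2)).
  assert (Hr : T < r <= t /\ r <= T + d / 2).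
  { unfold r. repeat split; [apply Rmin_glb_lt; lra|apply Rmin_l|apply Rmin_r]. }
  assert (K : Q (u T) - p T < Q (u r) - p r).
  { apply (derive_pos_lt (fun t => Q (u t) - p t) (barrier_gap_slope Q b0 u p)); [lra| | |].
    - intros s Hs'. apply (barrier_gap_derive Q b0 a); [exact HQ|exact H|lra|]. apply Hu. lra.
    - intros s Hs'. apply Cgap. lra.
    - intros s Hs'. specialize (Hx s). rewrite Rabs_pos_eq in Hx by lra.
      specialize (Hx ltac:(lra)). apply Rabs_def2 in Hx. lra. }
  specialize (Hs r ltac:(lra)). lra.
Qed.

Lemma escape_barrier Q b0 a u p : barrier Q b0 -> traj a u p -> u a = al -> 0 < p a ->
  p a <= Q al -> exists T, a <= T /\ energy (p T) + G (u T) < G 1 /\ forall t, a <= t <= T -> u t < 1.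
Proof.
  intros HQ H Hua Hpa HpQ.
  destruct (reach a u p ((al + 1) / 2) H Hua Hpa ltac:(lra)) as [Hdone|(T1 & HT1 & E1 & R1)];
    [exact Hdone|].
  assert (Hgap : forall T, a <= T -> (forall t, a <= t <= T -> al <= u t < 1 /\ 0 < p t) ->
    forall s t, a <= s < t -> t <= T -> Q (u s) - p s < Q (u t) - p t).
  { intros T HT Hr s t Hst HtT.
    apply (derive_pos_lt (fun t => Q (u t) - p t) (barrier_gap_slope Q b0 u p)); [lra| | |].
    - intros r Hr'. destruct (Hr r ltac:(lra)).
      apply (barrier_gap_derive Q b0 a); [exact HQ|exact H|lra|lra].
    - intros r Hr'. destruct (Hr r ltac:(lra)). apply continuity_pt_minus; [|apply H].
      apply (barrier_comp_continuity_pt Q b0 a u p); [exact HQ|exact H|lra].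
    - intros r Hr'. destruct (Hr r ltac:(lra)) as [U1 U2].
      assert (Hle : p r <= Q (u r)).
      { apply (barrier_invariant Q b0 a); [exact HQ|exact H|lra| |rewrite Hua; exact HpQ].
        intros r' Hr''. destruct (Hr r' ltac:(lra)). lra. }
      destruct (proj1 (proj2 HQ) (u r) ltac:(lra)) as [B _].
      pose proof (psi_le (p r) (Q (u r)) ltac:(lra) ltac:(lra)) as L.
      pose proof (psi_ge (p r) ltac:(lra)) as L2.
      assert (psi (p r) / psi (Q (u r)) <= 1).
      { apply Rle_div_l; lra. }
      pose proof (g_ge_0 (u r) ltac:(lra)).
      unfold barrier_gap_slope. destruct HQ as (Hb0 & _).
      apply Rplus_lt_le_0_compat; [apply Rmult_lt_0_compat; lra|apply Rmult_le_pos; lra]. }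
  (* The gap may be 0 at the start; at the intermediate level [(al + 1) / 2] it has become positive.
     It can only grow from there, but at a level where [Q < c] it is less than [c], because
     [p > 0]. *)
  set (c := Q (u T1) - p T1).
  assert (Hc : 0 < c).
  { pose proof (Hgap T1 ltac:(lra)) as K. specialize (K ltac:(intros t Ht; destruct (R1 t Ht); lra)).
    specialize (K a T1 ltac:(lra) ltac:(lra)). rewrite Hua in K. unfold c. lra. }
  destruct (proj2 (proj2 HQ) c ((al + 1) / 2) Hc ltac:(lra)) as (s & Hs & HQs).
  destruct (reach a u p s H Hua Hpa ltac:(lra)) as [Hdone|(T2 & HT2 & E2 & R2)];
    [exact Hdone|exfalso].
  assert (HT12 : T1 < T2).
  { apply Rnot_le_lt. intros Hle. destruct (R1 T2 ltac:(lra)). lra. }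
  pose proof (Hgap T2 ltac:(lra)) as K. specialize (K ltac:(intros t Ht; destruct (R2 t Ht); lra)).
  specialize (K T1 T2 ltac:(lra) ltac:(lra)). fold c in K. rewrite E2 in K.
  destruct (R2 T2 ltac:(lra)). lra.
Qed.

(** The three cases are part (ii), part (i) with [eps <= eps_bar f], and part (i) with a front. [k]
    bounds [p] when the trajectory passes [al / 2], which in the third case places it below the
    barrier. *)
Definition escape_condition (k : R) : Prop :=
  0 < G 1 \/ 1 <= G 1 - G al \/ exists Q b0, barrier Q b0 /\ k <= Q (al / 2).

Lemma escape k a u p : traj a u p -> u a = al / 2 -> 0 < p a -> p a <= k ->
  energy (p a) + G (u a) < 0 -> escape_condition k ->
  exists T, a <= T /\ energy (p T) + G (u T) < G 1 /\ forall t, a <= t <= T -> u t < 1.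
Proof.
  intros H Hua Hpa Hk HV Hesc.
  destruct Hesc as [HG|Hesc].
  { exists a. split; [lra|]. split; [lra|]. intros t Ht. replace t with a by lra. lra. }
  destruct (crossing a u p H ltac:(lra) Hpa) as (T & HT & ET & HpT & Hbefore).
  destruct Hesc as [HG|(Q & b0 & HQ & HkQ)].
  - exists T. split; [lra|]. split.
    + pose proof (energy_lt_1 (p T) (traj_abs_lt_1 a u p H T)). rewrite ET. lra.
    + intros t Ht. destruct (Req_dec t T) as [->|]; [lra|]. destruct (Hbefore t ltac:(lra)). lra.
  - destruct (escape_barrier Q b0 T u p) as (T' & HT' & HV' & Hlt).
    + exact HQ.
    + now apply (trajectory_weaken g b P a T); [lra|].
    + exact ET.
    + exact HpT.
    + rewrite <- ET. apply (barrier_invariant Q b0 a); [exact HQ|exact H|lra| |rewrite Hua; lra].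
      intros r Hr. destruct (Req_dec r T) as [->|]; [lra|]. destruct (Hbefore r ltac:(lra)). lra.
    + exists T'. split; [lra|]. split; [exact HV'|]. intros t Ht.
      destruct (Rle_dec T t) as [h|h]; [apply Hlt; lra|].
      destruct (Hbefore t ltac:(lra)). lra.
Qed.

(** * Convergence to the equilibrium *)

Lemma potential_ge_al s : G al <= G s.
Proof.
  destruct (Rle_dec s al); [apply potential_decr; lra|apply potential_incr; lra].
Qed.

(** [G u] never exceeds the initial energy, which is below both [G 0 = 0] and [G 1]. Since [G]
    decreases up to [al] and increases after it, its sublevel set stays away from 0 and 1. *)
Lemma trapped a u p : traj a u p -> energy (p a) + G (u a) < 0 -> energy (p a) + G (u a) < G 1 ->
  exists a1 a2, 0 < a1 < al /\ al < a2 < 1 /\ forall t, a <= t -> a1 < u t < a2.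
Proof.
  intros H V0 V1. set (V := energy (p a) + G (u a)) in *.
  destruct (continuity_pt_eps G 0 (potential_continuity_pt 0) (- V) ltac:(lra)) as (d0 & Hd0 & H0).
  destruct (continuity_pt_eps G 1 (potential_continuity_pt 1) (G 1 - V) ltac:(lra)) as (d1 & Hd1 & H1).
  set (r0 := Rmin (d0 / 2) (al / 2)). set (r1 := Rmin (d1 / 2) ((1 - al) / 2)).
  assert (Hr0 : 0 < r0 /\ r0 <= d0 / 2 /\ r0 <= al / 2).
  { unfold r0. split; [apply Rmin_glb_lt; lra|]. split; [apply Rmin_l|apply Rmin_r]. }
  assert (Hr1 : 0 < r1 /\ r1 <= d1 / 2 /\ r1 <= (1 - al) / 2).
  { unfold r1. split; [apply Rmin_glb_lt; lra|]. split; [apply Rmin_l|apply Rmin_r]. }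
  exists r0, (1 - r1). split; [lra|]. split; [lra|]. intros t Ht.
  assert (HV : G (u t) <= V).
  { pose proof (total_energy_noninc a u p a t H ltac:(lra)) as K.
    pose proof (energy_nonneg (p t)). fold V in K. lra. }
  split; apply Rnot_le_lt; intros Hle.
  - pose proof (potential_decr (u t) r0 ltac:(lra)) as K.
    specialize (H0 r0). rewrite Rminus_0_r, Rabs_pos_eq in H0 by lra.
    specialize (H0 ltac:(lra)). rewrite potential_0 in H0. apply Rabs_def2 in H0. lra.
  - pose proof (potential_incr (1 - r1) (u t) ltac:(lra)) as K.
    specialize (H1 (1 - r1)). rewrite Rabs_left in H1 by lra.
    specialize (H1 ltac:(lra)). apply Rabs_def2 in H1. lra.
Qed.

(** [p] is Lipschitz with constant [S], so [Rabs p >= e] at one time keeps [Rabs p] at least [e / 2]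
    for a time [h] and costs an energy of at least [c]. This is impossible once the energy is within
    [c] of its infimum. *)
Lemma velocity_vanishes a u p : traj a u p ->
  forall e, 0 < e -> exists N, a <= N /\ forall t, N <= t -> Rabs (p t) < e.
Proof.
  intros H e He.
  assert (HpP : forall t, Rabs (p t) <= P) by apply H.
  set (S := b * psi P + M).
  assert (HM : 0 <= M) by (apply Rle_trans with (2 := g_bound 0), Rabs_pos).
  assert (HpsP : 0 < psi P) by (pose proof (psi_ge P ltac:(lra)); lra).
  assert (HS : 0 < S) by (unfold S; nra).
  assert (Hp' : forall t, Rabs (- b * psi (p t) - g (u t)) <= S).
  { intros t. replace (- b * psi (p t) - g (u t)) with (- (b * psi (p t)) + - g (u t)) by ring.
    apply Rle_trans with (1 := Rabs_triang _ _). rewrite !Rabs_Ropp, Rabs_mult, (Rabs_pos_eq b) by lra.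
    specialize (g_bound (u t)). rewrite Rabs_psi.
    pose proof (psi_le (Rabs (p t)) P (conj (Rabs_pos _) (HpP t)) ltac:(lra)). unfold S. nra. }
  assert (HpL : forall s t, a <= s <= t -> Rabs (p t - p s) <= S * (t - s)).
  { intros s t Hst. apply Rabs_le. split.
    - assert (- S * (t - s) <= p t - p s); [|lra].
      apply (derive_ge_slope p (fun t => - b * psi (p t) - g (u t))); [lra| | |].
      + intros r Hr. apply H. lra.
      + intros; apply H.
      + intros r _. specialize (Hp' r). apply Rabs_le_between in Hp'. lra.
    - apply (derive_le_slope p (fun t => - b * psi (p t) - g (u t))); [lra| | |].
      + intros r Hr. apply H. lra.
      + intros; apply H.
      + intros r _. specialize (Hp' r). apply Rabs_le_between in Hp'. lra. }
  set (V := fun t => energy (p t) + G (u t)).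
  set (h := e / (2 * S)).
  assert (Hh : 0 < h) by (unfold h; apply Rdiv_lt_0_compat; lra).
  assert (HhS : S * h = e / 2) by (unfold h; field; lra).
  set (c := b * (e / 2) ^ 2 * h).
  assert (Hc : 0 < c).
  { unfold c. apply Rmult_lt_0_compat; [|exact Hh]. apply Rmult_lt_0_compat; [lra|].
    apply pow_lt. lra. }
  destruct (completeness (fun x => exists t, a <= t /\ x = - V t)) as (L & HL1 & HL2).
  { exists (- G al). intros x (t & _ & ->). pose proof (energy_nonneg (p t)).
    pose proof (potential_ge_al (u t)). unfold V. lra. }
  { exists (- V a). exists a. split; [lra|reflexivity]. }
  assert (HN : exists N, a <= N /\ L - c < - V N).
  { apply NNPP. intros Hn. assert (L <= L - c); [|lra]. apply HL2. intros x (t & Ht & ->).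
    apply Rnot_lt_le. intros Hlt. apply Hn. now exists t. }
  destruct HN as (N & HN & HVN). exists N. split; [exact HN|]. intros t Ht.
  apply Rnot_le_lt. intros Hpt.
  assert (K1 : V t <= V N) by (apply (total_energy_noninc a u p N t H); lra).
  assert (K2 : - V (t + h) <= L) by (apply HL1; exists (t + h); split; [lra|reflexivity]).
  assert (K3 : V (t + h) - V t <= - b * (e / 2) ^ 2 * (t + h - t)).
  { apply (derive_le_slope V (fun t => - b * psi (p t) ^ 2)); [lra| | |].
    - intros r Hr. apply (total_energy_derive a); [exact H|lra].
    - intros r Hr. now apply (total_energy_continuity_pt a).
    - intros r Hr. specialize (HpL t r ltac:(lra)).
      assert (Hr2 : e / 2 <= Rabs (p r)).
      { assert (S * (r - t) <= S * h) by (apply Rmult_le_compat_l; lra).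
        pose proof (Rabs_triang_inv (p t) (p t - p r)) as T1.
        replace (p t - (p t - p r)) with (p r) in T1 by ring.
        rewrite (Rabs_minus_sym (p t) (p r)) in T1. lra. }
      pose proof (psi_ge (Rabs (p r)) (conj (Rabs_pos _) (traj_abs_lt_1 a u p H r))) as T2.
      rewrite <- Rabs_psi in T2.
      assert ((e / 2) ^ 2 <= psi (p r) ^ 2).
      { rewrite <- (pow2_abs (psi (p r))). apply pow_incr. lra. }
      nra. }
  replace (- b * (e / 2) ^ 2 * (t + h - t)) with (- c) in K3 by (unfold c; ring). lra.
Qed.

(** Once [p] is small, [u] moves by at most [e / 2] in unit time. Were [u] at distance [e] from
    [al], the force would keep its sign and a size of at least [c] during that time, and would
    change [p] by more than its smallness permits. [trapped] keeps [u] away from the other zeros of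
    [g]. *)
Lemma converges a u p : traj a u p -> energy (p a) + G (u a) < 0 -> energy (p a) + G (u a) < G 1 ->
  is_lim u p_infty al.
Proof.
  intros H V0 V1.
  destruct (trapped a u p H V0 V1) as (a1 & a2 & Ha1 & Ha2 & Hin).
  set (k := / sqrt (1 - P ^ 2)).
  assert (Hk : 0 < k).
  { apply Rinv_0_lt_compat. destruct (sqrt_one_minus_pos P); [rewrite Rabs_pos_eq; lra|lra]. }
  assert (Hslow : forall e N, a <= N -> (forall t, N <= t -> Rabs (p t) < e) ->
    forall s t, N <= s <= t -> Rabs (psi (p t)) <= k * e /\ Rabs (u t - u s) <= k * e * (t - s)).
  { intros e N HN Hp s t Hst.
    assert (Hps : forall r, N <= r -> Rabs (psi (p r)) <= k * e).
    { intros r Hr. specialize (Hp r Hr).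
      pose proof (psi_linear_bound P (p r) ltac:(lra) (proj1 (proj2 (proj2 H)) r)) as B.
      fold k in B. nra. }
    split; [apply Hps; lra|]. apply Rabs_le. split.
    - assert (- (k * e) * (t - s) <= u t - u s); [|lra].
      apply (derive_ge_slope u (fun t => psi (p t))); [lra| | |].
      + intros r Hr. apply H. lra.
      + intros; apply H.
      + intros r Hr. specialize (Hps r ltac:(lra)). apply Rabs_le_between in Hps. lra.
    - apply (derive_le_slope u (fun t => psi (p t))); [lra| | |].
      + intros r Hr. apply H. lra.
      + intros; apply H.
      + intros r Hr. specialize (Hps r ltac:(lra)). apply Rabs_le_between in Hps. lra. }
  assert (Hpush : forall (e c : R), 0 < e -> 0 < c -> exists N, a <= N /\ forall t, N <= t ->
    (forall r, Rabs (r - u t) <= e / 2 -> a1 <= r <= a2 -> c <= Rabs (g r)) ->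
    (forall r r', Rabs (r - u t) <= e / 2 -> Rabs (r' - u t) <= e / 2 -> 0 <= g r * g r') -> False).
  { intros e c He Hc.
    (* The first entry bounds the displacement [k * d] by [e / 2]. The second makes the force beat
       the damping, at most [b * k * d], by at least [4 * d], while [p] can change by less than
       [2 * d]. *)
    set (d := Rmin (e / (2 * k)) (c / (2 * (b * k + 2)))).
    assert (Hbk : 0 < b * k) by nra.
    assert (Hd : 0 < d).
    { unfold d. apply Rmin_glb_lt; apply Rdiv_lt_0_compat; lra. }
    assert (Hd1 : d * (2 * k) <= e) by (apply Rle_div_r; [lra|apply Rmin_l]).
    assert (Hd2 : d * (2 * (b * k + 2)) <= c) by (apply Rle_div_r; [lra|apply Rmin_r]).
    destruct (velocity_vanishes a u p H d Hd) as (N & HN & HNp).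
    exists N. split; [exact HN|]. intros t Ht Hlow Hsign.
    assert (Hclose : forall r, t <= r <= t + 1 -> Rabs (u r - u t) <= e / 2).
    { intros r Hr. destruct (Hslow d N HN HNp t r ltac:(lra)) as [_ B].
      assert (k * d * (r - t) <= k * d * 1) by (apply Rmult_le_compat_l; nra). lra. }
    assert (Hgr : forall r, t <= r <= t + 1 -> c <= Rabs (g (u r))).
    { intros r Hr. apply Hlow; [now apply Hclose|]. destruct (Hin r ltac:(lra)). lra. }
    pose proof (HNp t ltac:(lra)) as P1. pose proof (HNp (t + 1) ltac:(lra)) as P2.
    apply Rabs_def2 in P1, P2.
    assert (Hpsr : forall r, t <= r <= t + 1 -> Rabs (psi (p r)) <= k * d).
    { intros r Hr. apply (Hslow d N HN HNp t r). lra. }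
    pose proof (Hgr t ltac:(lra)) as Hgt.
    assert (Hself : Rabs (u t - u t) <= e / 2) by (rewrite Rminus_diag_eq, Rabs_R0 by reflexivity; lra).
    destruct (Rle_dec 0 (g (u t))) as [hs|hs].
    - rewrite Rabs_pos_eq in Hgt by exact hs.
      assert (K : p (t + 1) - p t <= (b * (k * d) - c) * (t + 1 - t)).
      { apply (derive_le_slope p (fun t => - b * psi (p t) - g (u t))); [lra| | |].
        - intros r Hr. apply H. lra.
        - intros; apply H.
        - intros r Hr. specialize (Hgr r ltac:(lra)). specialize (Hpsr r ltac:(lra)).
          specialize (Hsign (u t) (u r) Hself (Hclose r ltac:(lra))).
          assert (0 <= g (u r)) by nra. rewrite Rabs_pos_eq in Hgr by assumption.
          apply Rabs_le_between in Hpsr. nra. }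
      nra.
    - rewrite Rabs_left in Hgt by lra.
      assert (K : (c - b * (k * d)) * (t + 1 - t) <= p (t + 1) - p t).
      { apply (derive_ge_slope p (fun t => - b * psi (p t) - g (u t))); [lra| | |].
        - intros r Hr. apply H. lra.
        - intros; apply H.
        - intros r Hr. specialize (Hgr r ltac:(lra)). specialize (Hpsr r ltac:(lra)).
          specialize (Hsign (u t) (u r) Hself (Hclose r ltac:(lra))).
          assert (g (u r) <= 0) by nra. rewrite Rabs_left1 in Hgr by assumption.
          apply Rabs_le_between in Hpsr. nra. }
      nra. }
  apply is_lim_spec. intros [e0 He0]. simpl.
  set (e := Rmin e0 (Rmin (al - a1) (a2 - al))).
  assert (He : 0 < e) by (unfold e; repeat apply Rmin_glb_lt; lra).
  assert (He1 : e <= e0) by apply Rmin_l.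
  assert (He2 : e <= al - a1) by (apply Rle_trans with (1 := Rmin_r _ _), Rmin_l).
  assert (He3 : e <= a2 - al) by (apply Rle_trans with (1 := Rmin_r _ _), Rmin_r).
  destruct (g_uniform_neg a1 (al - e / 2)) as (c1 & Hc1 & G1); [lra|lra|].
  destruct (g_uniform_pos (al + e / 2) a2) as (c2 & Hc2 & G2); [lra|lra|].
  destruct (Hpush e (Rmin c1 c2) He ltac:(now apply Rmin_glb_lt)) as (N & HN & Hcontra).
  exists N. intros t Ht. apply Rnot_le_lt. intros Hle. apply (Hcontra t); [lra| |].
  - intros r Hr Hra. apply Rabs_le_between in Hr.
    destruct (Rle_dec al (u t)) as [h|h].
    + rewrite Rabs_pos_eq in Hle by lra. specialize (G2 r ltac:(lra)).
      rewrite Rabs_pos_eq by lra. pose proof (Rmin_r c1 c2). lra.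
    + rewrite Rabs_left in Hle by lra. specialize (G1 r ltac:(lra)).
      rewrite Rabs_left by lra. pose proof (Rmin_l c1 c2). lra.
  - intros r r' Hr Hr'. apply Rabs_le_between in Hr, Hr'.
    destruct (Rle_dec al (u t)) as [h|h].
    + rewrite Rabs_pos_eq in Hle by lra.
      pose proof (g_ge_0 r ltac:(lra)). pose proof (g_ge_0 r' ltac:(lra)). nra.
    + rewrite Rabs_left in Hle by lra.
      pose proof (g_le_0 r ltac:(lra)). pose proof (g_le_0 r' ltac:(lra)). nra.
Qed.

(** * The unstable trajectory of the saddle *)

(** Gronwall's inequality: the damping term is nonpositive, and the two cross terms are controlled
    by [psi_linear_bound] and [dd_lin0]. It shows that starts closer to the saddle take longer to
    reach [al / 2], and that the saddle cannot be left in finite time within this region. *)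
Lemma saddle_growth a u p s t : traj a u p -> a <= s <= t ->
  (forall r, s <= r <= t -> 0 <= u r < al /\ 0 <= p r) ->
  u t ^ 2 + p t ^ 2 <= (u s ^ 2 + p s ^ 2) * exp ((/ sqrt (1 - P ^ 2) + l) * (t - s)).
Proof.
  intros H Hst Hr. set (k := / sqrt (1 - P ^ 2)). set (C := k + l).
  assert (K : (u t ^ 2 + p t ^ 2) * exp (- C * (t - s)) <= (u s ^ 2 + p s ^ 2) * exp (- C * (s - s))).
  { apply Rminus_le. rewrite <- (Rmult_0_l (t - s)).
    apply (derive_le_slope (fun t => (u t ^ 2 + p t ^ 2) * exp (- C * (t - s)))
      (fun t => (2 * u t * psi (p t) + 2 * p t * (- b * psi (p t) - g (u t))) * exp (- C * (t - s)) +
        (u t ^ 2 + p t ^ 2) * (- C * exp (- C * (t - s))))); [lra| | |].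
    - intros r Hr'. destruct (proj2 (proj2 (proj2 H)) r ltac:(lra)) as [D1 D2].
      apply (is_derive_mult (fun t => u t ^ 2 + p t ^ 2) (fun t => exp (- C * (t - s)))).
      + apply (is_derive_plus (fun t => u t ^ 2) (fun t => p t ^ 2)).
        * evar_last; [apply (is_derive_pow u 2); exact D1|simpl; ring].
        * evar_last; [apply (is_derive_pow p 2); exact D2|simpl; ring].
      + auto_derive; [trivial|unfold Rminus; ring].
      + intros; apply Rmult_comm.
    - intros r _. apply continuity_pt_mult.
      + apply continuity_pt_plus.
        * apply (continuity_pt_comp u (fun x => x ^ 2)); [apply H|].
          apply derivable_continuous_pt, derivable_pt_pow.
        * apply (continuity_pt_comp p (fun x => x ^ 2)); [apply H|].
          apply derivable_continuous_pt, derivable_pt_pow.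
      + apply is_derive_continuity_pt with (- C * exp (- C * (r - s))). auto_derive; [trivial|unfold Rminus; ring].
    - intros r Hr'. destruct (Hr r ltac:(lra)) as [Hu Hp].
      pose proof (exp_pos (- C * (r - s))) as He.
      pose proof (psi_linear_bound P (p r) ltac:(lra) (proj1 (proj2 (proj2 H)) r)) as B.
      fold k in B. rewrite (Rabs_pos_eq (p r)) in B by lra. apply Rabs_le_between in B.
      pose proof (traj_abs_lt_1 a u p H r) as Hp1. apply Rabs_def2 in Hp1.
      pose proof (psi_ge (p r) ltac:(lra)) as B2.
      pose proof (dd_lin0 _ _ _ _ _ _ _ Hg (u r) ltac:(lra)) as B3.
      pose proof (dd_l _ _ _ _ _ _ _ Hg) as Hl.
      assert (Hk : 0 < k).
      { apply Rinv_0_lt_compat. destruct (sqrt_one_minus_pos P); [rewrite Rabs_pos_eq; lra|lra]. }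
      assert (A1 : u r * psi (p r) <= u r * (k * p r)) by (apply Rmult_le_compat_l; lra).
      assert (A2 : p r * (- g (u r)) <= p r * (l * u r)) by (apply Rmult_le_compat_l; lra).
      assert (A3 : 0 <= b * psi (p r) * p r) by (apply Rmult_le_pos; [apply Rmult_le_pos|]; lra).
      (* The cross term [2 * C * u * p] is absorbed by [C * (u ^ 2 + p ^ 2)]. *)
      assert (A4 : 0 <= C * (u r - p r) ^ 2) by (apply Rmult_le_pos; [unfold C; lra|apply pow2_ge_0]).
      assert (A5 : 2 * u r * psi (p r) + 2 * p r * (- b * psi (p r) - g (u r)) - C * (u r ^ 2 + p r ^ 2) <= 0).
      { unfold C in *. nra. }
      replace ((2 * u r * psi (p r) + 2 * p r * (- b * psi (p r) - g (u r))) * exp (- C * (r - s)) +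
        (u r ^ 2 + p r ^ 2) * (- C * exp (- C * (r - s)))) with
        ((2 * u r * psi (p r) + 2 * p r * (- b * psi (p r) - g (u r)) - C * (u r ^ 2 + p r ^ 2))
          * exp (- C * (r - s))) by ring.
      nra. }
  replace (- C * (s - s)) with 0 in K by ring. rewrite exp_0, Rmult_1_r in K.
  replace (- C * (t - s)) with (- (C * (t - s))) in K by ring. rewrite exp_Ropp in K.
  pose proof (exp_pos (C * (t - s))) as He.
  apply Rmult_le_reg_r with (/ exp (C * (t - s))); [now apply Rinv_0_lt_compat|].
  rewrite Rmult_assoc, Rinv_r, Rmult_1_r by lra. exact K.
Qed.

Lemma rising_start d p0 : 0 < d < al / 2 -> 0 < p0 <= P ->
  exists u p T, u 0 = d /\ p 0 = p0 /\ traj 0 u p /\ lipschitz speed_bound u /\ lipschitz speed_bound p /\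
    0 < T /\ u T = al / 2 /\ forall t, 0 <= t <= T -> d <= u t <= al / 2 /\ 0 < p t.
Proof.
  intros Hd Hp0.
  destruct (trajectory_exists d p0) as (u & p & E1 & E2 & H & Lu & Lp); [rewrite Rabs_pos_eq; lra|].
  destruct (crossing 0 u p H ltac:(lra) ltac:(lra)) as (T' & HT' & ET' & _ & Hbefore).
  destruct (first_hit u (al / 2) 0 T') as (T & HT & ET & Hs); [lra|intros; apply H|lra|].
  exists u, p, T. repeat (split; [first [assumption|lra]|]). intros t Ht.
  destruct (Hbefore t) as [B1 B2].
  { split; [lra|]. apply Rle_lt_trans with T; [lra|].
    destruct (Req_dec T T') as [Heq|]; [rewrite Heq in ET; lra|lra]. }
  split; [split|exact B2].
  - rewrite <- E1. apply (traj_increasing 0 u p); [exact H|lra|].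
    intros r Hr. left. apply Hbefore. lra.
  - destruct (Req_dec t T) as [->|]; [lra|]. left. apply Hs. lra.
Qed.

Lemma energy_le_sqr p : Rabs p < 1 -> energy p <= p ^ 2.
Proof.
  intros Hp. destruct (sqrt_one_minus_pos p Hp) as [H1 H2]. unfold energy.
  assert (sqrt (1 - p ^ 2) * sqrt (1 - p ^ 2) = 1 - p ^ 2) by (apply sqrt_sqrt; lra). nra.
Qed.

(** Each approximation is shifted by its passage time [Tn] at [al / 2]. As [Tn] tends to infinity,
    the limit solves the system on the whole line. The starting speed is left to the hypothesis, so
    that a bound [k] at the phase [al / 2] can be imposed on all approximations. Only weak
    inequalities survive the limit. *)
Lemma saddle_limit k :
  (forall d, 0 < d < al / 2 -> exists p0, 0 < p0 <= d /\ p0 <= P /\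
    forall u p T, traj 0 u p -> u 0 = d -> p 0 = p0 -> 0 < T -> u T = al / 2 ->
      (forall t, 0 <= t <= T -> d <= u t <= al / 2) -> p T <= k) ->
  exists u p, (forall a, traj a u p) /\ u 0 = al / 2 /\ p 0 <= k /\
    (forall t, t <= 0 -> 0 <= u t <= al / 2 /\ 0 <= p t) /\
    (forall t, t <= 0 -> energy (p t) + G (u t) <= 0).
Proof.
  intros Hstart.
  set (d := fun n : nat => al / 2 * / (INR n + 2)).
  assert (Hd : forall n, 0 < d n < al / 2).
  { intros n. pose proof (pos_INR n). unfold d.
    assert (0 < / (INR n + 2) < 1).
    { split; [apply Rinv_0_lt_compat; lra|]. rewrite <- Rinv_1. apply Rinv_lt_contravar; lra. }
    nra. }
  assert (Hex : forall n, exists x : (R -> R) * (R -> R) * R, let '(u, p, T) := x in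
    traj 0 u p /\ lipschitz speed_bound u /\ lipschitz speed_bound p /\
    u 0 = d n /\ 0 < p 0 <= d n /\ p T <= k /\
    0 < T /\ u T = al / 2 /\ forall t, 0 <= t <= T -> d n <= u t <= al / 2 /\ 0 < p t).
  { intros n. destruct (Hstart (d n) (Hd n)) as (p0 & Hp0 & HpP & Hk).
    destruct (rising_start (d n) p0 (Hd n) ltac:(lra))
      as (u & p & T & E1 & E2 & H & Lu & Lp & HT & ET & Hr).
    exists (u, p, T). repeat (split; [first [assumption|lra]|]).
    split; [|repeat (split; [assumption|]); exact Hr].
    apply (Hk u p T); try assumption. intros t Ht. now apply Hr. }
  set (x := fun n => proj1_sig (constructive_indefinite_description _ (Hex n))).
  set (un := fun n => fst (fst (x n))). set (pn := fun n => snd (fst (x n))).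
  set (Tn := fun n => snd (x n)).
  assert (Hx : forall n, traj 0 (un n) (pn n) /\ lipschitz speed_bound (un n) /\
    lipschitz speed_bound (pn n) /\ un n 0 = d n /\ 0 < pn n 0 <= d n /\ pn n (Tn n) <= k /\
    0 < Tn n /\ un n (Tn n) = al / 2 /\
    forall t, 0 <= t <= Tn n -> d n <= un n t <= al / 2 /\ 0 < pn n t).
  { intros n. unfold un, pn, Tn, x. destruct constructive_indefinite_description as [[[u p] T] Hn].
    exact Hn. }
  clearbody un pn Tn. clear x Hex Hstart.
  (* By [saddle_growth], reaching [al / 2] before [tau] from a start of size [d n] forces
     [(INR n + 2) ^ 2 <= 2 * exp (C * tau)]. *)
  assert (HTinf : forall tau, exists N, forall n, (N <= n)%nat -> tau < Tn n).
  { intros tau. set (C := / sqrt (1 - P ^ 2) + l).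
    destruct (nfloor_ex (2 * exp (C * tau))) as (N & HN).
    { pose proof (exp_pos (C * tau)). lra. }
    exists (S N). intros n Hn. apply Rnot_le_lt. intros Hle.
    destruct (Hx n) as (H & _ & _ & E0 & Hp0 & _ & HT & ET & Hr).
    assert (K : un n (Tn n) ^ 2 + pn n (Tn n) ^ 2 <=
      (un n 0 ^ 2 + pn n 0 ^ 2) * exp (C * (Tn n - 0))).
    { apply (saddle_growth 0); [exact H|lra|]. intros r Hr'. destruct (Hr r Hr').
      specialize (Hd n). lra. }
    rewrite ET, E0, Rminus_0_r in K.
    assert (HC : 0 < C).
    { pose proof (dd_l _ _ _ _ _ _ _ Hg). apply Rplus_lt_0_compat; [|lra].
      apply Rinv_0_lt_compat. destruct (sqrt_one_minus_pos P); [rewrite Rabs_pos_eq; lra|lra]. }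
    assert (Hexp : exp (C * Tn n) <= exp (C * tau)).
    { destruct (Req_dec (Tn n) tau) as [->|]; [lra|]. left. apply exp_increasing.
      apply Rmult_lt_compat_l; lra. }
    pose proof (exp_pos (C * Tn n)) as He.
    assert (Hp2 : pn n 0 ^ 2 <= d n ^ 2) by (apply pow_incr; lra).
    pose proof (pow2_ge_0 (pn n (Tn n))) as Hsq.
    assert (K2 : (al / 2) ^ 2 <= 2 * d n ^ 2 * exp (C * tau)).
    { apply Rle_trans with ((d n ^ 2 + pn n 0 ^ 2) * exp (C * Tn n)); [lra|].
      apply Rmult_le_compat; [nra|lra|lra|exact Hexp]. }
    apply le_INR in Hn. rewrite S_INR in Hn.
    assert (Hn2 : d n ^ 2 * (INR n + 2) ^ 2 = (al / 2) ^ 2).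
    { unfold d. field. pose proof (pos_INR n). lra. }
    assert (Hdn : 0 < d n ^ 2) by (apply pow_lt, Hd).
    rewrite <- Hn2 in K2.
    assert ((INR n + 2) ^ 2 <= 2 * exp (C * tau)) by nra.
    pose proof (pos_INR n). nra. }
  destruct (lipschitz_compactness (fun n t => un n (t + Tn n)) (fun n t => pn n (t + Tn n))
    speed_bound 1) as (e & u & p & He & Hu & Hp).
  { intros n s t. destruct (Hx n) as (_ & L & _).
    replace (s - t) with ((s + Tn n) - (t + Tn n)) by ring. apply L. }
  { intros n s t. destruct (Hx n) as (_ & _ & L & _).
    replace (s - t) with ((s + Tn n) - (t + Tn n)) by ring. apply L. }
  { intros n. rewrite Rplus_0_l. destruct (Hx n) as (_ & _ & _ & _ & _ & _ & _ & -> & _).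
    rewrite Rabs_pos_eq; lra. }
  { intros n. destruct (Hx n) as ((_ & _ & B & _) & _). specialize (B (0 + Tn n)). lra. }
  assert (Lu : forall n, lipschitz speed_bound (fun t => un (e n) (t + Tn (e n)))).
  { intros n s t. destruct (Hx (e n)) as (_ & L & _).
    replace (s - t) with ((s + Tn (e n)) - (t + Tn (e n))) by ring. apply L. }
  assert (Lp : forall n, lipschitz speed_bound (fun t => pn (e n) (t + Tn (e n)))).
  { intros n s t. destruct (Hx (e n)) as (_ & _ & L & _).
    replace (s - t) with ((s + Tn (e n)) - (t + Tn (e n))) by ring. apply L. }
  assert (HpP : forall t, Rabs (p t) <= P).
  { intros t. apply (is_lim_seq_le (fun n => Rabs (pn (e n) (t + Tn (e n)))) (fun _ => P)
      (Rabs (p t)) P).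
    - intros n. apply (Hx (e n)).
    - now apply is_lim_seq_abs with (l := Finite (p t)).
    - apply is_lim_seq_const. }
  assert (HTe : forall tau, exists N, forall n, (N <= n)%nat -> tau < Tn (e n)).
  { intros tau. destruct (HTinf tau) as (N & HN). exists N. intros n Hn. apply HN.
    specialize (He n). lia. }
  (* The starting energy is at most [d ^ 2], since [energy p <= p ^ 2], [p <= d] and [G <= 0] there;
     it tends to 0 along the approximations. *)
  assert (Hlow : forall t, t <= 0 -> exists N, forall n, (N <= n)%nat ->
    d (e n) <= un (e n) (t + Tn (e n)) <= al / 2 /\ 0 < pn (e n) (t + Tn (e n)) /\
    energy (pn (e n) (t + Tn (e n))) + G (un (e n) (t + Tn (e n))) <= d (e n) ^ 2).
  { intros t Ht. destruct (HTe (- t)) as (N & HN). exists N. intros n Hn.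
    specialize (HN n Hn).
    destruct (Hx (e n)) as (H & _ & _ & E0 & Hp0 & _ & HT & ET & Hr).
    destruct (Hr (t + Tn (e n)) ltac:(lra)) as [R1 R2].
    split; [exact R1|]. split; [exact R2|].
    apply Rle_trans with (1 := total_energy_noninc 0 _ _ 0 (t + Tn (e n)) H ltac:(lra)).
    pose proof (energy_le_sqr _ (traj_abs_lt_1 0 _ _ H 0)) as K1.
    assert (K2 : pn (e n) 0 ^ 2 <= d (e n) ^ 2) by (apply pow_incr; lra).
    pose proof (potential_decr 0 (un (e n) 0)) as K3. rewrite potential_0, E0 in K3.
    specialize (Hd (e n)). rewrite E0. specialize (K3 ltac:(lra)). lra. }
  assert (Hder : forall (F : R -> R -> R) (z : nat -> R -> R) (w : R -> R) t,
    continuous2_at F (u t) (p t) ->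
    (forall s, is_lim_seq (fun n => z (e n) (s + Tn (e n))) (w s)) ->
    (forall n s, 0 < s -> is_derive (z n) s (F (un n s) (pn n s))) ->
    is_derive w t (F (u t) (p t))).
  { intros F z w t HF Hz Hzd.
    (* The unit margin keeps a whole window around [t] at positive unshifted times, where the
       approximations solve the system. *)
    destruct (HTe (- t + 1)) as (N & HN).
    apply (limit_is_derive (fun n s => z (e n) (s + Tn (e n)))
      (fun n s => F (un (e n) (s + Tn (e n))) (pn (e n) (s + Tn (e n)))) w t _ 1 N Hz Rlt_0_1).
    - intros n s Hn Hs. specialize (HN n Hn). apply Rabs_def2 in Hs.
      specialize (Hzd (e n) (s + Tn (e n)) ltac:(lra)).
      set (y := F _ _) in *. rewrite <- (Rmult_1_l y).
      apply (is_derive_comp (z (e n)) (fun s => s + Tn (e n))); [exact Hzd|].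
      auto_derive; [trivial|ring].
    - apply (equicontinuous_field F (fun n t => un (e n) (t + Tn (e n)))
        (fun n t => pn (e n) (t + Tn (e n))) (u t) (p t) speed_bound t Lu Lp (Hu t) (Hp t) HF). }
  assert (Cu : forall t, continuity_pt u t).
  { apply (lipschitz_continuity_pt speed_bound).
    now apply (lipschitz_lim (fun n t => un (e n) (t + Tn (e n)))). }
  assert (Cp : forall t, continuity_pt p t).
  { apply (lipschitz_continuity_pt speed_bound).
    now apply (lipschitz_lim (fun n t => pn (e n) (t + Tn (e n)))). }
  assert (Cpsi : forall t, continuity_pt psi (p t)).
  { intros t. apply psi_continuity_pt. specialize (HpP t). lra. }
  exists u, p. split; [|split; [|split; [|split]]].
  - intros a. split; [exact Cu|]. split; [exact Cp|]. split; [exact HpP|]. intros t _. split.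
    + apply (Hder (fun _ p => psi p) un); [apply (continuous2_snd psi), Cpsi|exact Hu|].
      intros n s Hs. now apply (Hx n).
    + apply (Hder (fun u p => - b * psi p - g u) pn); [|exact Hp|].
      * apply continuous2_plus.
        -- apply (continuous2_snd (fun p => - b * psi p)). now apply continuity_pt_scal.
        -- apply (continuous2_fst (fun u => - g u)). now apply continuity_pt_opp.
      * intros n s Hs. now apply (Hx n).
  - specialize (Hu 0). apply is_lim_seq_ext with (v := fun _ => al / 2) in Hu.
    + apply is_lim_seq_unique in Hu. rewrite Lim_seq_const in Hu. congruence.
    + intros n. rewrite Rplus_0_l. apply (Hx (e n)).
  - apply (is_lim_seq_le (fun n => pn (e n) (0 + Tn (e n))) (fun _ => k) (p 0) k).
    + intros n. rewrite Rplus_0_l. apply (Hx (e n)).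
    + apply Hp.
    + apply is_lim_seq_const.
  - intros t Ht. destruct (Hlow t Ht) as (N & HN).
    split; [split|].
    + apply (is_lim_seq_le_loc (fun _ => 0) (fun n => un (e n) (t + Tn (e n))) 0 (u t));
        [|apply is_lim_seq_const|apply Hu].
      exists N. intros n Hn. destruct (HN n Hn) as [K _]. specialize (Hd (e n)). lra.
    + apply (is_lim_seq_le_loc (fun n => un (e n) (t + Tn (e n))) (fun _ => al / 2) (u t) (al / 2));
        [|apply Hu|apply is_lim_seq_const].
      exists N. intros n Hn. destruct (HN n Hn) as [K _]. lra.
    + apply (is_lim_seq_le_loc (fun _ => 0) (fun n => pn (e n) (t + Tn (e n))) 0 (p t));
        [|apply is_lim_seq_const|apply Hp].
      exists N. intros n Hn. destruct (HN n Hn) as [_ [K _]]. lra.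
  - intros t Ht. destruct (Hlow t Ht) as (N & HN).
    apply (is_lim_seq_le_loc (fun n => energy (pn (e n) (t + Tn (e n))) + G (un (e n) (t + Tn (e n))))
      (fun n => al / 2 * / (INR n + 2)) (energy (p t) + G (u t)) 0).
    + exists N. intros n Hn. destruct (HN n Hn) as [_ [_ K]].
      apply Rle_trans with (1 := K).
      assert (Hde : d (e n) <= al / 2 * / (INR n + 2)).
      { unfold d. apply Rmult_le_compat_l; [lra|]. apply Rinv_le_contravar.
        - pose proof (pos_INR n). lra.
        - pose proof (le_INR _ _ (He n)). lra. }
      specialize (Hd (e n)). nra.
    + apply is_lim_seq_plus'.
      * apply (is_lim_seq_continuous energy); [|apply Hp].
        eapply is_derive_continuity_pt, energy_derive. specialize (HpP t). lra.
      * apply (is_lim_seq_continuous G); [apply potential_continuity_pt|apply Hu].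
    + apply is_lim_seq_spec. intros [r Hr]. simpl.
      destruct (nfloor_ex (/ r)) as (N' & HN').
      { left. now apply Rinv_0_lt_compat. }
      exists N'. intros n Hn. apply le_INR in Hn. rewrite Rminus_0_r.
      assert (0 < / (INR n + 2)) by (apply Rinv_0_lt_compat; pose proof (pos_INR n); lra).
      rewrite Rabs_pos_eq by nra.
      assert (/ (INR n + 2) < r); [|nra].
      rewrite <- (Rinv_inv r). apply Rinv_lt_contravar; [|lra].
      apply Rmult_lt_0_compat; [now apply Rinv_0_lt_compat|pose proof (pos_INR n); lra].
Qed.

(** Strictness is recovered afterwards. If [u t = 0], nonpositive energy forces [p t = 0], and
    [saddle_growth] would give [u 0 = 0]. If [p t = 0], then [p' = - g u > 0] would make [p]
    negative just before [t]. *)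
Lemma unstable_trajectory k :
  (forall d, 0 < d < al / 2 -> exists p0, 0 < p0 <= d /\ p0 <= P /\
    forall u p T, traj 0 u p -> u 0 = d -> p 0 = p0 -> 0 < T -> u T = al / 2 ->
      (forall t, 0 <= t <= T -> d <= u t <= al / 2) -> p T <= k) ->
  exists u p, (forall a, traj a u p) /\ u 0 = al / 2 /\ p 0 <= k /\
    (forall t, t <= 0 -> 0 < u t <= al / 2 /\ 0 < p t) /\
    is_lim u m_infty 0 /\ energy (p 0) + G (u 0) < 0.
Proof.
  intros Hstart. destruct (saddle_limit k Hstart) as (u & p & H & E0 & Hk & Hr & HV).
  assert (Hmono : forall s t, s <= t <= 0 -> u s <= u t).
  { intros s t Hst. apply (traj_increasing s u p); [apply H|lra|]. intros r Hr'. apply Hr. lra. }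
  assert (Hu : forall t, t <= 0 -> 0 < u t).
  { intros t Ht. apply Rnot_le_lt. intros Hle.
    assert (Eu : u t = 0) by (destruct (Hr t Ht); lra).
    assert (Ep : p t = 0).
    { specialize (HV t Ht). rewrite Eu, potential_0 in HV.
      pose proof (energy_nonneg (p t)). unfold energy in *.
      pose proof (traj_abs_lt_1 0 u p (H 0) t) as Hp1.
      destruct (sqrt_one_minus_pos (p t) Hp1) as [_ Q2].
      assert (Es : sqrt (1 - p t ^ 2) = 1) by lra.
      pose proof (sqrt_sqrt (1 - p t ^ 2) ltac:(lra)) as Q3. rewrite Es in Q3. nra. }
    pose proof (saddle_growth t u p t 0 (H t) ltac:(lra)) as K. rewrite Eu, Ep, E0 in K.
    specialize (K ltac:(intros r Hr'; destruct (Hr r ltac:(lra)); lra)). nra. }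
  assert (Hp : forall t, t <= 0 -> 0 < p t).
  { intros t Ht. apply Rnot_le_lt. intros Hle.
    assert (Ep : p t = 0) by (destruct (Hr t Ht); lra).
    destruct (proj2 (proj2 (proj2 (H (t - 1)))) t ltac:(lra)) as [_ D].
    rewrite Ep, psi_0, Rmult_0_r, Rminus_0_l in D.
    assert (Hgt : 0 < - g (u t)).
    { specialize (Hu t Ht). destruct (Hr t Ht). specialize (g_neg (u t) ltac:(lra)). lra. }
    apply is_derive_Reals in D. destruct (D (- g (u t)) Hgt) as ([r Hr0] & Hx).
    specialize (Hx (- (r / 2)) ltac:(lra)). simpl in Hx.
    rewrite Rabs_left in Hx by lra. specialize (Hx ltac:(lra)). rewrite Ep, Rminus_0_r in Hx.
    destruct (Hr (t + - (r / 2)) ltac:(lra)) as [_ Hq].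
    assert (E : p (t + - (r / 2)) / - (r / 2) = - (p (t + - (r / 2)) * / (r / 2))).
    { field. lra. }
    rewrite E in Hx. assert (0 < / (r / 2)) by (apply Rinv_0_lt_compat; lra).
    apply Rabs_def2 in Hx. nra. }
  exists u, p. split; [exact H|]. split; [exact E0|]. split; [exact Hk|].
  split; [|split].
  - intros t Ht. specialize (Hu t Ht). specialize (Hp t Ht). destruct (Hr t Ht). lra.
  - apply is_lim_spec. intros [r Hr0]. simpl.
    assert (Hex : exists t, t <= 0 /\ u t < r).
    { apply NNPP. intros Hn.
      assert (Hall : forall t, t <= 0 -> r <= u t).
      { intros t Ht. apply Rnot_lt_le. intros Hc. apply Hn. now exists t. }
      destruct (g_uniform_neg r (al / 2)) as (c & Hc & Hcg);
        [rewrite <- E0; split; [lra|apply Hall; lra]|lra|].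
      (* If [u] never fell below [r], the momentum would have gained [P + b] over this time, more
         than its range allows. *)
      set (T := (P + b) / c).
      assert (HT : 0 < T) by (apply Rdiv_lt_0_compat; lra).
      assert (K : c * (0 - - T) <= (p 0 + b * u 0) - (p (- T) + b * u (- T))).
      { apply (derive_ge_slope (fun t => p t + b * u t) (fun t => - g (u t))); [lra| | |].
        - intros t Ht. apply (momentum_derive (- T)); [apply H|lra].
        - intros t Ht. apply (momentum_continuity_pt (- T)). apply H.
        - intros t Ht. specialize (Hall t ltac:(lra)). destruct (Hr t ltac:(lra)) as [B _].
          specialize (Hcg (u t) ltac:(lra)). lra. }
      assert (E : c * (0 - - T) = P + b) by (unfold T; field; lra).
      rewrite E, E0 in K.
      specialize (Hp (- T) ltac:(lra)). specialize (Hu (- T) ltac:(lra)).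
      pose proof (proj1 (proj2 (proj2 (H 0))) 0) as HpP. apply Rabs_le_between in HpP. nra. }
    destruct Hex as (t & Ht & Hut). exists t. intros s Hs. rewrite Rminus_0_r.
    specialize (Hmono s t ltac:(lra)). specialize (Hu s ltac:(lra)).
    rewrite Rabs_pos_eq; lra.
  (* The energy is nonpositive at time -1, and damping with [p > 0] lowers it strictly until time
     0. *)
  - apply Rlt_le_trans with (energy (p (- (1))) + G (u (- (1)))); [|apply HV; lra].
    apply Rminus_lt.
    destruct (mvt_open (fun t => energy (p t) + G (u t)) (fun t => - b * psi (p t) ^ 2) (- (1)) 0)
      as (c & Hc & E); [lra| | |].
    + intros t Ht. apply (total_energy_derive (- (1))); [apply H|lra].
    + intros t Ht. apply (total_energy_continuity_pt 0 u p t (H 0)).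
    + rewrite E. specialize (Hp c ltac:(lra)).
      pose proof (traj_abs_lt_1 0 u p (H 0) c) as Hp1. apply Rabs_def2 in Hp1.
      pose proof (psi_ge (p c) ltac:(lra)).
      assert (0 < psi (p c) ^ 2) by (apply pow_lt; lra). nra.
Qed.

(** With a barrier, the approximations start below it, [barrier_invariant] carries this to the phase
    [al / 2], and [k = Q (al / 2)]. In the other cases [k = P] is no constraint. *)
Lemma connection :
  0 < G 1 \/ 1 <= G 1 - G al \/ (exists Q b0, barrier Q b0) ->
  exists u p, (forall a, traj a u p) /\ (forall t, 0 < u t < 1) /\
    is_lim u m_infty 0 /\ is_lim u p_infty al /\
    (forall s t, s < t -> t <= 0 -> u s < u t) /\
    u 0 < al /\ exists t, al < u t.
Proof.
  intros Hesc.
  assert (Hk : exists k, escape_condition k /\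
    forall d, 0 < d < al / 2 -> exists p0, 0 < p0 <= d /\ p0 <= P /\
    forall u p T, traj 0 u p -> u 0 = d -> p 0 = p0 -> 0 < T -> u T = al / 2 ->
      (forall t, 0 <= t <= T -> d <= u t <= al / 2) -> p T <= k).
  { assert (Hgen : escape_condition P -> exists k, escape_condition k /\
      forall d, 0 < d < al / 2 -> exists p0, 0 < p0 <= d /\ p0 <= P /\
      forall u p T, traj 0 u p -> u 0 = d -> p 0 = p0 -> 0 < T -> u T = al / 2 ->
        (forall t, 0 <= t <= T -> d <= u t <= al / 2) -> p T <= k).
    { intros HP'. exists P. split; [exact HP'|]. intros d Hd. exists (Rmin d P).
      split; [split; [apply Rmin_glb_lt; lra|apply Rmin_l]|]. split; [apply Rmin_r|].
      intros u p T H _ _ _ _ _. pose proof (proj1 (proj2 (proj2 H)) T) as B.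
      apply Rabs_le_between in B. lra. }
    destruct Hesc as [H1|[H1|(Q & b0 & HQ)]].
    - apply Hgen. now left.
    - apply Hgen. right. now left.
    - exists (Q (al / 2)). split.
      { right. right. exists Q, b0. split; [exact HQ|lra]. }
      intros d Hd. destruct (proj1 (proj2 HQ) d ltac:(lra)) as [HQd _].
      (* [d] keeps the start close to the saddle, [P] in the strip, and [Q d] below the barrier. *)
      exists (Rmin d (Rmin P (Q d))).
      assert (Hmin : Rmin P (Q d) <= P /\ Rmin P (Q d) <= Q d) by (split; [apply Rmin_l|apply Rmin_r]).
      pose proof (Rmin_r d (Rmin P (Q d))) as Hmin2.
      split; [split; [repeat apply Rmin_glb_lt; lra|apply Rmin_l]|]. split; [lra|].
      intros u p T H E0 Ep HT ET Hr. rewrite <- ET.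
      apply (barrier_invariant Q b0 0); [exact HQ|exact H|lra| |rewrite E0; lra].
      intros r Hr'. specialize (Hr r Hr'). lra. }
  destruct Hk as (k & Hesck & Hstart).
  destruct (unstable_trajectory k Hstart) as (u & p & H & E0 & Hpk & Hneg & Hlim0 & HV0).
  exists u, p. split; [exact H|].
  assert (Hp0 : 0 < p 0) by (apply Hneg; lra).
  destruct (escape k 0 u p (H 0) E0 Hp0 Hpk HV0 Hesck) as (T & HT & HVT & Hlt).
  assert (HVneg : forall t, 0 <= t -> energy (p t) + G (u t) < 0).
  { intros t Ht. pose proof (total_energy_noninc 0 u p 0 t (H 0) ltac:(lra)). lra. }
  split; [|split; [exact Hlim0|split; [|split; [|split]]]].
  - intros t. destruct (Rle_dec t 0) as [h|h]; [destruct (Hneg t h); lra|]. split.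
    + apply potential_neg_pos. specialize (HVneg t ltac:(lra)).
      pose proof (energy_nonneg (p t)). lra.
    + destruct (Rle_dec t T) as [h'|h']; [apply Hlt; lra|].
      apply potential_below_end. pose proof (energy_nonneg (p t)).
      pose proof (total_energy_noninc T u p T t (H T) ltac:(lra)). lra.
  - apply (converges T u p (H T)); [apply HVneg; lra|exact HVT].
  - intros s t Hst Ht. apply (traj_increasing_strict s u p); [apply H|lra|].
    intros r Hr. apply Hneg. lra.
  - lra.
  - destruct (crossing 0 u p (H 0) ltac:(lra) Hp0) as (T' & HT' & ET' & HpT' & _).
    destruct (continuity_pt_eps p T' (proj1 (proj2 (H 0)) T') (p T') HpT') as (d & Hd & Hx).
    exists (T' + d / 2). rewrite <- ET'.
    apply (traj_increasing_strict 0 u p); [apply H|lra|]. intros r Hr.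
    specialize (Hx r). rewrite Rabs_pos_eq in Hx by lra. specialize (Hx ltac:(lra)).
    apply Rabs_def2 in Hx. lra.
Qed.

(** * The phase curve of an increasing front *)

Section Front.

Variables (b0 : R) (U Pi : R -> R).
Hypothesis Hb0 : 0 <= b0 < b.
Hypothesis Pi_lt_1 : forall t, Rabs (Pi t) < 1.
Hypothesis U_derive : forall t, is_derive U t (psi (Pi t)).
Hypothesis Pi_derive : forall t, is_derive Pi t (- b0 * psi (Pi t) - g (U t)).
Hypothesis U_incr : strict_increasing U.
Hypothesis U_minfty : is_lim U m_infty 0.
Hypothesis U_pinfty : is_lim U p_infty 1.

Lemma front_range t : 0 < U t < 1.
Proof.
  split; apply Rnot_le_lt; intros Hle.
  - pose proof (U_incr (t - 1) t ltac:(lra)) as H1.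
    apply is_lim_spec in U_minfty.
    assert (He : 0 < - U (t - 1)) by lra.
    destruct (U_minfty (mkposreal _ He)) as (N & HN). simpl in HN.
    set (s := Rmin (N - 1) (t - 2)).
    pose proof (Rmin_l (N - 1) (t - 2)) as M1. pose proof (Rmin_r (N - 1) (t - 2)) as M2.
    fold s in M1, M2. specialize (HN s ltac:(lra)).
    pose proof (U_incr s (t - 1) ltac:(lra)) as H2. apply Rabs_def2 in HN. lra.
  - pose proof (U_incr t (t + 1) ltac:(lra)) as H1.
    apply is_lim_spec in U_pinfty.
    assert (He : 0 < U (t + 1) - 1) by lra.
    destruct (U_pinfty (mkposreal _ He)) as (N & HN). simpl in HN.
    set (s := Rmax (N + 1) (t + 2)).
    pose proof (Rmax_l (N + 1) (t + 2)) as M1. pose proof (Rmax_r (N + 1) (t + 2)) as M2.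
    fold s in M1, M2. specialize (HN s ltac:(lra)).
    pose proof (U_incr (t + 1) s ltac:(lra)) as H2. apply Rabs_def2 in HN. lra.
Qed.

Lemma front_speed_nonneg t : 0 <= Pi t.
Proof.
  apply Rnot_lt_le. intros Hlt.
  assert (pr : derivable U).
  { intros x. exists (psi (Pi x)). apply is_derive_Reals, U_derive. }
  assert (Hinc : increasing U).
  { intros x y Hxy. destruct (Req_dec x y) as [->|]; [lra|]. left. apply U_incr. lra. }
  pose proof (nonneg_derivative_0 U pr Hinc t) as K.
  rewrite (derive_pt_eq_0 U t (psi (Pi t)) (pr t)) in K by apply is_derive_Reals, U_derive.
  pose proof (Pi_lt_1 t) as Hp. apply Rabs_def2 in Hp.
  pose proof (psi_ge (- Pi t) ltac:(lra)) as K2. rewrite psi_opp in K2. lra.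
Qed.

Lemma front_energy s t : s <= t -> energy (Pi t) + G (U t) <= energy (Pi s) + G (U s).
Proof.
  assert (D : forall r, is_derive (fun t => energy (Pi t) + G (U t)) r (- b0 * psi (Pi r) ^ 2)).
  { intros r. replace (- b0 * psi (Pi r) ^ 2) with
      ((- b0 * psi (Pi r) - g (U r)) * psi (Pi r) + psi (Pi r) * g (U r)) by ring.
    apply (is_derive_plus (fun t => energy (Pi t)) (fun t => G (U t))).
    - apply (is_derive_comp energy Pi); [apply energy_derive, Pi_lt_1|apply Pi_derive].
    - apply (is_derive_comp G U); [apply potential_derive|apply U_derive]. }
  intros Hst. apply Rminus_le. rewrite <- (Rmult_0_l (t - s)).
  apply (derive_le_slope (fun t => energy (Pi t) + G (U t)) (fun t => - b0 * psi (Pi t) ^ 2)); [lra| | |].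
  - intros; apply D.
  - intros r _. eapply is_derive_continuity_pt, D.
  - intros r _. pose proof (pow2_ge_0 (psi (Pi r))). nra.
Qed.

(** A zero of [Pi] is a minimum, so [Pi' = 0] there, whence [g (U t) = 0] and [U t = al]. The energy
    then equals [G al], the minimum of [G], and could not allow [U] to increase further. *)
Lemma front_speed_pos t : 0 < Pi t.
Proof.
  apply Rnot_le_lt. intros Hle. pose proof (front_speed_nonneg t).
  assert (E : Pi t = 0) by lra.
  assert (pr : derivable_pt Pi t).
  { exists (- b0 * psi (Pi t) - g (U t)). apply is_derive_Reals, Pi_derive. }
  pose proof (deriv_minimum Pi (t - 1) (t + 1) t pr ltac:(lra) ltac:(lra)) as K.
  rewrite (derive_pt_eq_0 Pi t (- b0 * psi (Pi t) - g (U t)) pr) in K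
    by apply is_derive_Reals, Pi_derive.
  rewrite E, psi_0 in K.
  specialize (K ltac:(intros; rewrite E in *; apply front_speed_nonneg)).
  assert (EU : U t = al).
  { pose proof (front_range t). destruct (Rtotal_order (U t) al) as [h|[h|h]]; [|exact h|].
    - specialize (g_neg (U t) ltac:(lra)). lra.
    - specialize (g_pos (U t) ltac:(lra)). lra. }
  pose proof (front_energy t (t + 1) ltac:(lra)) as V. rewrite E, EU, energy_0 in V.
  pose proof (U_incr t (t + 1) ltac:(lra)) as HU. pose proof (front_range (t + 1)).
  pose proof (potential_incr_strict al (U (t + 1)) ltac:(lra) ltac:(lra)).
  pose proof (energy_nonneg (Pi (t + 1))). lra.
Qed.

Lemma front_inverse : exists th : R -> R,
  (forall t, th (U t) = t) /\ (forall s, 0 < s < 1 -> U (th s) = s).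
Proof.
  (* The condition on [s] sits under the existential, so that choice yields a total function,
     arbitrary outside (0, 1). *)
  assert (Hex : forall s, exists t, 0 < s < 1 -> U t = s).
  { intros s. destruct (classic (0 < s < 1)) as [Hs|Hs]; [|exists 0; tauto].
    pose proof U_minfty as L0. apply is_lim_spec in L0.
    pose proof U_pinfty as L1. apply is_lim_spec in L1.
    destruct (L0 (mkposreal s (proj1 Hs))) as (N0 & H0).
    assert (Hs1 : 0 < 1 - s) by lra.
    destruct (L1 (mkposreal _ Hs1)) as (N1 & H1). simpl in H0, H1.
    set (t0 := Rmin (N0 - 1) (N1 + 1)).
    assert (T0 : t0 < N0) by (pose proof (Rmin_l (N0 - 1) (N1 + 1)); unfold t0; lra).
    assert (T1 : t0 <= N1 + 1) by apply Rmin_r.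
    specialize (H0 t0 T0). specialize (H1 (N1 + 1) ltac:(lra)).
    apply Rabs_def2 in H0, H1.
    destruct (first_hit U s t0 (N1 + 1)) as (T & _ & ET & _); [exact T1| |lra|].
    - intros t _. eapply is_derive_continuity_pt, U_derive.
    - now exists T. }
  exists (fun s => proj1_sig (constructive_indefinite_description _ (Hex s))).
  assert (Hth : forall s, 0 < s < 1 ->
    U (proj1_sig (constructive_indefinite_description _ (Hex s))) = s).
  { intros s. now destruct constructive_indefinite_description. }
  split; [|exact Hth]. intros t. specialize (Hth (U t) (front_range t)).
  set (r := proj1_sig _) in *. destruct (Rtotal_order r t) as [h|[h|h]]; [|exact h|].
  - pose proof (U_incr r t h). lra.
  - pose proof (U_incr t r h). lra.
Qed.

(** By the mean value theorem the quotient of the inverse is [/ psi (Pi c)] with [c] between the two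
    preimages; strict monotonicity of [U] confines [c] to a small interval around [t]. *)
Lemma front_inverse_derive th :
  (forall t, th (U t) = t) -> (forall s, 0 < s < 1 -> U (th s) = s) ->
  forall s, 0 < s < 1 -> is_derive th s (/ psi (Pi (th s))).
Proof.
  intros H1 H2 s Hs. set (t := th s).
  assert (Hpsi : forall r, 0 < psi (Pi r)).
  { intros r. pose proof (front_speed_pos r). pose proof (Pi_lt_1 r) as B. apply Rabs_def2 in B.
    pose proof (psi_ge (Pi r) ltac:(lra)). lra. }
  assert (Hmono : forall x y, U x < U y -> x < y).
  { intros x y Hxy. apply Rnot_le_lt. intros Hle.
    destruct (Req_dec x y) as [->|]; [lra|]. pose proof (U_incr y x ltac:(lra)). lra. }
  assert (C : continuity_pt (fun r => / psi (Pi r)) t).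
  { apply continuity_pt_inv; [|specialize (Hpsi t); lra].
    apply (continuity_pt_comp Pi psi); [eapply is_derive_continuity_pt, Pi_derive|].
    apply psi_continuity_pt, Pi_lt_1. }
  apply is_derive_Reals. intros e He.
  destruct (continuity_pt_eps _ t C e He) as (d & Hd & Hx).
  assert (EU : U t = s) by now apply H2.
  pose proof (U_incr (t - d) t ltac:(lra)) as K1. pose proof (U_incr t (t + d) ltac:(lra)) as K2.
  set (r := Rmin (U (t + d) - s) (s - U (t - d))).
  assert (Hr : 0 < r) by (apply Rmin_glb_lt; lra).
  pose proof (Rmin_l (U (t + d) - s) (s - U (t - d))) as R1.
  pose proof (Rmin_r (U (t + d) - s) (s - U (t - d))) as R2. fold r in R1, R2.
  exists (mkposreal r Hr). intros h Hh0 Hh. simpl in Hh. apply Rabs_def2 in Hh.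
  pose proof (front_range (t + d)). pose proof (front_range (t - d)).
  assert (EUh : U (th (s + h)) = s + h) by (apply H2; lra).
  assert (B1 : th (s + h) < t + d) by (apply Hmono; lra).
  assert (B2 : t - d < th (s + h)) by (apply Hmono; lra).
  set (y := th (s + h)) in *.
  destruct (MVT_gen U t y (fun r => psi (Pi r))) as (c & Hc & E).
  { intros; apply U_derive. }
  { intros x _. eapply is_derive_continuity_pt, U_derive. }
  rewrite EUh, EU in E. replace (s + h - s) with h in E by ring.
  assert (Hcd : Rabs (c - t) < d).
  { revert Hc. unfold Rmin, Rmax. destruct Rle_dec; intros; apply Rabs_def1; lra. }
  specialize (Hx c Hcd). specialize (Hpsi c).
  assert (Hyt : y - t <> 0).
  { intros Hc0. rewrite Hc0 in E. lra. }
  fold t. replace ((y - t) / h) with (/ psi (Pi c)); [exact Hx|].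
  rewrite E. field. lra.
Qed.

Lemma front_barrier : exists Q, barrier Q b0.
Proof.
  destruct front_inverse as (th & H1 & H2). exists (fun s => Pi (th s)).
  split; [exact Hb0|]. split.
  - intros s Hs. pose proof (front_speed_pos (th s)) as Hpos.
    pose proof (Pi_lt_1 (th s)) as B. apply Rabs_def2 in B.
    pose proof (psi_ge (Pi (th s)) ltac:(lra)).
    split; [lra|].
    replace (- b0 - g s / psi (Pi (th s))) with
      (/ psi (Pi (th s)) * (- b0 * psi (Pi (th s)) - g (U (th s))))
      by (rewrite (H2 s Hs); field; lra).
    apply (is_derive_comp Pi th); [apply Pi_derive|]. now apply front_inverse_derive.
  - intros c s0 Hc Hs0.
    pose proof U_pinfty as L. apply is_lim_spec in L.
    assert (Hm : 0 < Rmin c (1 - s0)) by (apply Rmin_glb_lt; lra).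
    destruct (L (mkposreal _ Hm)) as (N & HN). simpl in HN.
    pose proof (Rmin_l c (1 - s0)). pose proof (Rmin_r c (1 - s0)).
    (* Far to the right [U] increases by less than [c] over a unit interval, so [psi (Pi x) < c] at
       some point [x] of it. *)
    destruct (mvt_open U (fun t => psi (Pi t)) (N + 1) (N + 2)) as (x & Hx & E); [lra| | |].
    + intros; apply U_derive.
    + intros t _. eapply is_derive_continuity_pt, U_derive.
    + pose proof (front_range (N + 2)). pose proof (front_range x).
      pose proof (HN (N + 1) ltac:(lra)) as A1. pose proof (HN x ltac:(lra)) as A2.
      apply Rabs_def2 in A1, A2.
      exists (U x). rewrite H1. split; [lra|].
      pose proof (front_speed_pos x). pose proof (Pi_lt_1 x) as B. apply Rabs_def2 in B.
      pose proof (psi_ge (Pi x) ltac:(lra)). lra.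
Qed.

End Front.

End Damped.

(** * Back to the second-order equation *)

(** The inverse of [psi], from the line onto (-1, 1): it turns a slope [v'] into the variable
    [p]. *)
Definition phi (w : R) : R := w / sqrt (1 + w ^ 2).

Lemma sqrt_one_plus_pos w : 0 < sqrt (1 + w ^ 2).
Proof. apply sqrt_lt_R0. pose proof (pow2_ge_0 w). lra. Qed.

Lemma phi_sqr w : 1 - phi w ^ 2 = / (1 + w ^ 2).
Proof.
  unfold phi. pose proof (sqrt_one_plus_pos w). pose proof (pow2_ge_0 w).
  unfold Rdiv. rewrite Rpow_mult_distr, pow_inv, pow2_sqrt by lra. field. lra.
Qed.

Lemma phi_lt_1 w : Rabs (phi w) < 1.
Proof.
  pose proof (phi_sqr w) as E. pose proof (pow2_ge_0 w).
  assert (0 < / (1 + w ^ 2)) by (apply Rinv_0_lt_compat; lra).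
  rewrite <- Rabs_R1. apply Rsqr_lt_abs_0. unfold Rsqr. lra.
Qed.

Lemma psi_phi w : psi (phi w) = w.
Proof.
  unfold psi. rewrite phi_sqr. rewrite sqrt_inv. pose proof (sqrt_one_plus_pos w).
  unfold phi. field. lra.
Qed.

Lemma phi_psi p : Rabs p < 1 -> phi (psi p) = p.
Proof.
  intros Hp. destruct (sqrt_one_minus_pos p Hp) as [H1 H2]. unfold phi.
  assert (E : 1 + psi p ^ 2 = / (1 - p ^ 2)).
  { unfold psi, Rdiv. rewrite Rpow_mult_distr, pow_inv, pow2_sqrt by lra. field. lra. }
  rewrite E, sqrt_inv. unfold psi. field. lra.
Qed.

Lemma phi_ex_derive w : ex_derive phi w.
Proof.
  unfold phi. auto_derive. pose proof (sqrt_one_plus_pos w). pose proof (pow2_ge_0 w).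
  replace (1 + w * (w * 1)) with (1 + w ^ 2) by ring. repeat split; lra.
Qed.

Lemma continuous_on_clamp_continuity_pt f : continuous_on (fun s => 0 <= s <= 1) f ->
  forall s, continuity_pt (fun s => f (clamp 0 1 s)) s.
Proof.
  intros Hf s. apply continuity_pt_of_eps. intros e He.
  pose proof (clamp_in 0 1 s ltac:(lra)) as Hin.
  destruct (Hf (clamp 0 1 s) Hin (fun z => Rabs (z - f (clamp 0 1 s)) < e)) as ([d Hd] & Hx).
  { exists (mkposreal e He). intros z Hz. exact Hz. }
  exists d. split; [exact Hd|]. intros y Hy. apply Hx; [|apply clamp_in; lra].
  apply Rle_lt_trans with (2 := Hy). apply clamp_contract.
Qed.

Lemma solution_intro (f : R -> R) eps b (v Pi : R -> R) :
  continuous_on (fun s => 0 <= s <= 1) f ->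
  (forall z, 0 <= v z <= 1) -> (forall z, Rabs (Pi z) < 1) ->
  (forall z, is_derive v z (psi (Pi z))) ->
  (forall z, is_derive Pi z (b * psi (Pi z) - f (v z) / eps)) ->
  solution f eps b v.
Proof.
  intros Hf Hv HPi Dv DPi.
  assert (E1 : forall z, Derive v z = psi (Pi z)) by (intros z; apply is_derive_unique, Dv).
  set (w := fun z => (b * psi (Pi z) - f (v z) / eps) *
    / (sqrt (1 - Pi z ^ 2) * (1 - Pi z ^ 2))).
  assert (D2 : forall z, is_derive (Derive v) z (w z)).
  { intros z. apply is_derive_ext with (fun z => psi (Pi z)); [intros; now rewrite E1|].
    apply (is_derive_comp psi Pi); [apply psi_derive, HPi|apply DPi]. }
  split; [|split; [exact Hv|]].
  - split; [|split].
    + intros z. eexists. apply Dv.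
    + intros z. eexists. apply D2.
    + intros z. apply continuous_ext with w.
      { intros t. symmetry. apply is_derive_unique, D2. }
      apply continuity_pt_filterlim. unfold w.
      assert (CPi : continuity_pt Pi z) by (eapply is_derive_continuity_pt, DPi).
      assert (Csq : continuity_pt (fun z => 1 - Pi z ^ 2) z).
      { apply (continuity_pt_comp Pi (fun x => 1 - x ^ 2)); [exact CPi|].
        apply is_derive_continuity_pt with (- (2 * Pi z)). auto_derive; [trivial|ring]. }
      destruct (sqrt_one_minus_pos (Pi z) (HPi z)) as [S1 S2].
      apply continuity_pt_mult.
      * apply continuity_pt_minus.
        -- apply continuity_pt_scal. apply (continuity_pt_comp Pi psi); [exact CPi|].
           apply psi_continuity_pt, HPi.
        -- apply continuity_pt_mult; [|apply continuity_pt_const; intros ? ?; reflexivity].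
           (* [f] is continuous relative to [0, 1] only; composed with the clamp it is continuous
              everywhere, and nothing changes along [v]. *)
           apply continuity_pt_ext with (fun z => f (clamp 0 1 (v z))).
           { intros t. now rewrite clamp_id. }
           apply (continuity_pt_comp v (fun s => f (clamp 0 1 s))).
           ++ eapply is_derive_continuity_pt, Dv.
           ++ now apply continuous_on_clamp_continuity_pt.
      * apply continuity_pt_inv; [|apply Rmult_integral_contrapositive; split; lra].
        apply continuity_pt_mult; [|exact Csq].
        apply (continuity_pt_comp (fun z => 1 - Pi z ^ 2) sqrt); [exact Csq|].
        apply continuity_pt_sqrt. lra.
  - intros z. rewrite (Derive_ext _ Pi).
    + rewrite (is_derive_unique _ _ _ (DPi z)), E1. ring.
    + intros t. rewrite E1. change (psi (Pi t) / sqrt (1 + psi (Pi t) ^ 2)) with (phi (psi (Pi t))).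
      now apply phi_psi.
Qed.

Lemma is_lim_opp_arg (u : R -> R) (x l : Rbar) :
  is_lim u (Rbar_opp x) l -> is_lim (fun z => u (- z)) x l.
Proof.
  intros H. apply (is_lim_comp u Ropp x l (Rbar_opp x)); [exact H| |].
  - apply (is_lim_opp (fun z => z)), is_lim_id.
  - destruct x as [x| |]; simpl.
    + exists (mkposreal 1 Rlt_0_1). intros y _ Hne Hc. injection Hc. lra.
    + exists 0. intros y _. discriminate.
    + exists 0. intros y _. discriminate.
Qed.

(** An increasing function stays above its limit at minus infinity, a decreasing one below it. *)
Lemma nonmonotone_of_limit (v : R -> R) (a x y : R) :
  is_lim v m_infty a -> v x < a < v y -> nonmonotone v.
Proof.
  intros Hlim Hxy. apply is_lim_spec in Hlim. split; intros Hmono.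
  - assert (He : 0 < a - v x) by lra.
    destruct (Hlim (mkposreal _ He)) as (N & HN). simpl in HN.
    pose proof (Rmin_l (N - 1) x). pose proof (Rmin_r (N - 1) x).
    specialize (HN (Rmin (N - 1) x) ltac:(lra)).
    specialize (Hmono (Rmin (N - 1) x) x ltac:(lra)). apply Rabs_def2 in HN. lra.
  - assert (He : 0 < v y - a) by lra.
    destruct (Hlim (mkposreal _ He)) as (N & HN). simpl in HN.
    pose proof (Rmin_l (N - 1) y). pose proof (Rmin_r (N - 1) y).
    specialize (HN (Rmin (N - 1) y) ltac:(lra)).
    specialize (Hmono (Rmin (N - 1) y) y ltac:(lra)). apply Rabs_def2 in HN. lra.
Qed.

Lemma damped_data_intro (g : R -> R) al b m l M :
  (forall s, continuity_pt g s) -> 0 < al < 1 -> 0 < b ->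
  (forall s, s <= 0 \/ 1 <= s -> g s = 0) ->
  (forall s, 0 < s < 1 -> s <> al -> 0 < g s * (s - al)) -> g al = 0 ->
  (forall s, Rabs (g s) <= M) -> is_derive g al m -> 0 < m -> b < 2 * sqrt m -> 0 < l ->
  (forall s, 0 <= s < al -> - g s <= l * s) ->
  exists P, damped_data g al b m l M P.
Proof.
  intros Hc Hal Hb Hout Hsign Hz HM Hd Hm Hbm Hl Hlin.
  assert (HM0 : 0 <= M) by (apply Rle_trans with (2 := HM 0), Rabs_pos).
  (* With [P = phi W] this gives [b * psi P = M + 1 > M]. *)
  set (W := (M + 1) / b).
  assert (HW : 0 < W) by (apply Rdiv_lt_0_compat; lra).
  exists (phi W). constructor; try assumption.
  - intros s Hs. specialize (Hsign s ltac:(lra) ltac:(lra)). nra.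
  - intros s Hs. specialize (Hsign s ltac:(lra) ltac:(lra)). nra.
  - pose proof (sqrt_sqrt m ltac:(lra)). nra.
  - split; [apply Rdiv_lt_0_compat; [exact HW|apply sqrt_one_plus_pos]|].
    pose proof (phi_lt_1 W) as B. apply Rabs_def2 in B. lra.
  - rewrite psi_phi. replace (b * W) with (M + 1) by (unfold W; field; lra). lra.
Qed.

(** * The two reductions to the damped system *)

Section Bistable.

Variables (f : R -> R) (alpha eps b : R).
Hypothesis Hf : bistable f alpha.
Hypothesis Heps : 0 < eps.
Hypothesis Hb : 0 < b < b_plus f alpha eps.

Let Hal := bistable_alpha _ _ Hf.

Lemma bistable_bound s : 0 <= s <= 1 -> Rabs (f s) <= Derive f alpha.
Proof.
  intros Hs. apply Rle_trans with (1 := bistable_lin_alpha _ _ Hf s Hs).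
  pose proof (bistable_derive_pos _ _ Hf).
  assert (Rabs (s - alpha) <= 1) by (apply Rabs_le; lra).
  pose proof (Rabs_pos (s - alpha)). nra.
Qed.

Definition forcing (s : R) : R := f (clamp 0 1 s) / eps.
(** The force seen by [1 - v]: the flip exchanges the two saddles and moves [alpha] to [1 - alpha],
    so that the saddle to be left is again at 0. *)
Definition flipped_forcing (s : R) : R := - f (clamp 0 1 (1 - s)) / eps.

Lemma forcing_continuity_pt s : continuity_pt forcing s.
Proof.
  apply continuity_pt_mult; [|apply continuity_pt_const; intros ? ?; reflexivity].
  apply continuous_on_clamp_continuity_pt, Hf.
Qed.

Lemma flipped_forcing_eq s : flipped_forcing s = - forcing (1 - s).
Proof. unfold flipped_forcing, forcing, Rdiv. ring. Qed.

Lemma flip_continuity_pt s : continuity_pt (fun s => 1 - s) s.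
Proof.
  apply continuity_pt_minus; [apply continuity_pt_const; intros ? ?; reflexivity|].
  apply derivable_continuous_pt, derivable_pt_id.
Qed.

Lemma flipped_forcing_continuity_pt s : continuity_pt flipped_forcing s.
Proof.
  apply continuity_pt_ext with (fun s => - forcing (1 - s)).
  { intros t. now rewrite flipped_forcing_eq. }
  apply continuity_pt_opp. apply (continuity_pt_comp (fun s => 1 - s) forcing).
  - apply flip_continuity_pt.
  - apply forcing_continuity_pt.
Qed.

Lemma forcing_out s : s <= 0 \/ 1 <= s -> forcing s = 0.
Proof.
  intros [h|h]; unfold forcing.
  - rewrite clamp_below, (bistable_f0 _ _ Hf) by lra. apply Rmult_0_l.
  - rewrite clamp_above, (bistable_f1 _ _ Hf) by lra. apply Rmult_0_l.
Qed.

Lemma forcing_sign s : 0 < s < 1 -> s <> alpha -> 0 < forcing s * (s - alpha).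
Proof.
  intros Hs Hne. unfold forcing. rewrite clamp_id by lra.
  pose proof (bistable_sign _ _ Hf s Hs Hne).
  replace (f s / eps * (s - alpha)) with (f s * (s - alpha) / eps) by (field; lra).
  now apply Rdiv_lt_0_compat.
Qed.

Lemma forcing_alpha : forcing alpha = 0.
Proof. unfold forcing. rewrite clamp_id, (bistable_falpha _ _ Hf) by lra. apply Rmult_0_l. Qed.

Lemma forcing_bound s : Rabs (forcing s) <= Derive f alpha / eps.
Proof.
  unfold forcing, Rdiv. rewrite Rabs_mult, (Rabs_pos_eq (/ eps)).
  - apply Rmult_le_compat_r; [left; now apply Rinv_0_lt_compat|].
    apply bistable_bound, clamp_in. lra.
  - left; now apply Rinv_0_lt_compat.
Qed.

Lemma forcing_derive : is_derive forcing alpha (Derive f alpha / eps).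
Proof.
  apply is_derive_ext_loc with (fun s => f s / eps).
  - assert (Hr : 0 < Rmin alpha (1 - alpha)) by (apply Rmin_glb_lt; lra).
    exists (mkposreal _ Hr). intros s Hs. apply Rabs_def2 in Hs.
    unfold minus, plus, opp in Hs. simpl in Hs.
    pose proof (Rmin_l alpha (1 - alpha)). pose proof (Rmin_r alpha (1 - alpha)).
    unfold forcing. rewrite clamp_id by lra. reflexivity.
  - apply is_derive_ext with (fun s => / eps * f s).
    { intros t. unfold Rdiv. apply Rmult_comm. }
    unfold Rdiv. rewrite Rmult_comm. apply (is_derive_scal f).
    apply Derive_correct, (bistable_ex_derive _ _ Hf).
Qed.

Lemma forcing_damped : exists l M P, damped_data forcing alpha b (Derive f alpha / eps) l M P.
Proof.
  destruct (bistable_lin_ends _ _ Hf) as (l & Hl & Hlin).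
  assert (Hm : 0 < Derive f alpha / eps).
  { apply Rdiv_lt_0_compat; [apply (bistable_derive_pos _ _ Hf)|exact Heps]. }
  (* The bound [M] equals [m], by [bistable_lin_alpha] and [Rabs (s - alpha) <= 1]. *)
  exists (l / eps), (Derive f alpha / eps).
  apply damped_data_intro; try assumption; try apply Hb.
  - apply forcing_continuity_pt.
  - apply forcing_out.
  - apply forcing_sign.
  - apply forcing_alpha.
  - apply forcing_bound.
  - apply forcing_derive.
  - now apply Rdiv_lt_0_compat.
  - intros s Hs. unfold forcing. rewrite clamp_id by lra.
    destruct (Hlin s ltac:(lra)) as [K _].
    replace (- (f s / eps)) with (- f s / eps) by (field; lra).
    replace (l / eps * s) with (l * s / eps) by (field; lra).
    apply Rmult_le_compat_r; [left; now apply Rinv_0_lt_compat|lra].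
Qed.

Lemma flipped_forcing_damped : exists l M P,
  damped_data flipped_forcing (1 - alpha) b (Derive f alpha / eps) l M P.
Proof.
  destruct (bistable_lin_ends _ _ Hf) as (l & Hl & Hlin).
  assert (Hm : 0 < Derive f alpha / eps).
  { apply Rdiv_lt_0_compat; [apply (bistable_derive_pos _ _ Hf)|exact Heps]. }
  exists (l / eps), (Derive f alpha / eps).
  apply damped_data_intro; try assumption; try apply Hb.
  - apply flipped_forcing_continuity_pt.
  - lra.
  - intros s Hs. rewrite flipped_forcing_eq, forcing_out by lra. ring.
  - intros s Hs Hne. rewrite flipped_forcing_eq.
    pose proof (forcing_sign (1 - s) ltac:(lra) ltac:(lra)). nra.
  - rewrite flipped_forcing_eq. replace (1 - (1 - alpha)) with alpha by ring.
    rewrite forcing_alpha. ring.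
  - intros s. rewrite flipped_forcing_eq, Rabs_Ropp. apply forcing_bound.
  - apply is_derive_ext with (fun s => - forcing (1 - s)).
    { intros t. now rewrite flipped_forcing_eq. }
    pose proof forcing_derive as D.
    replace alpha with (1 - (1 - alpha)) in D at 1 by ring.
    replace (Derive f alpha / eps) with (opp (scal (- (1)) (Derive f alpha / eps)))
      by (unfold opp, scal; simpl; unfold mult; simpl; ring).
    apply (is_derive_opp (fun s => forcing (1 - s))).
    apply (is_derive_comp forcing (fun s => 1 - s)); [exact D|].
    auto_derive; [trivial|ring].
  - now apply Rdiv_lt_0_compat.
  - intros s Hs. rewrite flipped_forcing_eq. unfold forcing. rewrite clamp_id by lra.
    (* The upper bound on [f] near 1 becomes the linear bound at the flipped saddle. *)
    destruct (Hlin (1 - s) ltac:(lra)) as [_ K].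
    replace (- - (f (1 - s) / eps)) with (f (1 - s) / eps) by ring.
    replace (l / eps * s) with (l * s / eps) by (field; lra).
    apply Rmult_le_compat_r; [left; now apply Rinv_0_lt_compat|lra].
Qed.

Lemma forcing_potential_1 : 0 < potential forcing 1.
Proof.
  assert (E : RInt f 0 1 = eps * potential forcing 1).
  { unfold potential.
    rewrite (RInt_ext f (fun s => scal eps (forcing s))).
    - apply @RInt_scal. apply @ex_RInt_continuous. intros z _.
      apply continuity_pt_filterlim, forcing_continuity_pt.
    - rewrite Rmin_left, Rmax_right by lra. intros s Hs. unfold forcing.
      rewrite clamp_id by lra. unfold scal; simpl; unfold mult; simpl. field. lra. }
  pose proof (bistable_int _ _ Hf) as Hint. rewrite E in Hint.
  apply Rmult_lt_reg_l with eps; lra.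
Qed.

(** The drop is the integral of [- f / eps] over (0, alpha), that is [eps_bar f / eps], because
    [neg_part f] vanishes between [alpha] and 1. *)
Lemma flipped_potential_drop : eps <= eps_bar f ->
  1 <= potential flipped_forcing 1 - potential flipped_forcing (1 - alpha).
Proof.
  intros Hle.
  set (np := fun s => neg_part f (clamp 0 1 s)).
  assert (Cnp : forall s, continuity_pt np s).
  { intros s. pose proof (continuous_on_clamp_continuity_pt f (bistable_cont _ _ Hf) s) as C.
    apply continuity_pt_of_eps. intros e He.
    destruct (continuity_pt_eps _ s C e He) as (d & Hd & Hx). exists d. split; [exact Hd|].
    intros y Hy. specialize (Hx y Hy). revert Hx. unfold np, neg_part, Rmax, Rabs.
    repeat destruct Rle_dec; repeat destruct Rcase_abs; lra. }
  assert (Dnp : forall s, is_derive (fun s => 0 + RInt np 0 s) s (np s)).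
  { intros s. now apply is_derive_primitive. }
  set (N := fun s => 0 + RInt np 0 s) in *.
  assert (E : eps_bar f = N 1).
  { unfold N, eps_bar. rewrite Rplus_0_l. apply RInt_ext.
    rewrite Rmin_left, Rmax_right by lra. intros s Hs. unfold np. now rewrite clamp_id by lra. }
  assert (Hfle : forall s, 0 < s < alpha -> f s <= 0).
  { intros s Hs. pose proof (bistable_sign _ _ Hf s ltac:(lra) ltac:(lra)). nra. }
  assert (Hfge : forall s, alpha < s < 1 -> 0 <= f s).
  { intros s Hs. pose proof (bistable_sign _ _ Hf s ltac:(lra) ltac:(lra)). nra. }
  assert (K1 : N 1 - N alpha <= 0 * (1 - alpha)).
  { apply (derive_le_slope N np); [lra| | |].
    - intros; apply Dnp.
    - intros s _. eapply is_derive_continuity_pt, Dnp.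
    - intros s Hs. unfold np, neg_part. rewrite clamp_id by lra.
      specialize (Hfge s Hs). rewrite Rmax_right; lra. }
  (* [H] has zero derivative on (0, alpha); this replaces the change of variable from [s] to [1 - s]
     in the integral. *)
  set (H := fun s => N s - eps * (potential flipped_forcing 1 - potential flipped_forcing (1 - s))).
  assert (DH : forall s, is_derive H s (np s - eps * flipped_forcing (1 - s))).
  { intros s. apply (is_derive_minus N); [apply Dnp|].
    apply (is_derive_scal (fun s => potential flipped_forcing 1 - potential flipped_forcing (1 - s))).
    replace (flipped_forcing (1 - s)) with (minus 0 (scal (- (1)) (flipped_forcing (1 - s))))
      by (unfold minus, plus, opp, scal; simpl; unfold mult; simpl; ring).
    apply (is_derive_minus (fun _ => potential flipped_forcing 1)
      (fun s => potential flipped_forcing (1 - s))); [apply @is_derive_const|].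
    apply (is_derive_comp (potential flipped_forcing) (fun s => 1 - s)).
    - apply is_derive_ext with (fun t => 0 + RInt flipped_forcing 0 t).
      { intros t. apply Rplus_0_l. }
      apply is_derive_primitive, flipped_forcing_continuity_pt.
    - auto_derive; [trivial|ring]. }
  assert (K2 : H alpha - H 0 <= 0 * (alpha - 0)).
  { apply (derive_le_slope H (fun s => np s - eps * flipped_forcing (1 - s))); [lra| | |].
    - intros; apply DH.
    - intros s _. eapply is_derive_continuity_pt, DH.
    - intros s Hs. unfold np, neg_part, flipped_forcing.
      replace (1 - (1 - s)) with s by ring. rewrite clamp_id by lra.
      specialize (Hfle s Hs). rewrite Rmax_left by lra.
      right. field. lra. }
  assert (EH0 : H 0 = 0).
  { unfold H, N. rewrite Rminus_0_r.
    replace (RInt np 0 0) with 0 by (symmetry; apply @RInt_point). ring. }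
  rewrite EH0 in K2. unfold H in K2.
  apply Rmult_le_reg_l with eps; lra.
Qed.

(** Reflecting both time and value turns the front into [1 - v (- t)], again increasing from 0 to 1,
    for the flipped system with damping [bstar]; its phase curve is the barrier. *)
Lemma front_flipped_barrier bstar v l M P : bstar < b -> 0 <= bstar ->
  damped_data flipped_forcing (1 - alpha) b (Derive f alpha / eps) l M P ->
  increasing_front f eps bstar v -> exists Q, barrier flipped_forcing b Q bstar.
Proof.
  intros Hlt H0 Hdd (((D1 & D2 & _) & Hrange & Heq) & Hinc & Hm & Hp).
  set (Pi := fun t => phi (Derive v t)).
  assert (DPi : forall t, is_derive Pi t (bstar * psi (Pi t) - f (v t) / eps)).
  { intros t. replace (bstar * psi (Pi t) - f (v t) / eps) with (Derive Pi t).
    - apply Derive_correct. apply (ex_derive_comp phi (Derive v)); [apply phi_ex_derive|apply D2].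
    - unfold Pi at 2. rewrite psi_phi. specialize (Heq t).
      change (Derive (fun t => Derive v t / sqrt (1 + Derive v t ^ 2)) t) with (Derive Pi t) in Heq.
      lra. }
  apply (front_barrier flipped_forcing (1 - alpha) b _ l M P Hdd bstar
    (fun t => 1 - v (- t)) (fun t => Pi (- t))).
  - lra.
  - intros t. apply phi_lt_1.
  - intros t. unfold Pi. rewrite psi_phi.
    replace (Derive v (- t)) with (minus 0 (scal (- (1)) (Derive v (- t))))
      by (unfold minus, plus, opp, scal; simpl; unfold mult; simpl; ring).
    apply (is_derive_minus (fun _ => 1) (fun t => v (- t))); [apply @is_derive_const|].
    apply (is_derive_comp v Ropp); [apply Derive_correct, D1|].
    auto_derive; [trivial|ring].
  - intros t.
    replace (- bstar * psi (Pi (- t)) - flipped_forcing (1 - v (- t))) with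
      (scal (- (1)) (bstar * psi (Pi (- t)) - f (v (- t)) / eps)).
    + apply (is_derive_comp Pi Ropp); [apply DPi|]. auto_derive; [trivial|ring].
    + unfold flipped_forcing. replace (1 - (1 - v (- t))) with (v (- t)) by ring.
      rewrite clamp_id by apply Hrange.
      unfold scal; simpl; unfold mult; simpl. field. lra.
  - intros x y Hxy. pose proof (Hinc (- y) (- x) ltac:(lra)). lra.
  - replace (Finite 0) with (Rbar_minus 1 1) by (simpl; f_equal; ring).
    apply is_lim_minus'; [apply is_lim_const|]. now apply (is_lim_opp_arg v m_infty).
  - replace (Finite 1) with (Rbar_minus 1 0) by (simpl; f_equal; ring).
    apply is_lim_minus'; [apply is_lim_const|]. now apply (is_lim_opp_arg v p_infty).
Qed.

Lemma solution_to_0 : exists v, solution f eps b v /\ nonmonotone v /\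
  is_lim v m_infty alpha /\ is_lim v p_infty 0 /\ eventually_decreasing v.
Proof.
  destruct forcing_damped as (l & M & P & Hdd).
  destruct (connection forcing alpha b _ l M P Hdd) as
    (u & p & Htr & Hr & Hl0 & Hla & Hinc & Hu0 & (t1 & Ht1)).
  { left. apply forcing_potential_1. }
  exists (fun z => u (- z)). split; [|split; [|split; [|split]]].
  (* Time reversal changes the sign of the slope, hence of [p]. *)
  - apply (solution_intro f eps b _ (fun z => - p (- z))).
    + apply Hf.
    + intros z. specialize (Hr (- z)). lra.
    + intros z. rewrite Rabs_Ropp. apply (traj_abs_lt_1 _ _ _ _ _ _ _ Hdd 0 u p (Htr 0)).
    + intros z. rewrite psi_opp.
      replace (- psi (p (- z))) with (scal (- (1)) (psi (p (- z))))
        by (unfold scal; simpl; unfold mult; simpl; ring).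
      apply (is_derive_comp u Ropp); [apply (Htr (- z - 1)); lra|].
      auto_derive; [trivial|ring].
    + intros z. rewrite psi_opp.
      replace (b * - psi (p (- z)) - f (u (- z)) / eps) with
        (opp (scal (- (1)) (- b * psi (p (- z)) - forcing (u (- z))))).
      * apply (is_derive_opp (fun z => p (- z))).
        apply (is_derive_comp p Ropp); [apply (Htr (- z - 1)); lra|].
        auto_derive; [trivial|ring].
      * unfold forcing. specialize (Hr (- z)). rewrite clamp_id by lra.
        unfold opp, scal; simpl; unfold mult; simpl. ring.
  - apply (nonmonotone_of_limit _ alpha 0 (- t1)).
    + now apply (is_lim_opp_arg u m_infty).
    + rewrite Ropp_0, Ropp_involutive. lra.
  - now apply (is_lim_opp_arg u m_infty).
  - now apply (is_lim_opp_arg u p_infty).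
  - exists 0. intros x y Hx Hxy. apply Hinc; lra.
Qed.

Lemma solution_to_1 bstar : is_b_star f eps bstar -> bstar < b ->
  exists v, solution f eps b v /\ nonmonotone v /\
  is_lim v m_infty alpha /\ is_lim v p_infty 1 /\ eventually_increasing v.
Proof.
  intros [Hlarge Hsmall] Hlt.
  destruct flipped_forcing_damped as (l & M & P & Hdd).
  destruct (connection flipped_forcing (1 - alpha) b _ l M P Hdd) as
    (u & p & Htr & Hr & Hl0 & Hla & Hinc & Hu0 & (t1 & Ht1)).
  { right. destruct (Rle_lt_dec eps (eps_bar f)) as [h|h].
    - left. now apply flipped_potential_drop.
    - right. destruct (proj1 (Hlarge h)) as (H0 & v & Hv).
      destruct (front_flipped_barrier bstar v l M P Hlt H0 Hdd Hv) as (Q & HQ).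
      now exists Q, bstar. }
  assert (Hlim : forall x y : R, forall z : Rbar, is_lim u (Rbar_opp z) x -> y = 1 - x ->
    is_lim (fun z => 1 - u (- z)) z y).
  { intros x y z H ->. apply (is_lim_minus' (fun _ => 1) (fun z => u (- z))).
    - apply is_lim_const.
    - now apply is_lim_opp_arg. }
  exists (fun z => 1 - u (- z)). split; [|split; [|split; [|split]]].
  (* The reflections of time and value cancel: the slope keeps the sign of [p]. *)
  - apply (solution_intro f eps b _ (fun z => p (- z))).
    + apply Hf.
    + intros z. specialize (Hr (- z)). lra.
    + intros z. apply (traj_abs_lt_1 _ _ _ _ _ _ _ Hdd 0 u p (Htr 0)).
    + intros z.
      replace (psi (p (- z))) with (minus 0 (scal (- (1)) (psi (p (- z)))))
        by (unfold minus, plus, opp, scal; simpl; unfold mult; simpl; ring).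
      apply (is_derive_minus (fun _ => 1) (fun z => u (- z))); [apply @is_derive_const|].
      apply (is_derive_comp u Ropp); [apply (Htr (- z - 1)); lra|].
      auto_derive; [trivial|ring].
    + intros z.
      replace (b * psi (p (- z)) - f (1 - u (- z)) / eps) with
        (scal (- (1)) (- b * psi (p (- z)) - flipped_forcing (u (- z)))).
      * apply (is_derive_comp p Ropp); [apply (Htr (- z - 1)); lra|].
        auto_derive; [trivial|ring].
      * unfold flipped_forcing. specialize (Hr (- z)). rewrite clamp_id by lra.
        unfold scal; simpl; unfold mult; simpl. field. lra.
  - apply (nonmonotone_of_limit _ alpha (- t1) 0).
    + apply (Hlim (1 - alpha)); [exact Hla|ring].
    + rewrite Ropp_0, Ropp_involutive. lra.
  - apply (Hlim (1 - alpha)); [exact Hla|ring].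
  - apply (Hlim 0); [exact Hl0|ring].
  - exists 0. intros x y Hx Hxy. specialize (Hinc (- y) (- x) ltac:(lra) ltac:(lra)). lra.
Qed.

End Bistable.

Theorem theorem2p5 :
  forall (f : R -> R) (alpha eps : R),
    bistable f alpha ->
    0 < eps ->
    (forall bstar b : R,
       is_b_star f eps bstar ->
       bstar < b < b_plus f alpha eps ->
       exists v : R -> R,
         solution f eps b v /\
         nonmonotone v /\
         is_lim v m_infty alpha /\
         is_lim v p_infty 1 /\
         eventually_increasing v) /\
    (forall b : R,
       0 < b < b_plus f alpha eps ->
       exists v : R -> R,
         solution f eps b v /\
         nonmonotone v /\
         is_lim v m_infty alpha /\
         is_lim v p_infty 0 /\
         eventually_decreasing v).
Proof.
  intros f alpha eps Hf Heps. split.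
  - intros bstar b Hstar [Hlt Hlt'].
    assert (H0 : 0 <= bstar).
    { destruct Hstar as [Hlarge Hsmall].
      destruct (Rle_lt_dec eps (eps_bar f)) as [h|h].
      - rewrite (Hsmall h). lra.
      - now destruct (Hlarge h) as [[H0 _] _]. }
    apply (solution_to_1 f alpha eps b Hf Heps ltac:(lra) bstar Hstar Hlt).
  - intros b Hb. now apply (solution_to_0 f alpha eps b).
Qed.
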